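(* For all $F\in\mathbb{D}$ with chaotic representation $F=\int_{\mathcal{P}}f(A)\,dB_A$, $$\frac{dF^\theta}{d\theta}\Big|_{\theta=0}=\frac{d}{d\theta}\int_{\mathcal{P}}f(A)\,d(B\cos\theta+M\sin\theta)_A\Big|_{\theta=0}=\int D_sF\,dM_s .$$ The right-hand term, denoted $F^\sharp$, is a gradient for the Ornstein-Uhlenbeck form, and in the sense of $L^2(\mathbb{P})=L^2(\mathbb{P}_1\times\mathbb{P}_2)$ $$F^\sharp=\lim_{\theta\to0}\frac1\theta\,(F^\theta-F).$$
   Context: $B$ is a standard one-dimensional Brownian motion on the Wiener space $(\Omega_1,\mathbb{P}_1)$. $M$ is a normal martingale (a square integrable martingale with $M_0=0$ and $\langle M,M\rangle_t=t$) defined under a probability $\mathbb{P}_2$; $\mathbb{P}=\mathbb{P}_1\times\mathbb{P}_2$, so $M$ is independent of $B$. For $\theta\in\mathbb{R}$, $Y^\theta_t=B_t\cos\theta+M_t\sin\theta$, a normal martingale with $Y^0=B$. $\mathcal{P}$ is the set of finite subsets $A=\{s_1<\cdots<s_n\}$ of $]0,\infty[$, with the measure $dA$ whose restriction to each simplex is Lebesgue measure (unit mass at $\emptyset$). Every $F\in L^2(\mathbb{P}_1)$ with Wiener chaos expansion $F=\sum_n I_n(f_n)$ ($f_n\in L^2(\mathbb{R}_+^n)$ symmetric) is written $F=\int_{\mathcal{P}}f(A)\,dB_A$ with $f=(n!f_n)_n\in L^2(\mathcal{P})$, and its chaotic extension is $$F^\theta=\int_{\mathcal{P}}f(A)\,dY^\theta_A=f(\emptyset)+\sum_{n>0}\int_{s_1<\cdots<s_n}f(s_1,\ldots,s_n)\,dY^\theta_{s_1}\cdots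 dY^\theta_{s_n}\in L^2(\mathbb{P}).$$ $\mathbb{D}$ is the domain of the Ornstein-Uhlenbeck form: $F\in\mathbb{D}$ iff $\sum_n n\,n!\,\|f_n\|^2_{L^2}<\infty$. $D$ is the Malliavin derivative and $\Gamma[F]=\int_0^\infty(D_sF)^2ds$ the carré du champ. Since $DF$ depends only on $\omega_1$ and $M$ only on $\omega_2$, $\int D_sF\,dM_s$ is the Wiener-type integral of $s\mapsto D_sF(\omega_1)$ against $M$ for fixed $\omega_1$, an element of $L^2(\mathbb{P}_1\times\mathbb{P}_2)$. ''Gradient for the Ornstein-Uhlenbeck form'' means that $F\mapsto F^\sharp$ is a linear operator on $\mathbb{D}$ with values in $L^2(\mathbb{P}_1\times\mathbb{P}_2)$ with $\mathbb{E}_{\mathbb{P}_2}[(F^\sharp)^2]=\Gamma[F]$ $\mathbb{P}_1$-a.s. *)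

(* Defs.v *)
From HB Require Import structures.
From mathcomp Require Import all_boot all_order perm all_algebra.
From mathcomp Require Import all_classical all_reals all_analysis.
Set Implicit Arguments.
Unset Strict Implicit.
Unset Printing Implicit Defensive.
Import Order.TTheory GRing.Theory Num.Theory.
Import numFieldNormedType.Exports.
Local Open Scope classical_set_scope.
Local Open Scope ring_scope.

Section nlebesgue.
Variable R : realType.
Local Notation mR := (measurableTypeR R).

Definition consT (n : nat) (p : mR * n.-tuple mR) : n.+1.-tuple mR :=
  [tuple of p.1 :: p.2].

Lemma measurable_consT n : measurable_fun setT (@consT n).
Proof. exact: measurable_cons. Qed.

Section step.
Variables (n : nat) (m : {sigma_finite_measure set (n.-tuple mR) -> \bar R}).

Definition nleb_succ : set (n.+1.-tuple mR) -> \bar R :=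
  pushforward (@lebesgue_measure R \x m)%E (@consT n).

Let nleb_succ0 : nleb_succ set0 = 0%E.
Proof. by rewrite /nleb_succ /pushforward preimage_set0 measure0. Qed.

Let nleb_succ_ge0 A : (0 <= nleb_succ A)%E.
Proof. by rewrite /nleb_succ /pushforward measure_ge0. Qed.

Let nleb_succ_sigma_additive : semi_sigma_additive nleb_succ.
Proof.
pose mu := measure_function_pushforward__canonical__measure_function_Measure
  (@lebesgue_measure R \x m)%E (@measurable_consT n).
exact: (@measure_semi_sigma_additive _ _ _ mu).
Qed.

HB.instance Definition _ := isMeasure.Build _ _ _ nleb_succ
  nleb_succ0 nleb_succ_ge0 nleb_succ_sigma_additive.

Let unconsT (x : n.+1.-tuple mR) : mR * n.-tuple mR :=
  (thead x, [tuple of behead x]).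

Let unconsTK p : unconsT (consT p) = p.
Proof.
by case: p => s x; congr pair; apply/val_inj.
Qed.

Let measurable_unconsT : measurable_fun setT unconsT.
Proof.
apply/measurable_fun_pairP; split; last exact: measurable_behead.
exact: measurable_tnth.
Qed.

Let nleb_succ_sigma_finite : sigma_finite setT nleb_succ.
Proof.
have [F FT Ffin] : sigma_finite setT (@lebesgue_measure R \x m)%E.
  by case: (lebesgue_integral_fubini.measure_function_Measure_isSigmaFinite__to__measure_function_isSigmaFinite
    (@lebesgue_measure R) m).
exists (fun k => unconsT @^-1` F k).
  by rewrite -preimage_bigcup -FT preimage_setT.
move=> k; have [mF Foo] := Ffin k; split.
  by rewrite -[X in measurable X]setTI; exact: measurable_unconsT.
rewrite /nleb_succ /pushforward -comp_preimage.
by rewrite (_ : unconsT \o @consT n = id) ?preimage_id//; apply/funext.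
Qed.

HB.instance Definition _ := Measure_isSigmaFinite.Build _ _ _ nleb_succ
  nleb_succ_sigma_finite.

End step.

(* Lebesgue measure on R^n (one coordinate at a time); for n = 0, the unit mass on the empty tuple *)
Fixpoint nlebesgue (n : nat) :
    {sigma_finite_measure set (n.-tuple mR) -> \bar R} :=
  match n with
  | 0 => dirac ([tuple] : 0.-tuple mR)
  | n.+1 => nleb_succ (nlebesgue n)
  end.

End nlebesgue.

Section square_integrable.
Context {d : measure_display} {T : measurableType d} {R : realType}.

Definition sqnorm (mu : {measure set T -> \bar R}) (D : set T) (f : T -> R) :
    \bar R :=
  (\int[mu]_(x in D) (f x ^+ 2)%:E)%E.

Definition L2 (mu : {measure set T -> \bar R}) (D : set T) (f : T -> R) :=
  measurable_fun D f /\ (sqnorm mu D f < +oo)%E.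

End square_integrable.

Section processes.
Context {d : measure_display} {T : measurableType d} {R : realType}.

(* Processes are functions R -> T -> R of which only the values at nonnegative
   times matter. *)

Definition filtration (G : R -> set (set T)) :=
  [/\ forall t, 0 <= t -> sigma_algebra setT (G t),
      forall t, 0 <= t -> G t `<=` measurable &
      forall s t, 0 <= s -> s <= t -> G s `<=` G t].

Definition martingale (P : probability T R) (G : R -> set (set T))
    (X : R -> T -> R) :=
  [/\ forall t (U : set R), 0 <= t -> measurable U -> G t (X t @^-1` U),
      forall t, 0 <= t -> P.-integrable setT (EFin \o X t) &
      forall s t (A : set T), 0 <= s -> s <= t -> G s A ->
        (\int[P]_(w in A) (X t w)%:E = \int[P]_(w in A) (X s w)%:E)%E].

(* The last condition is <M, M>_t = t: the predictable bracket is the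
   predictable increasing process A such that M^2 - A is a martingale. *)
Definition normal_martingale (P : probability T R) (M : R -> T -> R) :=
  exists G : R -> set (set T),
    [/\ filtration G, martingale P G M,
        forall t, 0 <= t -> L2 P setT (M t),
        {ae P, forall w, M 0 w = 0} &
        martingale P G (fun t w => M t w ^+ 2 - t)].

Definition history (X : R -> T -> R) (I : set R) : set (set T) :=
  let cyl := [set A | exists t (U : set R),
                        [/\ I t, measurable U & A = X t @^-1` U]] in
  <<s cyl >>.

(* [normal_prob m s] is parameterized by the standard deviation s. *)
Definition brownian_motion (P : probability T R) (B : R -> T -> R) :=
  [/\ forall t, 0 <= t -> measurable_fun setT (B t),
      {ae P, forall w, B 0 w = 0},
      {ae P, forall w, {within `[0, +oo[, continuous (fun t => B t w)}},
      forall s t (U : set R), 0 <= s -> s < t -> measurable U ->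
        P ((B t \- B s) @^-1` U)
          = normal_prob 0 (Num.sqrt (t - s)) U &
      forall s t (A : set T) (U : set R), 0 <= s -> s < t ->
        history B `[0, s] A -> measurable U ->
        P (A `&` (B t \- B s) @^-1` U)
          = (P A * P ((B t \- B s)%R @^-1` U))%E].

(* A probability space carrying a Brownian motion which generates its
   sigma-algebra up to null sets. *)
Definition wiener_space (P : probability T R) (B : R -> T -> R) :=
  brownian_motion P B /\
  forall A : set T, measurable A ->
    exists2 A', history B `[0, +oo[ A' & P (A `+` A') = 0%E.

End processes.

Section chaos.
Context {R : realType}.
Local Notation mR := (measurableTypeR R).
Local Notation Rn n := (n.-tuple mR).

Definition orthant (n : nat) : set (Rn n) :=
  [set x | forall i : 'I_n, 0 <= (tnth x i : R)].

Definition simplex (n : nat) : set (Rn n) :=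
  [set x | (forall i : 'I_n, 0 < (tnth x i : R)) /\
           (forall i j : 'I_n, (i < j)%N -> (tnth x i : R) < (tnth x j : R))].

(* The rectangle prod_i ]s_i, t_i], given as the tuple of the (s_i, t_i). *)
Definition rectangle_in_simplex (n : nat) (b : n.-tuple (R * R)) :=
  (forall i : 'I_n, 0 <= (tnth b i).1 <= (tnth b i).2) /\
  (forall i j : 'I_n, (i < j)%N -> (tnth b i).2 <= (tnth b j).1).

(* A list of pairs (a, b) stands for the step function sum a 1_b. *)
Definition step_fun (n : nat) (c : seq (R * n.-tuple (R * R))) (x : Rn n) : R :=
  \sum_(p <- c) p.1 * \prod_(i < n)
    \1_(`](tnth p.2 i).1, (tnth p.2 i).2]%classic) (tnth x i).

Definition step_int (T : Type) (Y : R -> T -> R) (n : nat)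
    (c : seq (R * n.-tuple (R * R))) (w : T) : R :=
  \sum_(p <- c) p.1 * \prod_(i < n)
    (Y (tnth p.2 i).2 w - Y (tnth p.2 i).1 w).

Context {d : measure_display} {T : measurableType d}.
Implicit Types (P : {measure set T -> \bar R}) (Y : R -> T -> R) (X : T -> R).

(* X = int_{s_1 < ... < s_n} f(s_1, ..., s_n) dY_{s_1} ... dY_{s_n}, the
   L^2-closure of the iterated integral of step functions (for a normal
   martingale Y it is an isometry on L^2 of the simplex); X = f([tuple])
   almost surely for n = 0. *)
Definition iterated_integral P Y (n : nat) (f : Rn n -> R) X :=
  [/\ L2 (nlebesgue R n) (@simplex n) f, L2 P setT X &
      exists c : nat -> seq (R * n.-tuple (R * R)),
        [/\ forall k p, p \in c k -> rectangle_in_simplex p.2,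
            (fun k => sqnorm (nlebesgue R n) (@simplex n)
                        (fun x => step_fun (c k) x - f x)) @ \oo --> 0%E &
            (fun k => sqnorm P setT
                        (fun w => step_int Y (c k) w - X w)) @ \oo --> 0%E]].

(* A function on the finite subsets of ]0, oo[ is given as a family f, where
   f n x is its value at {x_1 < ... < x_n}; then this is X = int f(A) dY_A. *)
Definition chaos_integral P Y (f : forall n, Rn n -> R) X :=
  L2 P setT X /\
  exists J : nat -> T -> R,
    (forall n, iterated_integral P Y (@f n) (J n)) /\
    (fun N => sqnorm P setT (fun w => \sum_(0 <= n < N) J n w - X w))
      @ \oo --> 0%E.

Definition symmetric_kernels (f : forall n, Rn n -> R) :=
  forall n (s : 'S_n) (x : Rn n), f n [tuple tnth x (s i) | i < n] = f n x.

(* f = (n! f_n)_n as a function on finite sets, for symmetric kernels f_n *)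
Definition set_kernel (f : forall n, Rn n -> R) (n : nat) (x : Rn n) : R :=
  n`!%:R * f n x.

(* X = sum_n I_n(f_n) *)
Definition chaos_expansion P Y (f : forall n, Rn n -> R) X :=
  [/\ symmetric_kernels f,
      forall n, L2 (nlebesgue R n) (@orthant n) (f n) &
      chaos_integral P Y (set_kernel f) X].

Definition finite_energy (f : forall n, Rn n -> R) :=
  (\sum_(0 <= n <oo)
     (n * n`!)%:R%:E * sqnorm (nlebesgue R n) (@orthant n) (f n) < +oo)%E.

Definition ou_domain P B (F : T -> R) :=
  exists2 f, chaos_expansion P B f F & finite_energy f.

(* D_s F = sum_{n >= 1} n I_{n-1}(f_n(s, .)) *)
Definition derivative_kernels (f : forall n, Rn n -> R) (s : R) (n : nat)
    (x : Rn n) : R :=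
  n.+1%:R * f n.+1 [tuple of (s : mR) :: x].

Definition malliavin_derivative P B (F : T -> R) (DF : T -> R -> R) :=
  exists2 f, chaos_expansion P B f F /\ finite_energy f &
    L2 (P \x @lebesgue_measure R)%E (setT `*` `]0, +oo[)
       (fun p : T * mR => DF p.1 p.2) /\
    {ae @lebesgue_measure R, forall s : mR, 0 < (s : R) ->
      chaos_expansion P B (derivative_kernels f s) (DF ^~ s)}.

Definition carre_du_champ (DF : T -> R -> R) (w : T) : \bar R :=
  sqnorm (@lebesgue_measure R) `]0, +oo[ (DF w).

End chaos.

Section two_spaces.
Context {R : realType} {d1 d2 : measure_display}
  {T1 : measurableType d1} {T2 : measurableType d2}.
Variables (P1 : probability T1 R) (P2 : probability T2 R)
  (B : R -> T1 -> R) (M : R -> T2 -> R).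
Local Notation P := (P1 \x P2)%E.

Definition rotated (theta t : R) (w : T1 * T2) : R :=
  B t w.1 * cos theta + M t w.2 * sin theta.

(* G = int D_s F dM_s, for almost every fixed first coordinate *)
Definition integral_dM (DF : T1 -> R -> R) (G : T1 * T2 -> R) :=
  L2 P setT G /\
  {ae P1, forall w1, iterated_integral P2 M
    (fun x : 1.-tuple (measurableTypeR R) => DF w1 (thead x))
    (fun w2 => G (w1, w2))}.

Definition sharp_operator (S : (T1 -> R) -> T1 * T2 -> R) :=
  forall F, ou_domain P1 B F ->
    exists2 DF, malliavin_derivative P1 B F DF & integral_dM DF (S F).

Definition ou_gradient (S : (T1 -> R) -> T1 * T2 -> R) :=
  [/\ forall F, ou_domain P1 B F -> L2 P setT (S F),
      forall F H, ou_domain P1 B F -> ou_domain P1 B H ->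
        {ae P1, forall w, F w = H w} -> {ae P, forall w, S F w = S H w},
      forall (a : R) F H, ou_domain P1 B F -> ou_domain P1 B H ->
        ou_domain P1 B (fun w => a * F w + H w) /\
        {ae P, forall w, S (fun w1 => a * F w1 + H w1) w = a * S F w + S H w} &
      forall F DF, ou_domain P1 B F -> malliavin_derivative P1 B F DF ->
        {ae P1, forall w1,
          sqnorm P2 setT (fun w2 => S F (w1, w2)) = carre_du_champ DF w1}].

Definition L2_lim0 (V : R -> T1 * T2 -> R) (G : T1 * T2 -> R) :=
  (fun theta => sqnorm P setT (fun w => V theta w - G w)) @ 0^' --> 0%E.

End two_spaces.

(* Main.v *)
Require Import Defs.
From HB Require Import structures.
From mathcomp Require Import all_boot all_order perm all_algebra.
From mathcomp Require Import all_classical all_reals all_analysis.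
From mathcomp Require Import measurable_realfun zify ring lra.
Set Implicit Arguments.
Unset Strict Implicit.
Unset Printing Implicit Defensive.
Import Order.TTheory GRing.Theory Num.Theory.
Import numFieldNormedType.Exports.
Local Open Scope classical_set_scope.
Local Open Scope ring_scope.

(** If an increment of Y is multiplied by a square integrable variable that
    depends on its past only, the inner products of such products are reduced,
    one interval at a time, to overlaps of intervals. Hence the products of n
    increments of Y^theta over increasing intervals satisfy the same isometry
    for all theta, those of Y^theta and Y^phi have cos (theta - phi) ^ n as
    additional factor, and the derivative G of the product at theta = 0, in
    which each increment of B in turn is replaced by one of M, has n as factor.
    All of these, as well as DF (replace the increment of B over I by the
    indicator of I at s), extend to L^2 kernels by linearity and completeness;
    for fixed omega_1, G is the integral of D_s F against M already for step
    kernels, and this passes to the limit along fast subsequences.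
    Chaos by chaos, the squared norm of (F^theta - F) / theta - F^sharp is the
    n-th term of the energy of F times a factor that is at most 4 and tends to
    0 with theta, so that dominated convergence of series concludes. *)

(** A chaos expansion comes with approximating step kernels. The same steps, or their slices at a
    time s, serve for Y^theta, G, DF and D_s F, and each isometry turns their convergence into the
    existence of an integral. Integrals are relations that determine their value up to null sets
    only, so [S] is an arbitrary choice and everything said about it rests on uniqueness, which
    again comes from the isometries. The isometry of DF in omega_1 and s is transported from that of
    G, fiber by fiber. The levels of the remainder Y^theta - Y^0 - theta G are orthogonal as well,
    so its norm is an explicit series. The bound 4 comes from 1 - cos^n theta <= n (1 - cos theta)
    <= n theta^2 / 2 and |sin theta| <= |theta|. The variables known at a given time are abstract
    classes closed under linear combinations; on the product space these classes consist of finite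
    sums of tensors, for which inner products factorize. *)

Lemma cvge0P (R : realType) (I : Type) (F : set_system I) {FF : Filter F}
    (u : I -> \bar R) : (forall i, 0 <= u i)%E ->
  u @ F --> 0%E <->
    forall e : R, 0 < e -> \forall i \near F, (u i <= e%:E)%E.
Proof.
move=> u0; split=> [/fine_cvgP[ufin /cvgrPdist_le ucvg] e e0|h].
  near=> i.
  have uifin : u i \is a fin_num by near: i.
  rewrite -(fineK uifin) lee_fin.
  have : `|0 - (fine \o u) i| <= e by near: i; exact: ucvg.
  by rewrite sub0r normrN /= ger0_norm// fine_ge0.
have ufin : \forall i \near F, u i \is a fin_num.
  apply: filterS (h 1 ltr01) => i ui.
  by rewrite ge0_fin_numE// (le_lt_trans ui)// ltry.
apply/fine_cvgP; split => //; apply/cvgrPdist_le => e e0.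
near=> i; rewrite sub0r normrN /= ger0_norm ?fine_ge0//.
have uifin : u i \is a fin_num by near: i.
by rewrite -lee_fin fineK//; near: i; exact: h.
Unshelve. all: by end_near. Qed.

Lemma cvge0_seqP (R : realType) (u : nat -> \bar R) : (forall i, 0 <= u i)%E ->
  u @ \oo --> 0%E <->
    forall e : R, 0 < e -> exists N, forall k, (N <= k)%N -> (u k <= e%:E)%E.
Proof.
move=> u0; rewrite cvge0P//; split=> h e e0.
  by have [N _ hN] := h e e0; exists N => k Nk; exact: hN.
by have [N hN] := h e e0; exists N.
Qed.

Lemma sqr_add_le (R : realDomainType) (a b : R) :
  (a + b) ^+ 2 <= 2 * a ^+ 2 + 2 * b ^+ 2.
Proof. by have := sqr_ge0 (a - b); nra. Qed.

(** * Square integrable functions *)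

(** Real valued, so that bilinear identities become ring identities. It is meaningful for square
    integrable arguments; an infinite integral would be read as 0. *)
Definition ip d (T : measurableType d) (R : realType)
    (mu : {measure set T -> \bar R}) (D : set T) (f g : T -> R) : R :=
  \int[mu]_(x in D) (f x * g x).

Lemma ipE d (T : measurableType d) (R : realType)
    (mu : {measure set T -> \bar R}) (D : set T) (f g : T -> R) :
  ip mu D f g = \int[mu]_(x in D) (f x * g x).
Proof. by []. Qed.

Section L2_space.
Context d (T : measurableType d) (R : realType).
Variables (mu : {measure set T -> \bar R}) (D : set T).
Hypothesis mD : measurable D.
Local Notation L2 := (L2 mu D).
Local Notation ip := (ip mu D).
Local Notation sqnorm := (sqnorm mu D).
Implicit Types f g h : T -> R.

Lemma sqnorm_ge0 f : (0 <= sqnorm f)%E.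
Proof. by apply: integral_ge0 => x _; rewrite lee_fin sqr_ge0. Qed.

Lemma L2_measurable f : L2 f -> measurable_fun D f.
Proof. by case. Qed.

Lemma L2_integrable_sqr f : L2 f -> mu.-integrable D (fun x => (f x ^+ 2)%:E).
Proof.
move=> [mf fi]; apply/integrableP; split.
  by apply/measurable_EFinP; exact: measurable_funX.
rewrite (eq_integral (fun x => (f x ^+ 2)%:E))// => x _.
by rewrite gee0_abs// lee_fin sqr_ge0.
Qed.

Lemma L2_integrableM f g : L2 f -> L2 g ->
  mu.-integrable D (fun x => (f x * g x)%:E).
Proof.
move=> Lf Lg.
apply: (le_integrable mD _ _
  (integrableD mD (L2_integrable_sqr Lf) (L2_integrable_sqr Lg))).
  by apply/measurable_EFinP; apply: measurable_funM; apply: L2_measurable.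
move=> x _ /=; rewrite lee_fin [leRHS]ger0_norm ?addr_ge0 ?sqr_ge0//.
rewrite ler_norml; apply/andP; split.
  by have := sqr_ge0 (f x + g x); have := sqr_ge0 (f x - g x); nra.
by have := sqr_ge0 (f x + g x); have := sqr_ge0 (f x - g x); nra.
Qed.

Lemma sqnorm_add_le f g : measurable_fun D f -> measurable_fun D g ->
  (sqnorm (fun x => f x + g x)%R <= 2%:E * sqnorm f + 2%:E * sqnorm g)%E.
Proof.
move=> mf mg.
have mf2 : measurable_fun D (fun x => (f x ^+ 2)%:E).
  by apply/measurable_EFinP; exact: measurable_funX.
have mg2 : measurable_fun D (fun x => (g x ^+ 2)%:E).
  by apply/measurable_EFinP; exact: measurable_funX.
rewrite /sqnorm -!ge0_integralZl//; try by move=> x _; rewrite lee_fin sqr_ge0.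
rewrite -ge0_integralD//; try by move=> x _; rewrite lee_fin mulr_ge0 ?sqr_ge0.
- apply: ge0_le_integral => //.
  + by move=> x _; rewrite lee_fin sqr_ge0.
  + by apply/measurable_EFinP; apply/measurable_funX/measurable_funD.
  + by apply: emeasurable_funD; exact: measurable_funeM.
  + by move=> x _; rewrite lee_fin sqr_add_le.
- exact: measurable_funeM.
- exact: measurable_funeM.
Qed.

Lemma sqnormZ a f : measurable_fun D f ->
  sqnorm (fun x => a * f x) = ((a ^+ 2)%:E * sqnorm f)%E.
Proof.
move=> mf; rewrite /sqnorm -ge0_integralZl//.
- by apply: eq_integral => x _; rewrite exprMn.
- by apply/measurable_EFinP; exact: measurable_funX.
- by move=> x _; rewrite lee_fin sqr_ge0.
- by rewrite lee_fin sqr_ge0.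
Qed.

Lemma L2D f g : L2 f -> L2 g -> L2 (fun x => f x + g x).
Proof.
move=> [mf fi] [mg gi]; split; first exact: measurable_funD.
apply: (le_lt_trans (sqnorm_add_le mf mg)).
by rewrite lte_add_pinfty// lte_mul_pinfty ?sqnorm_ge0.
Qed.

Lemma L2Z a f : L2 f -> L2 (fun x => a * f x).
Proof.
move=> [mf fi]; split.
  by apply: measurable_funM => //; exact: measurable_cst.
by rewrite sqnormZ// lte_mul_pinfty ?lee_fin ?sqr_ge0.
Qed.

Lemma L2N f : L2 f -> L2 (fun x => - f x).
Proof.
move=> Lf; rewrite (_ : (fun x => - f x) = fun x => -1 * f x); first exact: L2Z.
by apply/funext => x; rewrite mulN1r.
Qed.

Lemma L2B f g : L2 f -> L2 g -> L2 (fun x => f x - g x).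
Proof. by move=> Lf Lg; apply: L2D => //; exact: L2N. Qed.

Lemma L2_0 : L2 (fun=> 0).
Proof.
split; first exact: measurable_cst.
by rewrite /sqnorm/= expr0n/= integral0 ltry.
Qed.

Lemma L2_sum (I : eqType) (s : seq I) (F : I -> T -> R) :
  (forall i, i \in s -> L2 (F i)) -> L2 (fun x => \sum_(i <- s) F i x).
Proof.
elim: s => [_|i s ih h].
  by under eq_fun do rewrite big_nil; exact: L2_0.
under eq_fun do rewrite big_cons.
apply: L2D; first by apply: h; rewrite mem_head.
by apply: ih => j js; apply: h; rewrite in_cons js orbT.
Qed.

Lemma ipC f g : ip f g = ip g f.
Proof. by apply: eq_Rintegral => x _; rewrite mulrC. Qed.

Lemma ipDl f g h : L2 f -> L2 g -> L2 h ->
  ip (fun x => f x + g x) h = ip f h + ip g h.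
Proof.
move=> Lf Lg Lh; rewrite /ip -RintegralD//; last 2 first.
- exact: L2_integrableM.
- exact: L2_integrableM.
by apply: eq_Rintegral => x _; rewrite mulrDl.
Qed.

Lemma ipZl a f h : L2 f -> L2 h -> ip (fun x => a * f x) h = a * ip f h.
Proof.
move=> Lf Lh; rewrite /ip -RintegralZl//; last exact: L2_integrableM.
by apply: eq_Rintegral => x _; rewrite mulrA.
Qed.

Lemma ipNl f h : L2 f -> L2 h -> ip (fun x => - f x) h = - ip f h.
Proof.
move=> Lf Lh; rewrite -mulN1r -ipZl//.
by congr ip; apply/funext => x; rewrite mulN1r.
Qed.

Lemma ipBl f g h : L2 f -> L2 g -> L2 h ->
  ip (fun x => f x - g x) h = ip f h - ip g h.
Proof. by move=> Lf Lg Lh; rewrite ipDl ?ipNl//; exact: L2N. Qed.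

Lemma ip0l h : ip (fun=> 0) h = 0.
Proof.
by rewrite /ip; under eq_Rintegral do rewrite mul0r; rewrite /Rintegral integral0.
Qed.

Lemma ip0r h : ip h (fun=> 0) = 0.
Proof. by rewrite ipC ip0l. Qed.

Lemma ip_suml (I : eqType) (s : seq I) (F : I -> T -> R) h :
  (forall i, i \in s -> L2 (F i)) -> L2 h ->
  ip (fun x => \sum_(i <- s) F i x) h = \sum_(i <- s) ip (F i) h.
Proof.
elim: s => [_ Lh|i s ih hs Lh].
  by under eq_fun do rewrite big_nil; rewrite big_nil ip0l.
have hs' j : j \in s -> L2 (F j).
  by move=> js; apply: hs; rewrite in_cons js orbT.
under eq_fun do rewrite big_cons.
rewrite big_cons ipDl ?ih//; last exact: L2_sum.
by apply: hs; rewrite mem_head.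
Qed.

Lemma ipDr f g h : L2 f -> L2 g -> L2 h ->
  ip h (fun x => f x + g x) = ip h f + ip h g.
Proof. by move=> *; rewrite ipC ipDl// !(ipC h). Qed.

Lemma ipZr a f h : L2 f -> L2 h -> ip h (fun x => a * f x) = a * ip h f.
Proof. by move=> *; rewrite ipC ipZl// (ipC h). Qed.

Lemma ipBr f g h : L2 f -> L2 g -> L2 h ->
  ip h (fun x => f x - g x) = ip h f - ip h g.
Proof. by move=> *; rewrite ipC ipBl// !(ipC h). Qed.

Lemma ip_sumr (I : eqType) (s : seq I) (F : I -> T -> R) h :
  (forall i, i \in s -> L2 (F i)) -> L2 h ->
  ip h (fun x => \sum_(i <- s) F i x) = \sum_(i <- s) ip h (F i).
Proof.
by move=> *; rewrite ipC ip_suml//; apply: eq_bigr => i _; rewrite ipC.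
Qed.

Lemma ip_ge0 f : 0 <= ip f f.
Proof. by apply: Rintegral_ge0 => x _; rewrite -expr2 sqr_ge0. Qed.

Lemma sqnormE f : L2 f -> sqnorm f = (ip f f)%:E.
Proof.
move=> Lf; rewrite /ip /Rintegral fineK.
  by apply: eq_integral => x _; rewrite expr2.
by apply: integrable_fin_num => //; exact: L2_integrableM.
Qed.

Lemma ip_sub_sqr f g : L2 f -> L2 g ->
  ip (fun x => f x - g x) (fun x => f x - g x) = ip f f - 2 * ip f g + ip g g.
Proof.
move=> Lf Lg; rewrite ipBl ?ipBr//; last exact: L2B.
by rewrite (ipC g f); ring.
Qed.

Lemma cauchy_schwarz f g : L2 f -> L2 g -> ip f g ^+ 2 <= ip f f * ip g g.
Proof.
move=> Lf Lg.
have H t : 0 <= ip f f - 2 * (t * ip f g) + t ^+ 2 * ip g g.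
  have := ip_ge0 (fun x => f x - t * g x).
  rewrite (ip_sub_sqr Lf (L2Z t Lg)) !(ipZr,ipZl)//; last exact: L2Z.
  by rewrite expr2 -mulrA.
have := ip_ge0 g; rewrite le_eqVlt => /orP[/eqP c0|c0].
  have [->|b0] := eqVneq (ip f g) 0; first by rewrite expr0n/= -c0 mulr0.
  (* Without its quadratic term the polynomial in t is affine and takes the value -1 here. *)
  have := H ((ip f f + 1) / (2 * ip f g)).
  rewrite -c0 mulr0 addr0.
  have -> : 2 * ((ip f f + 1) / (2 * ip f g) * ip f g) = ip f f + 1.
    by field.
  by lra.
(* The minimum of the quadratic polynomial in t. *)
have := H (ip f g / ip g g).
have -> : ip f f - 2 * (ip f g / ip g g * ip f g) + (ip f g / ip g g) ^+ 2 * ip g g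
  = (ip f f * ip g g - ip f g ^+ 2) / ip g g.
  by field; rewrite gt_eqF.
by rewrite pmulr_lge0 ?invr_gt0// subr_ge0.
Qed.

Lemma sqnorm_eq0 f : measurable_fun D f ->
  sqnorm f = 0%E <-> {ae mu, forall x, D x -> f x = 0}.
Proof.
move=> mf.
have mf2 : measurable_fun D (fun x => (f x ^+ 2)%:E).
  by apply/measurable_EFinP; exact: measurable_funX.
have -> : sqnorm f = (\int[mu]_(x in D) `|(f x ^+ 2)%:E|)%E.
  by apply: eq_integral => x _; rewrite gee0_abs// lee_fin sqr_ge0.
rewrite ae_eq_integral_abs//; split; apply: filterS => x h Dx.
  by apply/eqP; rewrite -sqrf_eq0; move: (h Dx) => [->].
by rewrite /= (h Dx) expr0n.
Qed.

Lemma sqnorm_ae f g : measurable_fun D f -> measurable_fun D g ->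
  {ae mu, forall x, D x -> f x = g x} -> sqnorm f = sqnorm g.
Proof.
move=> mf mg fg; apply: ae_eq_integral => //.
- by apply/measurable_EFinP; exact: measurable_funX.
- by apply/measurable_EFinP; exact: measurable_funX.
by apply: filterS fg => x /[apply] ->.
Qed.

Definition L2cvg (u : nat -> T -> R) (X : T -> R) :=
  (fun k => sqnorm (fun x => u k x - X x)) @ \oo --> 0%E.

Lemma L2cvgP u X : (forall k, L2 (u k)) -> L2 X -> L2cvg u X <->
  forall e, 0 < e -> exists N, forall k, (N <= k)%N ->
    ip (fun x => u k x - X x) (fun x => u k x - X x) <= e.
Proof.
move=> Lu LX; rewrite /L2cvg cvge0_seqP; last by move=> k; exact: sqnorm_ge0.
by split=> h e e0; have [N hN] := h e e0; exists N => k Nk; have := hN k Nk;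
  rewrite (sqnormE (L2B (Lu k) LX)) lee_fin.
Qed.

Lemma L2cvgZD a u v X Y : (forall k, L2 (u k)) -> (forall k, L2 (v k)) ->
  L2 X -> L2 Y -> L2cvg u X -> L2cvg v Y ->
  L2cvg (fun k x => a * u k x + v k x) (fun x => a * X x + Y x).
Proof.
move=> Lu Lv LX LY /L2cvgP uX /L2cvgP vY.
apply/L2cvgP; [by move=> k; apply: L2D => //; exact: L2Z
  |by apply: L2D => //; exact: L2Z|move=> e e0].
(* [sqnorm_add_le] doubles each squared norm, and each of the two terms may use half of [e], hence
   the 4. The + 1 covers [a = 0]. *)
have a2 : 0 < 4 * (a ^+ 2 + 1) by have := sqr_ge0 a; nra.
have [N1 h1] := uX Lu LX (e / (4 * (a ^+ 2 + 1))) (divr_gt0 e0 a2).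
have e4 : 0 < e / 4 by lra.
have [N2 h2] := vY Lv LY (e / 4) e4.
exists (maxn N1 N2) => k; rewrite geq_max => /andP[k1 k2].
have {}h1 := h1 k k1; have {}h2 := h2 k k2.
have L1 := L2B (Lu k) LX; have L2' := L2B (Lv k) LY.
rewrite -lee_fin -sqnormE; last by apply: L2B; apply: L2D => //; exact: L2Z.
rewrite (_ : (fun x => _) = (fun x => a * (u k x - X x) + (v k x - Y x))); last first.
  by apply/funext => x; ring.
have L1a := L2Z a L1.
apply: (le_trans (sqnorm_add_le (L2_measurable L1a) (L2_measurable L2'))).
rewrite sqnormZ; last exact: L2_measurable.
rewrite !sqnormE// -!EFinM -EFinD lee_fin.
have : ip (fun x => u k x - X x) (fun x => u k x - X x) * (4 * (a ^+ 2 + 1)) <= e.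
  by rewrite -ler_pdivlMr.
have := ip_ge0 (fun x => u k x - X x); have := sqr_ge0 a; nra.
Qed.

Lemma L2cvgB u v X Y : (forall k, L2 (u k)) -> (forall k, L2 (v k)) ->
  L2 X -> L2 Y -> L2cvg u X -> L2cvg v Y ->
  L2cvg (fun k x => u k x - v k x) (fun x => X x - Y x).
Proof.
move=> Lu Lv LX LY uX vY; have := L2cvgZD (-1) Lv Lu LY LX vY uX.
by under eq_fun => k do under eq_fun => x do rewrite mulN1r addrC;
  under [X in L2cvg _ X]eq_fun => x do rewrite mulN1r addrC.
Qed.

Lemma L2cvg_ip u v X Y : (forall k, L2 (u k)) -> (forall k, L2 (v k)) ->
  L2 X -> L2 Y -> L2cvg u X -> L2cvg v Y ->
  (fun k => ip (u k) (v k)) @ \oo --> ip X Y.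
Proof.
move=> Lu Lv LX LY /L2cvgP uX /L2cvgP vY; apply/cvgrPdist_le => e e0.
(* [c] dominates every norm that occurs, so by Cauchy-Schwarz each of the three error terms has a
   square of at most [e' * c = e ^+ 2 / 16], and their sum stays below [e]. *)
pose c := 1 + e + ip X X + ip Y Y.
have c0 : 0 < c by have := ip_ge0 X; have := ip_ge0 Y; rewrite /c; lra.
pose e' := e ^+ 2 / (16 * c).
have e'0 : 0 < e' by rewrite divr_gt0 ?exprn_gt0//; nra.
have [N1 h1] := uX Lu LX e' e'0.
have [N2 h2] := vY Lv LY e' e'0.
exists (maxn N1 N2) => // k; rewrite /= geq_max => /andP[k1 k2].
have {h1}A1 := h1 k k1; have {h2}A2 := h2 k k2.
set U := fun x => u k x - X x in A1.
set V := fun x => v k x - Y x in A2.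
have LU : L2 U by exact: L2B.
have LV : L2 V by exact: L2B.
have -> : ip X Y - ip (u k) (v k) = - (ip U V + ip U Y + ip X V).
  by rewrite /U /V !(ipBl,ipBr)//; do ?exact: L2B; ring.
rewrite normrN.
have B1 := cauchy_schwarz LU LV; have B2 := cauchy_schwarz LU LY.
have B3 := cauchy_schwarz LX LV.
have U0 := ip_ge0 U; have V0 := ip_ge0 V; have X0 := ip_ge0 X; have Y0 := ip_ge0 Y.
have ce : e' * (16 * c) = e ^+ 2 by rewrite /e' divfK// gt_eqF//; nra.
have e'e : e' <= e / 16.
  rewrite /e' ler_pdivrMr; last nra.
  rewrite /c; nra.
have K z : z ^+ 2 <= e' * c -> `|z| <= e / 4.
  move=> hz; rewrite -(@ler_pXn2r _ 2)// ?nnegrE//; last by lra.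
  by rewrite real_normK ?num_real//; nra.
have C1 : `|ip U V| <= e / 4.
  by apply: K; apply: (le_trans B1); apply: ler_pM => //; rewrite /c; lra.
have C2 : `|ip U Y| <= e / 4.
  by apply: K; apply: (le_trans B2); apply: ler_pM => //; rewrite /c; lra.
have C3 : `|ip X V| <= e / 4.
  apply: K; apply: (le_trans B3); rewrite mulrC.
  by apply: ler_pM => //; rewrite /c; lra.
apply: (le_trans (ler_normD _ _)).
have := ler_normD (ip U V) (ip U Y); lra.
Qed.

(** The zero sequence [u - u] converges to [X - Y], and norms pass to the limit. *)
Lemma L2cvg_sqnorm0 u X Y : (forall k, L2 (u k)) -> L2 X -> L2 Y ->
  L2cvg u X -> L2cvg u Y -> sqnorm (fun x => X x - Y x) = 0%E.
Proof.
move=> Lu LX LY uX uY.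
have := L2cvg_ip (fun k => L2B (Lu k) (Lu k)) (fun k => L2B (Lu k) (Lu k))
  (L2B LX LY) (L2B LX LY) (L2cvgB Lu Lu LX LY uX uY) (L2cvgB Lu Lu LX LY uX uY).
have -> : (fun k => ip (fun x => u k x - u k x) (fun x => u k x - u k x))
    = fun=> 0.
  apply/funext => k; rewrite -[RHS](ip0l (fun=> 0)).
  by congr ip; apply/funext => x; rewrite subrr.
move=> /(cvg_unique _) /(_ (cvg_cst _)) h.
by rewrite sqnormE ?h//; exact: L2B.
Qed.

Lemma L2cvg_ae u X Y : (forall k, L2 (u k)) -> L2 X -> L2 Y ->
  sqnorm (fun x => X x - Y x) = 0%E -> L2cvg u X -> L2cvg u Y.
Proof.
move=> Lu LX LY XY; rewrite /L2cvg => uX.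
rewrite (_ : (fun k => _) = fun k => sqnorm (fun x => u k x - X x))//.
apply/funext => k; apply: sqnorm_ae.
- by apply: L2_measurable; exact: L2B.
- by apply: L2_measurable; exact: L2B.
move/sqnorm_eq0 : XY => /(_ (L2_measurable (L2B LX LY))).
by apply: filterS => x /[apply] /eqP; rewrite subr_eq0 => /eqP ->.
Qed.

Lemma sqnormBC f g : sqnorm (fun x => f x - g x) = sqnorm (fun x => g x - f x).
Proof. by apply: eq_integral => x _; rewrite -sqrrN opprB. Qed.

End L2_space.

(** * Fast convergence and completeness of L^2 *)

Definition half_pow (R : realType) (k : nat) : R := ((2 ^ k.+1)%:R)^-1.

Lemma half_pow_gt0 (R : realType) k : 0 < half_pow R k.
Proof. by rewrite invr_gt0 ltr0n expn_gt0. Qed.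

Lemma half_pow_small (R : realType) (e : R) : 0 < e ->
  exists N, forall k, (N <= k)%N -> half_pow R k <= e.
Proof.
move=> e0; exists (Num.bound (e^-1)) => k Nk.
rewrite /half_pow invf_ple ?posrE ?ltr0n ?expn_gt0//.
apply: (le_trans (ltW (archi_boundP _))); first by rewrite invr_ge0 ltW.
by rewrite ler_nat (leq_trans Nk)// ltnW// (leq_trans (ltn_expl k (isT : 1 < 2)%N))// leq_pexp2l.
Qed.

Lemma half_pow_series (R : realType) :
  (\sum_(0 <= k <oo) (half_pow R k)%:E <= 1%:E)%E.
Proof.
have := @epsilon_trick0 R 1 xpredT ler01.
by under eq_eseriesr do rewrite mul1r.
Qed.

Lemma exists_subsequence (Q : nat -> nat -> Prop) :
  (forall k, exists N, forall m, (N <= m)%N -> Q k m) ->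
  exists phi : nat -> nat, {homo phi : m n / (m <= n)%N} /\
    forall k m, (phi k <= m)%N -> Q k m.
Proof.
move=> h; have [N hN] := choice h.
exists (fun k => \max_(i < k.+1) N i); split => [m n mn|k m km].
  apply/bigmax_leqP => i _.
  exact: (@leq_bigmax _ (fun j : 'I_n.+1 => N j) (widen_ord (mn : (m.+1 <= n.+1)%N) i)).
by apply: hN; apply: (leq_trans _ km); exact: (@leq_bigmax _ (fun j : 'I_k.+1 => N j) ord_max).
Qed.

Section fast_convergence.
Context d (T : measurableType d) (R : realType).
Variables (mu : {measure set T -> \bar R}) (D : set T).
Hypothesis mD : measurable D.

Lemma ae_series_lty (u : nat -> T -> \bar R) :
  (forall k, measurable_fun D (u k)) -> (forall k x, D x -> 0 <= u k x)%E ->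
  (\sum_(0 <= k <oo) \int[mu]_(x in D) u k x < +oo)%E ->
  {ae mu, forall x, D x -> (\sum_(0 <= k <oo) u k x < +oo)%E}.
Proof.
move=> mu_ u0; rewrite -integral_nneseries// => ufin.
have s0 x : D x -> (0 <= \sum_(0 <= k <oo) u k x)%E.
  by move=> Dx; apply: nneseries_ge0 => k _ _; exact: u0.
have ui : mu.-integrable D (fun x => \sum_(0 <= k <oo) u k x)%E.
  apply/integrableP; split.
    apply: (@eq_measurable_fun _ _ _ _ D
      (fun x => \sum_(0 <= k <oo | k \in xpredT) u k x)%E) => //.
    by apply: ge0_emeasurable_sum => // k x Dx _; exact: u0.
  rewrite (eq_integral (fun x => \sum_(0 <= k <oo) u k x)%E)// => x /[!inE] Dx.
  by rewrite gee0_abs// s0.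
have := integrable_ae mD ui; apply: filterS => x h Dx.
by rewrite ltey_eq h.
Qed.

Lemma nneseries_lty_cvg0 (a : nat -> \bar R) : (forall k, 0 <= a k)%E ->
  (\sum_(0 <= k <oo) a k < +oo)%E -> a @ \oo --> 0%E.
Proof.
move=> a0 afin; have := nneseries_tail_cvg afin (fun k _ => a0 k).
rewrite !cvge0_seqP//; last by move=> i; exact: nneseries_ge0.
move=> h e e0; have [N hN] := h e e0; exists N => k Nk.
apply: le_trans (hN k Nk); have := @nneseries_lim_ge R a xpredT k k.+1 (fun n _ _ => a0 n).
by rewrite big_nat1.
Qed.

(** The bounds are summable, so the sum of the [u k] has a finite integral, is finite almost
    everywhere, and its terms tend to 0 there. This is what carries convergence on a product space
    over to almost every section. *)
Lemma ae_fast_cvg0 (u : nat -> T -> \bar R) :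
  (forall k, measurable_fun D (u k)) -> (forall k x, 0 <= u k x)%E ->
  (forall k, \int[mu]_(x in D) u k x <= (half_pow R k)%:E)%E ->
  {ae mu, forall x, D x -> u ^~ x @ \oo --> 0%E}.
Proof.
move=> mu_ u0 ub; have : (\sum_(0 <= k <oo) \int[mu]_(x in D) u k x < +oo)%E.
  apply: (@le_lt_trans _ _ (\sum_(0 <= k <oo) (half_pow R k)%:E)%E).
    by apply: lee_nneseries => k _ // _; apply: integral_ge0.
  by apply: (le_lt_trans (half_pow_series R)); rewrite ltry.
move=> /(ae_series_lty mu_ (fun k x _ => u0 k x)); apply: filterS => x h Dx.
by apply: nneseries_lty_cvg0 => //; exact: h.
Qed.

End fast_convergence.

Lemma limn_einf_le (R : realType) (u : nat -> \bar R) (c : \bar R) :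
  (forall k, u k <= c)%E -> (limn_einf u <= c)%E.
Proof.
move=> uc; rewrite limn_einf_lim; apply: lime_le; first exact: is_cvg_einfs.
apply: nearW => n; apply: le_trans (uc n).
by apply: ereal_inf_lbound; exists n => //=.
Qed.

(** With h = [half_pow R k], an increment x satisfies |x| <= x^2 / h + h. As the h are summable too,
    the increments of [v] are absolutely summable. *)
Lemma weighted_square_series_cvg (R : realType) (v : nat -> R) :
  (\sum_(0 <= k <oo) ((half_pow R k)^-1 * (v k.+1 - v k) ^+ 2)%:E < +oo)%E ->
  cvgn v.
Proof.
pose a k := ((half_pow R k)^-1 * (v k.+1 - v k) ^+ 2)%:E; rewrite -/a => afin.
have a0 k : (0 <= a k)%E.
  by rewrite /a lee_fin mulr_ge0 ?sqr_ge0// invr_ge0 ltW// half_pow_gt0.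
have sfin : (\sum_(0 <= k <oo) a k)%E \is a fin_num.
  by rewrite ge0_fin_numE// nneseries_ge0.
pose C := fine (\sum_(0 <= k <oo) a k)%E.
have bnd n : \sum_(0 <= k < n) `|v k.+1 - v k| <= C + 1.
  rewrite -lee_fin -sumEFin EFinD fineK//.
  apply: (@le_trans _ _ (\sum_(0 <= k < n) (a k + (half_pow R k)%:E))%E).
    apply: lee_sum => k _; rewrite /a -EFinD lee_fin.
    have h0 := half_pow_gt0 R k; set h := half_pow R k in h0 *.
    rewrite -(real_normK (num_real (v k.+1 - v k))).
    set x := `|_|; have -> : x = h * (x / h) by field; rewrite gt_eqF.
    set z := x / h; have -> : h^-1 * (h * z) ^+ 2 = h * z ^+ 2.
      by field; rewrite gt_eqF.
    by have := sqr_ge0 (z - 1); nra.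
  rewrite big_split/=; apply: leeD.
    by apply: (@nneseries_lim_ge R a xpredT 0 n).
  apply: le_trans (half_pow_series R).
  apply: (@nneseries_lim_ge R (fun k => (half_pow R k)%:E) xpredT 0 n).
  by move=> k _ _; rewrite lee_fin ltW// half_pow_gt0.
have : cvgn (series (telescope v)).
  apply: normed_cvg; apply: nondecreasing_is_cvgn.
    by apply: nondecreasing_series => k _ _; exact: normr_ge0.
  by exists (C + 1) => _ [n _ <-]; exact: bnd.
move=> sc; rewrite (_ : v = (fun n => v 0%N + series (telescope v) n)).
  by apply: is_cvgD => //; exact: is_cvg_cst.
by apply/funext => n; rewrite -eq_sum_telescope.
Qed.

Section completeness.
Context d (T : measurableType d) (R : realType).
Variables (mu : {measure set T -> \bar R}) (D : set T).
Hypothesis mD : measurable D.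

(** Riesz-Fischer: a subsequence with summable weighted squared increments converges almost
    everywhere, and Fatou's lemma along it bounds the distance from its limit to the whole
    sequence. *)
Lemma L2_complete (u : nat -> T -> R) : (forall k, L2 mu D (u k)) ->
  (forall e : R, 0 < e -> exists N, forall m n, (N <= m)%N -> (N <= n)%N ->
     (sqnorm mu D (fun x => (u m x - u n x)%R) <= e%:E)%E) ->
  exists2 X, L2 mu D X & L2cvg mu D u X.
Proof.
move=> Lu uC.
(* Squared, because the weight [(half_pow R k)^-1] in [a] uses up one factor and the remaining one
   must still be summable. *)
pose Q k N := forall m n, (N <= m)%N -> (N <= n)%N ->
  (sqnorm mu D (fun x => (u m x - u n x)%R) <= (half_pow R k ^+ 2)%:E)%E.
have [phi [phi_homo phiQ]] : exists phi : nat -> nat,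
    {homo phi : m n / (m <= n)%N} /\ forall k m, (phi k <= m)%N -> Q k m.
  apply: exists_subsequence => k.
  have [N hN] := uC (half_pow R k ^+ 2) (exprn_gt0 2 (half_pow_gt0 R k)).
  exists N => m Nm i j mi mj; apply: hN; exact: (leq_trans Nm).
pose v k := u (phi k).
have Lv k : L2 mu D (v k) by exact: Lu.
have vQ k m : (phi k <= m)%N ->
    (sqnorm mu D (fun x => (v k x - u m x)%R) <= (half_pow R k ^+ 2)%:E)%E.
  by move=> km; exact: (phiQ k (phi k) (leqnn _)).
pose a k x := ((half_pow R k)^-1 * (v k.+1 x - v k x) ^+ 2)%:E.
have ma k : measurable_fun D (a k).
  apply/measurable_EFinP; apply: measurable_funM; first exact: measurable_cst.
  apply/measurable_funX/measurable_funB; exact: L2_measurable.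
have a0 k x : (0 <= a k x)%E.
  by rewrite /a lee_fin mulr_ge0 ?sqr_ge0// invr_ge0 ltW// half_pow_gt0.
have aint k : (\int[mu]_(x in D) a k x <= (half_pow R k)%:E)%E.
  rewrite /a; under eq_integral do rewrite EFinM.
  rewrite ge0_integralZl//; last 3 first.
  - apply/measurable_EFinP/measurable_funX/measurable_funB; exact: L2_measurable.
  - by move=> x _; rewrite lee_fin sqr_ge0.
  - by rewrite lee_fin invr_ge0 ltW// half_pow_gt0.
  have := vQ k (phi k.+1) (phi_homo _ _ (leqnSn k)); rewrite sqnormBC => h.
  apply: (@le_trans _ _ ((half_pow R k)^-1%:E * (half_pow R k ^+ 2)%:E)%E).
    by rewrite lee_pmul2l// lte_fin invr_gt0 half_pow_gt0.
  by rewrite -EFinM lee_fin expr2 mulKf// gt_eqF// half_pow_gt0.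
pose E := D `&` [set x | (\sum_(0 <= k <oo) a k x < +oo)%E].
have mE : measurable E.
  apply: emeasurable_fun_infty_o => //.
  apply: (@eq_measurable_fun _ _ _ _ D
    (fun x => \sum_(0 <= k <oo | k \in xpredT) a k x)%E) => //.
  by apply: ge0_emeasurable_sum => // k x Dx _; exact: a0.
have aeE : {ae mu, forall x, D x -> E x}.
  have : (\sum_(0 <= k <oo) \int[mu]_(x in D) a k x < +oo)%E.
    apply: (@le_lt_trans _ _ (\sum_(0 <= k <oo) (half_pow R k)%:E)%E).
      by apply: lee_nneseries => k _ // _; apply: integral_ge0.
    by apply: (le_lt_trans (half_pow_series R)); rewrite ltry.
  move=> /(ae_series_lty mD ma (fun k x _ => a0 k x)); apply: filterS => x h Dx.
  by split => //; exact: h.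
(* Cutting off outside [E] makes the sequence converge at every point of [D], so that its pointwise
   limit is measurable. *)
pose w k x := v k x * \1_E x.
have mw k : measurable_fun D (w k).
  by apply: measurable_funM; [exact: L2_measurable|exact: measurable_indic].
have wcvg x : D x -> cvgn (w ^~ x).
  move=> Dx; rewrite /w; have [xE|xE] := boolP (x \in E).
    apply: is_cvgM; last exact: is_cvg_cst.
    by apply: weighted_square_series_cvg; move: xE; rewrite inE => -[].
  rewrite indicE (negbTE xE); under eq_fun do rewrite mulr0; exact: is_cvg_cst.
pose X x := limn (w ^~ x).
have mX : measurable_fun D X by apply: measurable_fun_cvg => // x Dx; exact: wcvg.
(* Fatou's lemma for the shifted subsequence against the fixed function [u m]. With [i = 0] it shows
   that [X] is square integrable, with large [i] that the whole sequence converges. *)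
have key i m : (phi i <= m)%N ->
    (sqnorm mu D (fun x => (X x - u m x)%R) <= (half_pow R i ^+ 2)%:E)%E.
  move=> im.
  pose f k x := ((w (k + i)%N x - u m x) ^+ 2)%:E.
  have mf k : measurable_fun D (f k).
    by apply/measurable_EFinP/measurable_funX/measurable_funB => //; exact: L2_measurable.
  have f0 k x : D x -> (0 <= f k x)%E by move=> _; rewrite lee_fin sqr_ge0.
  have -> : sqnorm mu D (fun x => (X x - u m x)%R) =
      (\int[mu]_(x in D) limn_einf (f ^~ x))%E.
    apply: eq_integral => x /[!inE] Dx.
    have fX : f ^~ x @ \oo --> ((X x - u m x) ^+ 2)%:E.
      apply: cvg_EFin; first by apply: nearW.
      have wX : (fun k => w (k + i)%N x) @ \oo --> X x.
        by rewrite (cvg_shiftn i (w ^~ x)); exact: wcvg.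
      rewrite /comp /= expr2; under eq_fun do rewrite expr2.
      by apply: cvgM; apply: cvgB => //; exact: cvg_cst.
    by rewrite (cvg_limn_einf_sup fX).1.
  apply: (le_trans (fatou mu mD mf f0)); apply: limn_einf_le => k.
  have -> : (\int[mu]_(x in D) f k x)%E =
      sqnorm mu D (fun x => (v (k + i)%N x - u m x)%R).
    apply: sqnorm_ae => //.
    - by apply: measurable_funB => //; exact: L2_measurable.
    - by apply: measurable_funB; exact: L2_measurable.
    apply: filterS aeE => x /[apply] Ex.
    by rewrite /w indicE mem_set// mulr1.
  exact: (phiQ i (phi i) (leqnn _) _ _ (phi_homo _ _ (leq_addl k i)) im).
have LX : L2 mu D X.
  have L0 : L2 mu D (fun x => X x - u (phi 0%N) x).
    split; first by apply: measurable_funB => //; exact: L2_measurable.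
    by apply: (le_lt_trans (key 0%N _ (leqnn _))); rewrite ltry.
  have := L2D mD L0 (Lu (phi 0%N)).
  by under eq_fun do rewrite subrK.
exists X => //; apply/cvge0_seqP; first by move=> k; exact: sqnorm_ge0.
move=> e e0.
(* [key] bounds by a square, which is dominated by the number itself once this is at most 1. *)
have e1 : 0 < Num.min 1 e by rewrite lt_min e0 ltr01.
have [N hN] := half_pow_small e1.
exists (phi N) => k Nk; rewrite sqnormBC; apply: (le_trans (key N k Nk)).
have := hN N (leqnn N); rewrite lee_fin le_min => /andP[h1 h2].
have := half_pow_gt0 R N; nra.
Qed.

End completeness.

Import HBNNSimple.

(** * Adapted functions and martingale increments *)

Section normal_moments.
Variable R : realType.
Variable s : R.
Hypothesis s0 : s != 0.
Local Notation p := (normal_pdf 0 s).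
Local Notation mu := (@lebesgue_measure R).

Let k := (s ^+ 2 *+ 2)^-1.

Let k0 : 0 < k.
Proof. by rewrite invr_gt0 mulrn_wgt0// exprn_even_gt0. Qed.

Let pE : p = fun x => normal_peak s * expR (- (k * x ^+ 2)).
Proof.
apply/funext => x; rewrite normal_pdfE// /normal_fun subr0 mulNr.
by rewrite (mulrC k).
Qed.

Lemma normal_pdf_sym x : p (- x) = p x.
Proof. by rewrite pE sqrrN. Qed.

Lemma is_derive_normal_pdf (x : R) :
  is_derive x (1 : R) p (- (x / s ^+ 2 * p x)).
Proof.
rewrite pE.
pose q : R -> R := fun y => - (k * y ^+ 2).
have dq : is_derive x (1 : R) q (- (k * (2 * x))).
  rewrite /q (_ : (fun y => _) = - (k \*: (@idfun R) ^+ 2)); last first.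
    by apply/funext => y; rewrite /GRing.opp/= /GRing.scale/= !fctE.
  apply: is_derive_eq; rewrite /= /GRing.scale/=; ring.
have dexp : is_derive x (1 : R) (expR \o q) (- (k * (2 * x)) * expR (q x)).
  by rewrite mulrC; apply: (@is_derive1_comp R expR q x _ _ (is_derive_expR (q x)) dq).
rewrite (_ : (fun y => _) = normal_peak s \*: (expR \o q)); last by [].
apply: is_derive_eq.
rewrite /GRing.scale/= /q; set e := expR _.
have -> : k = (2 * s ^+ 2)^-1 by rewrite mulr_natl.
by field.
Qed.

Lemma cvg_normal_pdf : p x @[x --> +oo%R] --> (0 : R).
Proof.
rewrite pE -(mulr0 (normal_peak s)); apply: cvgMr.
rewrite (_ : (fun x => _) = (fun z => expR (- z)) \o (fun z => k * z) \o
  (fun z : R => z ^+ 2)); last by [].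
apply: (@cvg_comp _ _ _ _ _ _ (pinfty_nbhs R)); first exact: cvgr_expr2.
apply: (@cvg_comp _ _ _ _ _ _ (pinfty_nbhs R)); last exact: cvgr_expR.
by apply: gt0_cvgMry => //; exact: cvg_id.
Qed.

(** [- p] is a primitive of the integrand and vanishes at infinity. *)
Lemma normal_pdf_tail (a : R) : 0 <= a ->
  (\int[mu]_(y in `[a, +oo[) (y / s ^+ 2 * p y)%:E)%E = (p a)%:E.
Proof.
move=> a0.
have cp : continuous p by exact: continuous_normal_pdf.
rewrite (@ge0_continuous_FTC2y _ _ (fun x => - p x) a 0).
- by rewrite -EFinB sub0r opprK.
- move=> x ax; rewrite mulr_ge0 ?normal_pdf_ge0// divr_ge0 ?sqr_ge0//.
  exact: le_trans ax.
- apply: continuous_subspaceT => x; apply: cvgM; last exact: cp.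
  by apply: cvgM; [exact: cvg_id|exact: cvg_cst].
- by rewrite -[X in _ --> X]oppr0; apply: (@cvgN _ R^o); exact: cvg_normal_pdf.
- move=> x _; have h := is_derive_normal_pdf x; apply: derivableN; exact: (@ex_derive _ _ _ _ _ _ _ h).
- by apply: cvgN; apply/cvg_at_right_filter; exact: cp.
- move=> x _; rewrite derive1E.
  have h := is_deriveN (is_derive_normal_pdf x).
  rewrite (_ : (fun x => - p x) = - p)//.
  by rewrite (@derive_val _ _ _ _ _ _ _ h) opprK.
Qed.

(** Integration by parts through Tonelli's theorem: y^2 p(y) / s^2 is the integral of (y / s^2) p(y)
    over x in [0, y], and integrating over y >= x first leaves p(x), by [normal_pdf_tail]. *)
Lemma normal_pdf_half_moment :
  (\int[mu]_(y in `[0%R, +oo[) (y ^+ 2 * p y)%:E =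
   (s ^+ 2)%:E * \int[mu]_(y in `[0%R, +oo[) (p y)%:E)%E.
Proof.
have mp : measurable_fun setT p by exact: measurable_normal_pdf.
pose h (z : measurableTypeR R * measurableTypeR R) : \bar R :=
  (\1_(`[0%R, +oo[%classic : set R) z.1 * ((z.1 <= z.2)%R%:R) *
   (z.2 / s ^+ 2 * p z.2))%:E.
have h0 z : (0 <= h z)%E.
  rewrite lee_fin indicE; case: (boolP (z.1 \in _)) => [|_]; last by rewrite !mul0r.
  rewrite inE/= in_itv/= andbT => z10; case: (leP z.1 z.2) => zz; last by rewrite mulr0 mul0r.
  by rewrite !mul1r mulr_ge0 ?normal_pdf_ge0// divr_ge0 ?sqr_ge0// (le_trans z10).
have mh : measurable_fun setT h.
  apply/measurable_EFinP; apply: measurable_funM; last first.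
    apply: measurable_funM.
      by apply: measurable_funM => //; exact: measurable_cst.
    by apply: measurableT_comp.
  apply: measurable_funM.
    by apply: measurableT_comp => //; exact: measurable_indic.
  apply: (measurableT_comp (f := fun b : bool => b%:R : R)) => //.
  exact: measurable_fun_ler.
have L : (\int[mu]_x \int[mu]_y h (x, y) = \int[mu]_(x in `[0%R, +oo[) (p x)%:E)%E.
  rewrite [RHS]integral_mkcond; apply: eq_integral => x _; rewrite patchE.
  rewrite /h/= indicE; case: ifPn => x0; last first.
    by under eq_integral do rewrite !mul0r; rewrite integral0.
  move: x0; rewrite inE/= in_itv/= andbT => x0.
  rewrite -normal_pdf_tail// [RHS]integral_mkcond; apply: eq_integral => y _.
  rewrite patchE mul1r; case: ifPn; rewrite ?inE ?notin_setE/= in_itv/= andbT.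
    by move=> ->; rewrite mul1r.
  by move/negP/negbTE => ->; rewrite mul0r.
have K : (\int[mu]_y \int[mu]_x h (x, y) =
    \int[mu]_(y in `[0%R, +oo[) ((s ^+ 2)^-1%:E * (y ^+ 2 * p y)%:E))%E.
  rewrite [RHS]integral_mkcond; apply: eq_integral => y _; rewrite patchE /h/=.
  have [y0|y0] := leP 0 y; last first.
    rewrite memNset/=; last by rewrite in_itv/= andbT; apply/negP; rewrite -ltNge.
    rewrite integral0_eq// => x _; rewrite indicE.
    case: (boolP (x \in _)) => [|_]; last by rewrite !mul0r.
    rewrite inE/= in_itv/= andbT => x0.
    by rewrite leNgt (lt_le_trans y0 x0) mulr0 mul0r.
  rewrite mem_set/=; last by rewrite in_itv/= andbT.
  transitivity (\int[mu]_x ((y / s ^+ 2 * p y)%:E * (\1_(`[0%R, y]%classic : set R) x)%:E))%E.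
    apply: eq_integral => x _; rewrite -EFinM mulrC; congr (_ * _)%:E.
    rewrite !indicE !mem_setE !in_itv/= andbT.
    by case: (0 <= x); rewrite ?mul1r ?mul0r.
  rewrite ge0_integralZl//; last 2 first.
  - by apply/measurable_EFinP; exact: measurable_indic.
  - by rewrite lee_fin mulr_ge0 ?normal_pdf_ge0// divr_ge0// sqr_ge0.
  have muy : lebesgue_measure (`[0%R, y]%classic : set R) = y%:E.
    rewrite lebesgue_measure_itv/= lte_fin; case: ltP => yy.
      by rewrite oppr0 adde0.
    by congr EFin; apply/eqP; rewrite eq_le y0 yy.
  rewrite integral_indic// setIT [X in (_ * X)%E]muy -!EFinM; congr (_%:E).
  by rewrite expr2; ring.
have E : (\int[mu]_x \int[mu]_y h (x, y) = \int[mu]_y \int[mu]_x h (x, y))%E :=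
  fubini_tonelli h mh h0.
rewrite -L E K.
have Z : (\int[mu]_(y in `[0%R, +oo[) ((s ^+ 2)^-1%:E * (y ^+ 2 * p y)%:E) =
    (s ^+ 2)^-1%:E * \int[mu]_(y in `[0%R, +oo[) (y ^+ 2 * p y)%:E)%E.
  apply: ge0_integralZl.
  - exact: measurable_itv.
  - apply/measurable_EFinP/measurable_funTS; exact: measurable_funM.
  - by move=> y _; rewrite lee_fin mulr_ge0 ?sqr_ge0 ?normal_pdf_ge0.
  - by rewrite lee_fin invr_ge0 sqr_ge0.
have ss : s ^+ 2 != 0 by rewrite sqrf_eq0.
rewrite Z muleA -EFinM (divff ss) mul1e; reflexivity.
Qed.

Lemma normal_pdf_second_moment :
  (\int[mu]_x ((x ^+ 2)%:E * (p x)%:E) = (s ^+ 2)%:E)%E.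
Proof.
have cp : continuous p by exact: continuous_normal_pdf.
under eq_integral do rewrite -EFinM.
rewrite ge0_symfun_integralT; last 3 first.
- by move=> x; rewrite mulr_ge0 ?sqr_ge0 ?normal_pdf_ge0.
- by move=> x; apply: cvgM; [exact: exprn_continuous|exact: cp].
- by move=> x /=; rewrite sqrrN normal_pdf_sym.
rewrite -set_itvcy normal_pdf_half_moment muleCA -[RHS]mule1; congr (_ * _)%E.
rewrite -(integral_normal_pdf 0 s) [RHS]ge0_symfun_integralT.
- by rewrite -set_itvcy.
- by move=> x; exact: normal_pdf_ge0.
- exact: cp.
- by move=> x /=; rewrite normal_pdf_sym.
Qed.

End normal_moments.

(** * Integrals of functions adapted to a sub-sigma-algebra *)

Section sub_sigma_algebra.
Context d (T : measurableType d) (R : realType).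
Variables (G : set (set T)).
Hypothesis (sG : sigma_algebra setT G) (GT : G `<=` @measurable d T).

Definition adapted (f : T -> R) :=
  forall U : set R, measurable U -> G (f @^-1` U).

Lemma adaptedP (f : T -> R) :
  adapted f <-> measurable_fun [set: g_sigma_algebraType G] (f : g_sigma_algebraType G -> R).
Proof.
split=> [h _ U mU|h U mU].
  by rewrite setTI; apply: sub_sigma_algebra; exact: h.
have := h measurableT U mU; rewrite setTI /measurable/=.
by rewrite /g_sigma_algebraType/= sigma_algebra_id.
Qed.

Lemma adapted_measurable (f : T -> R) : adapted f -> measurable_fun setT f.
Proof. by move=> h _ U mU; rewrite setTI; apply: GT; exact: h. Qed.

Lemma adapted_cst (a : R) : adapted (fun=> a).
Proof. by apply/adaptedP; exact: measurable_cst. Qed.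

Lemma adaptedD (f g : T -> R) : adapted f -> adapted g -> adapted (fun x => f x + g x).
Proof. by move=> /adaptedP ? /adaptedP ?; apply/adaptedP; exact: measurable_funD. Qed.

Lemma adaptedM (f g : T -> R) : adapted f -> adapted g -> adapted (fun x => f x * g x).
Proof. by move=> /adaptedP ? /adaptedP ?; apply/adaptedP; exact: measurable_funM. Qed.

Lemma adaptedB (f g : T -> R) : adapted f -> adapted g -> adapted (fun x => f x - g x).
Proof. by move=> /adaptedP ? /adaptedP ?; apply/adaptedP; exact: measurable_funB. Qed.

(** If [m1] with density [W1] and [m2] with density [W2] agree on [G], they integrate adapted
    functions alike. It serves three times: for a squared increment against the constant [t - s],
    for the normal density, and for an indicator against its probability. *)
Lemma ge0_integral_adapted (m1 m2 : {measure set T -> \bar R}) (W1 W2 f : T -> R) :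
  measurable_fun setT W1 -> measurable_fun setT W2 ->
  (forall x, 0 <= W1 x) -> (forall x, 0 <= W2 x) ->
  (forall A, G A -> \int[m1]_(x in A) (W1 x)%:E = \int[m2]_(x in A) (W2 x)%:E)%E ->
  adapted f -> (forall x, 0 <= f x) ->
  (\int[m1]_x (f x * W1 x)%:E = \int[m2]_x (f x * W2 x)%:E)%E.
Proof.
move=> mW1 mW2 W10 W20 W12 /adaptedP mf f0.
have mEf : measurable_fun [set: g_sigma_algebraType G] (EFin \o (f : g_sigma_algebraType G -> R)).
  exact/measurable_EFinP.
(* The simple functions are built on the measurable type generated by [G], so that their level sets
   lie in [G]. *)
pose g' := nnsfun_approx measurableT mEf.
pose g n : T -> R := fun x => g' n (x : g_sigma_algebraType G).
have gG n (U : set R) : measurable U -> G (g n @^-1` U).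
  move=> mU; have := measurable_funPTI (g' n) mU.
  by rewrite /measurable/= /g_sigma_algebraType/= sigma_algebra_id.
have mg n : measurable_fun setT (g n).
  by move=> _ U mU; rewrite setTI; apply: GT; exact: gG.
have g0 n x : 0 <= g n x by rewrite /g; exact: fun_ge0.
have gm n y : d.-measurable (g n @^-1` [set y]).
  by apply: GT; apply: gG.
have step (m : {measure set T -> \bar R}) (W : T -> R) n :
    measurable_fun setT W -> (forall x, 0 <= W x) ->
    (\int[m]_x (g n x * W x)%:E =
     \sum_(y \in range (g' n)) (y%:E * \int[m]_(x in g n @^-1` [set y]) (W x)%:E))%E.
  move=> mW W0.
  have pos y x : (0 <= (y * \1_(g n @^-1` [set y]) x)%:E)%E.
    rewrite lee_fin indicE; case: (boolP (_ \in _)) => [|_]; last by rewrite mulr0.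
    by rewrite inE/= => <-; rewrite mulr1.
  transitivity (\int[m]_x \sum_(y \in range (g' n))
      ((y * \1_(g n @^-1` [set y]) x)%:E * (W x)%:E))%E.
    apply: eq_integral => x _.
    rewrite -ge0_mule_fsuml//.
    rewrite fsumEFin// EFinM; congr (_%:E * _)%E; exact: fimfunE.
  rewrite ge0_integral_fsum//; last 2 first.
  - move=> y; apply: emeasurable_funM; apply/measurable_EFinP => //.
    by apply: measurable_funM => //; exact: measurable_indic.
  - by move=> y x _; rewrite mule_ge0// ?lee_fin//; exact: pos.
  apply: eq_fsbigr => y; rewrite inE/= => -[x _ <-].
  under eq_integral do rewrite EFinM -muleA.
  rewrite ge0_integralZl//; last 3 first.
  - by apply: emeasurable_funM; apply/measurable_EFinP => //; exact: measurable_indic.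
  - by move=> z _; rewrite mule_ge0// lee_fin.
  - by rewrite lee_fin; exact: g0.
  congr (_ * _)%E; rewrite [RHS]integral_mkcond; apply: eq_integral => z _.
  by rewrite patchE indicE; case: ifPn => _; rewrite ?mul1e ?mul0e.
have lim (m : {measure set T -> \bar R}) (W : T -> R) :
    measurable_fun setT W -> (forall x, 0 <= W x) ->
    (\int[m]_x (f x * W x)%:E = limn (fun n => \int[m]_x (g n x * W x)%:E))%E.
  move=> mW W0; rewrite -monotone_convergence//.
  - apply: eq_integral => x _; apply/esym/cvg_lim => //.
    under eq_fun do rewrite EFinM.
    rewrite EFinM; apply: cvgeZr => //.
    by apply: (cvg_nnsfun_approx measurableT mEf) => // y _; rewrite lee_fin.
  - by move=> n; apply/measurable_EFinP; exact: measurable_funM.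
  - by move=> n x _; rewrite lee_fin mulr_ge0.
  - move=> x _ a b ab; rewrite lee_fin ler_wpM2r//.
    by have /lefP := nd_nnsfun_approx measurableT mEf ab; exact.
rewrite !lim//; congr (limn _); apply/funext => n.
rewrite !step//; apply: eq_fsbigr => y _; congr (_ * _)%E.
by apply: W12; exact: gG.
Qed.

(** On [G] the positive and negative parts of [W] have equal integrals, so the nonnegative case
    applies to either part of [f]; all four products are dominated by the integrable product of [f]
    and [W]. *)
Lemma integral_adapted0 (m : {measure set T -> \bar R}) (W f : T -> R) :
  m.-integrable setT (EFin \o W) ->
  (forall A, G A -> \int[m]_(x in A) W x = 0) ->
  adapted f -> m.-integrable setT (fun x => (f x * W x)%:E) ->
  \int[m]_x (f x * W x) = 0.
Proof.
move=> iW W0 af ifW.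
have mW : measurable_fun setT W by apply/measurable_EFinP; exact: measurable_int iW.
have mWp : measurable_fun setT W^\+ by exact: measurable_funrpos.
have mWn : measurable_fun setT W^\- by exact: measurable_funrneg.
have mf : measurable_fun setT f by exact: adapted_measurable.
have eqA A : G A -> (\int[m]_(x in A) (W^\+ x)%:E = \int[m]_(x in A) (W^\- x)%:E)%E.
  move=> GA; have mA : measurable A by exact: GT.
  have iA : m.-integrable A (EFin \o W) by apply: integrableS iW.
  have ip_ : m.-integrable A (fun x => (W^\+ x)%:E).
    by have := integrable_funepos mA iA; rewrite funerpos.
  have in_ : m.-integrable A (fun x => (W^\- x)%:E).
    by have := integrable_funeneg mA iA; rewrite funerneg.
  have := W0 A GA; rewrite -{1}(funrposBneg W) RintegralB//.
  move/eqP; rewrite subr_eq0 => /eqP h.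
  rewrite -(fineK (integrable_fin_num mA ip_)) -(fineK (integrable_fin_num mA in_)).
  by congr EFin.
have afp : adapted f^\+.
  by apply/adaptedP; apply: measurable_funrpos; exact/adaptedP.
have afn : adapted f^\-.
  by apply/adaptedP; apply: measurable_funrneg; exact/adaptedP.
have P0 (g : T -> R) x : 0 <= g^\+ x by exact: funrpos_ge0.
have N0 (g : T -> R) x : 0 <= g^\- x by exact: funrneg_ge0.
have ep := ge0_integral_adapted mWp mWn (P0 W) (N0 W) eqA afp (P0 f).
have en := ge0_integral_adapted mWp mWn (P0 W) (N0 W) eqA afn (N0 f).
have bound (g h : T -> R) : measurable_fun setT g -> measurable_fun setT h ->
    (forall x, 0 <= g x <= `|f x|) -> (forall x, 0 <= h x <= `|W x|) ->
    m.-integrable setT (fun x => (g x * h x)%:E).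
  move=> mg mh gf hW; apply: (le_integrable measurableT _ _ ifW).
    by apply/measurable_EFinP; exact: measurable_funM.
  move=> x _; rewrite /= lee_fin !normrM.
  have /andP[g0 gx] := gf x; have /andP[h0 hx] := hW x.
  by rewrite ler_pM// ger0_norm.
have Pb (g : T -> R) x : 0 <= g^\+ x <= `|g x|.
  by rewrite P0/= /funrpos ge_max normr_ge0 ler_norm.
have Nb (g : T -> R) x : 0 <= g^\- x <= `|g x|.
  by rewrite N0/= /funrneg ge_max normr_ge0 -normrN ler_norm.
have mfp : measurable_fun setT f^\+ by exact: measurable_funrpos.
have mfn : measurable_fun setT f^\- by exact: measurable_funrneg.
have i1 := bound _ _ mfp mWp (Pb f) (Pb W).
have i2 := bound _ _ mfp mWn (Pb f) (Nb W).
have i3 := bound _ _ mfn mWp (Nb f) (Pb W).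
have i4 := bound _ _ mfn mWn (Nb f) (Nb W).
rewrite (_ : (fun x => f x * W x) = fun x => (f^\+ x * W^\+ x - f^\+ x * W^\- x) -
   (f^\- x * W^\+ x - f^\- x * W^\- x)); last first.
  apply/funext => x; have := congr1 (fun g => g x) (funrposBneg f).
  have := congr1 (fun g => g x) (funrposBneg W); rewrite !fctE => <- <-; ring.
rewrite RintegralB//; [|exact: (integrableB measurableT i1 i2)|
  exact: (integrableB measurableT i3 i4)].
rewrite !RintegralB// /Rintegral ep en !subrr.
by [].
Qed.

End sub_sigma_algebra.

(** * Increments relative to abstract classes of past variables *)

Section adapted_families.
Context d (T : measurableType d) (R : realType).
Variable mu : {measure set T -> \bar R}.
Implicit Types (V : R -> (T -> R) -> Prop) (Y Z : R -> T -> R) (f g : T -> R).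
Local Notation ip := (ip mu setT).
Local Notation L2 := (L2 mu setT).

(** [V s] stands for square integrable variables known at time s. There are two instances: the
    variables adapted to a filtration, and the finite sums of tensors on a product space. *)
Definition adapted_family V :=
  [/\ forall s f, 0 <= s -> V s f -> L2 f,
      forall s t f, 0 <= s -> s <= t -> V s f -> V t f,
      forall s a f g, 0 <= s -> V s f -> V s g -> V s (fun w => a * f w + g w) &
      forall s, 0 <= s -> V s (fun=> 1)].

(** Includes that the product is square integrable although neither factor is bounded; for a
    filtration this rests on the conditional variance of the increment. *)
Definition compatible V Y := forall s t f, 0 <= s -> s <= t -> V s f ->
  V t (fun w => f w * (Y t w - Y s w)).

Definition centered V Y := forall s t f g, 0 <= s -> s <= t -> V s f -> V s g ->
  ip f (fun w => g w * (Y t w - Y s w)) = 0.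

(** Weak form of the statement that, given the past, the two increments have conditional covariance
    [rho * (t - s)]. *)
Definition covariation V Y Z (rho : R) := forall s t f g, 0 <= s -> s <= t ->
  V s f -> V s g ->
  ip (fun w => f w * (Y t w - Y s w)) (fun w => g w * (Z t w - Z s w)) =
  rho * (t - s) * ip f g.

(** The Lebesgue measure of the intersection of the two half-open intervals, in closed form. *)
Definition overlap (I J : R * R) : R :=
  Num.max 0 (Num.min I.2 J.2 - Num.max I.1 J.1).

Lemma covariationC V Y Z rho : covariation V Y Z rho -> covariation V Z Y rho.
Proof. by move=> h s t f g s0 st Vf Vg; rewrite ipC h// ipC. Qed.

Section combination.
Variables (V : R -> (T -> R) -> Prop).
Hypothesis (aV : adapted_family V).
Variables (Y1 Y2 : R -> T -> R) (a b : R).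
Let Y t w := Y1 t w * a + Y2 t w * b.
Hypotheses (c1 : compatible V Y1) (c2 : compatible V Y2).

Let decomp s t f : (fun w => f w * (Y t w - Y s w)) =
  (fun w => a * (f w * (Y1 t w - Y1 s w)) + (b * (f w * (Y2 t w - Y2 s w)))).
Proof. by apply/funext => w; rewrite /Y; ring. Qed.

Let V0 s : 0 <= s -> V s (fun=> 0).
Proof.
case: aV => _ _ lin one s0.
have := lin s (-1) _ _ s0 (one s s0) (one s s0).
by under eq_fun do rewrite mulr1 addNr.
Qed.

Let VZ s k f : 0 <= s -> V s f -> V s (fun w => k * f w).
Proof.
case: aV => _ _ lin one s0 Vf; have := lin s k f _ s0 Vf (V0 s0).
by under eq_fun do rewrite addr0.
Qed.

Lemma compatible_comb : compatible V Y.
Proof.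
move=> s t f s0 st Vf; have t0 := le_trans s0 st; rewrite decomp.
case: aV => _ _ lin _; apply: lin => //; first exact: c1.
by apply: VZ => //; exact: c2.
Qed.

Let LV t f : 0 <= t -> V t f -> L2 f.
Proof. by move=> t0; case: aV => + _ _ _; exact. Qed.

Lemma centered_comb : centered V Y1 -> centered V Y2 -> centered V Y.
Proof.
move=> h1 h2 s t f g s0 st Vf Vg; have t0 := le_trans s0 st.
have L1 := LV t0 (c1 s0 st Vg); have L2' := LV t0 (c2 s0 st Vg).
have Lf := LV s0 Vf.
rewrite decomp ipDr ?ipZr ?h1 ?h2 ?mulr0 ?addr0//; exact: L2Z.
Qed.

Lemma covariation_comb Z r1 r2 : compatible V Z ->
  covariation V Y1 Z r1 -> covariation V Y2 Z r2 ->
  covariation V Y Z (a * r1 + b * r2).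
Proof.
move=> cZ h1 h2 s t f g s0 st Vf Vg; have t0 := le_trans s0 st.
have L1 := LV t0 (c1 s0 st Vf); have L2' := LV t0 (c2 s0 st Vf).
have Lg := LV t0 (cZ s t g s0 st Vg).
rewrite decomp ipDl ?ipZl ?h1 ?h2//; try exact: L2Z.
by ring.
Qed.

End combination.

Section intervals.
Variables (V : R -> (T -> R) -> Prop).
Hypothesis (aV : adapted_family V).

Let LV t f : 0 <= t -> V t f -> L2 f.
Proof. by move=> t0; case: aV => + _ _ _; exact. Qed.

Let incl s t f : 0 <= s -> s <= t -> V s f -> V t f.
Proof. by case: aV => _ + _ _; exact. Qed.

(* Only the common part of the two intervals contributes: every other product
   of increments contains one that lies after everything else. *)
Lemma ip_increments Y Z rho s t s' t' f g :
  compatible V Y -> compatible V Z -> centered V Y -> centered V Z ->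
  covariation V Y Z rho ->
  0 <= s -> s <= t -> 0 <= s' -> s' <= t' -> V s f -> V s' g ->
  ip (fun w => f w * (Y t w - Y s w)) (fun w => g w * (Z t' w - Z s' w)) =
  rho * overlap (s, t) (s', t') * ip f g.
Proof.
move=> cY cZ zY zZ cov s0 st s'0 s't' Vf Vg.
have t0 := le_trans s0 st; have t'0 := le_trans s'0 s't'.
have [ts'|s't] := leP t s'.
  rewrite (zZ s' t') //; last by apply: (incl t0 ts'); exact: cY.
  rewrite /overlap/= (_ : Num.max 0 _ = 0) ?mulr0 ?mul0r//.
  apply/max_idPl; rewrite subr_le0; apply: (@le_trans _ _ t).
    by rewrite ge_min lexx.
  by rewrite le_max ts' orbT.
have [t's|st'] := leP t' s.
  rewrite ipC (zY s t) //; last by apply: (incl t'0 t's); exact: cZ.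
  rewrite /overlap/= (_ : Num.max 0 _ = 0) ?mulr0 ?mul0r//.
  apply/max_idPl; rewrite subr_le0; apply: (@le_trans _ _ t').
    by rewrite ge_min lexx orbT.
  by rewrite le_max t's.
rewrite /overlap/=; set u := Num.max s s'; set v := Num.min t t'.
have uv : u <= v by rewrite /u /v ge_max !le_min st s't' (ltW st') (ltW s't).
have su : s <= u by rewrite /u le_max lexx.
have s'u : s' <= u by rewrite /u le_max lexx orbT.
have vt : v <= t by rewrite /v ge_min lexx.
have vt' : v <= t' by rewrite /v ge_min lexx orbT.
have u0 := le_trans s0 su; have v0 := le_trans u0 uv.
have Vfu := incl s0 su Vf; have Vgu := incl s'0 s'u Vg.
have Vfv := incl u0 uv Vfu; have Vgv := incl u0 uv Vgu.
pose a1 w := f w * (Y u w - Y s w); pose a2 w := f w * (Y v w - Y u w).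
pose a3 w := f w * (Y t w - Y v w).
pose b1 w := g w * (Z u w - Z s' w); pose b2 w := g w * (Z v w - Z u w).
pose b3 w := g w * (Z t' w - Z v w).
have Va1 : V u a1 by exact: cY. have Va2 : V v a2 by exact: cY.
have Va3 : V t a3 by exact: cY.
have Vb1 : V u b1 by exact: cZ. have Vb2 : V v b2 by exact: cZ.
have Vb3 : V t' b3 by exact: cZ.
have La1 := LV u0 Va1; have La2 := LV v0 Va2; have La3 := LV t0 Va3.
have Lb1 := LV u0 Vb1; have Lb2 := LV v0 Vb2; have Lb3 := LV t'0 Vb3.
rewrite (_ : (fun w => f w * _) = fun w => (a1 w + a2 w) + a3 w); last first.
  by apply/funext => w; rewrite /a1 /a2 /a3; ring.
rewrite (_ : (fun w => g w * _) = fun w => (b1 w + b2 w) + b3 w); last first.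
  by apply/funext => w; rewrite /b1 /b2 /b3; ring.
(* The cut [u] is the left end of one of the two intervals, so one of [a1] and [b1] is zero; the cut
   [v] has the same effect on [a3] and [b3]. *)
have e11 : ip a1 b1 = 0.
  have [ss'|s's] := leP s s'.
    rewrite (_ : b1 = fun=> 0) ?ip0r//; apply/funext => w.
    by rewrite /b1 /u max_r// subrr mulr0.
  rewrite (_ : a1 = fun=> 0) ?ip0l//; apply/funext => w.
  by rewrite /a1 /u max_l ?(ltW s's)// subrr mulr0.
have e12 : ip a1 b2 = 0 by exact: zZ.
have e13 : ip a1 b3 = 0 by apply: zZ => //; exact: incl uv Va1.
have e21 : ip a2 b1 = 0 by rewrite ipC; exact: zY.
have e22 : ip a2 b2 = rho * (v - u) * ip f g by exact: cov.
have e23 : ip a2 b3 = 0 by apply: zZ.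
have e31 : ip a3 b1 = 0 by rewrite ipC; apply: zY => //; exact: incl uv Vb1.
have e32 : ip a3 b2 = 0 by rewrite ipC; apply: zY.
have e33 : ip a3 b3 = 0.
  have [tt'|t't] := leP t t'.
    rewrite (_ : a3 = fun=> 0) ?ip0l//; apply/funext => w.
    by rewrite /a3 /v min_l// subrr mulr0.
  rewrite (_ : b3 = fun=> 0) ?ip0r//; apply/funext => w.
  by rewrite /b3 /v min_r ?(ltW t't)// subrr mulr0.
have LA := L2D measurableT La1 La2; have LB := L2D measurableT Lb1 Lb2.
rewrite (ipDl _ LA La3 (L2D measurableT LB Lb3))//.
rewrite (ipDr _ LB Lb3 LA)// (ipDr _ LB Lb3 La3)//.
rewrite (ipDl _ La1 La2 LB)// (ipDr _ Lb1 Lb2 La1)// (ipDr _ Lb1 Lb2 La2)//.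
rewrite (ipDl _ La1 La2 Lb3)// (ipDr _ Lb1 Lb2 La3)//.
rewrite e11 e12 e13 e21 e22 e23 e31 e32 e33 max_r ?subr_ge0 ?uv//.
by ring.
Qed.

Definition increasing_intervals (J : nat -> R * R) n :=
  (forall i, (i < n)%N -> 0 <= (J i).1 /\ (J i).1 <= (J i).2) /\
  (forall i j, (i < j)%N -> (j < n)%N -> (J i).2 <= (J j).1).

Lemma increasing_intervalsS J n : increasing_intervals J n.+1 ->
  increasing_intervals J n.
Proof.
move=> [h1 h2]; split=> [i ilt|i j ij jn]; first by apply: h1; exact: ltnW.
by apply: h2 => //; exact: ltnW.
Qed.

Definition increments Y (J : nat -> R * R) n w :=
  \prod_(i < n) (Y (J i).2 w - Y (J i).1 w).

(* The sum over i < n of the products of increments of Y in which the i-th one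
   is replaced by the increment of Z. *)
Fixpoint increments1 Y Z (J : nat -> R * R) n w : R :=
  if n is n'.+1 then increments1 Y Z J n' w * (Y (J n').2 w - Y (J n').1 w) +
                     increments Y J n' w * (Z (J n').2 w - Z (J n').1 w)
  else 0.

Lemma incrementsS Y J n w :
  increments Y J n.+1 w = increments Y J n w * (Y (J n).2 w - Y (J n).1 w).
Proof. by rewrite /increments big_ord_recr. Qed.

Lemma incrementsS_fun Y J n : increments Y J n.+1 =
  fun w => increments Y J n w * (Y (J n).2 w - Y (J n).1 w).
Proof. by apply/funext => w; exact: incrementsS. Qed.

Lemma increments0 Y J : increments Y J 0 = fun=> 1.
Proof. by apply/funext => w; rewrite /increments big_ord0. Qed.

Lemma increments_adapted Y J n t : compatible V Y -> increasing_intervals J n ->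
  0 <= t -> (forall i, (i < n)%N -> (J i).2 <= t) -> V t (increments Y J n).
Proof.
move=> cY; elim: n t => [|n ih] t hJ t0 ht.
  by rewrite increments0; case: aV => _ _ _; exact.
have [J0 JJ] := hJ.1 n (ltnSn n).
apply: (incl (le_trans J0 JJ)); first exact: ht.
rewrite incrementsS_fun.
apply: cY => //; apply: ih => //; first exact: increasing_intervalsS.
by move=> i ilt; apply: hJ.2.
Qed.

Lemma increments1_adapted Y Z J n t : compatible V Y -> compatible V Z ->
  increasing_intervals J n ->
  0 <= t -> (forall i, (i < n)%N -> (J i).2 <= t) -> V t (increments1 Y Z J n).
Proof.
move=> cY cZ; elim: n t => [|n ih] t hJ t0 ht.
  case: aV => _ _ lin one; have := lin t (-1) _ _ t0 (one t t0) (one t t0).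
  by under eq_fun do rewrite mulr1 addNr.
have [J0 JJ] := hJ.1 n (ltnSn n).
apply: (incl (le_trans J0 JJ)); first exact: ht.
case: aV => _ _ lin one /=.
have V1 : V (J n).2 (fun w => increments1 Y Z J n w * (Y (J n).2 w - Y (J n).1 w)).
  apply: cY => //; apply: ih => //; first exact: increasing_intervalsS.
  by move=> i ilt; apply: hJ.2.
have V2 : V (J n).2 (fun w => increments Y J n w * (Z (J n).2 w - Z (J n).1 w)).
  apply: cZ => //; apply: increments_adapted => //; first exact: increasing_intervalsS.
  by move=> i ilt; apply: hJ.2.
have := lin _ 1 _ _ (le_trans J0 JJ) V1 V2.
by under eq_fun do rewrite mul1r.
Qed.

Hypothesis mu1 : ip (fun=> 1) (fun=> 1) = 1.

Section products.
Variables (Y Z : R -> T -> R) (rho : R).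
Hypotheses (cY : compatible V Y) (cZ : compatible V Z).
Hypotheses (zY : centered V Y) (zZ : centered V Z) (cov : covariation V Y Z rho).

(** Peeling off the last interval of both products yields one overlap and one factor [rho]. For
    different lengths the recursion ends with the constant 1 against a product whose last increment
    is centered. *)
Lemma ip_increments_prod J J' n m :
  increasing_intervals J n -> increasing_intervals J' m ->
  ip (increments Y J n) (increments Z J' m) =
  (n == m)%:R * rho ^+ n * \prod_(i < n) overlap (J i) (J' i).
Proof.
elim: n m => [|n ih] [|m] hJ hJ'.
- by rewrite !increments0 mu1 big_ord0 expr0 !mulr1.
- rewrite !mul0r increments0 (incrementsS_fun Z).
  have [J0 JJ] := hJ'.1 m (ltnSn m).
  apply: zZ => //; first by case: aV => _ _ _; exact.
  apply: increments_adapted => //; first exact: increasing_intervalsS.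
  by move=> i ilt; apply: hJ'.2.
- rewrite !mul0r increments0 ipC (incrementsS_fun Y).
  have [J0 JJ] := hJ.1 n (ltnSn n).
  apply: zY => //; first by case: aV => _ _ _; exact.
  apply: increments_adapted => //; first exact: increasing_intervalsS.
  by move=> i ilt; apply: hJ.2.
have [J0 JJ] := hJ.1 n (ltnSn n); have [J'0 JJ'] := hJ'.1 m (ltnSn m).
rewrite (_ : increments Y J n.+1 = fun w => increments Y J n w *
  (Y (J n).2 w - Y (J n).1 w)); last by apply/funext => w; exact: incrementsS.
rewrite (_ : increments Z J' m.+1 = fun w => increments Z J' m w *
  (Z (J' m).2 w - Z (J' m).1 w)); last by apply/funext => w; exact: incrementsS.
rewrite (ip_increments cY cZ zY zZ cov)//; last 2 first.
- apply: increments_adapted => //; first exact: increasing_intervalsS.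
  by move=> i ilt; apply: hJ.2.
- apply: increments_adapted => //; first exact: increasing_intervalsS.
  by move=> i ilt; apply: hJ'.2.
rewrite ih; try exact: increasing_intervalsS.
rewrite -!surjective_pairing eqSS; have [->|nm] := eqVneq n m; last by rewrite !mul0r mulr0.
by rewrite big_ord_recr/= exprS; ring.
Qed.

End products.

Section one_replacement.
Variables (B M : R -> T -> R).
Hypotheses (cB : compatible V B) (cM : compatible V M).
Hypotheses (zB : centered V B) (zM : centered V M).
Hypotheses (covBB : covariation V B B 1) (covMM : covariation V M M 1)
  (covBM : covariation V B M 0).

Let past n J : increasing_intervals J n.+1 ->
  [/\ 0 <= (J n).1, (J n).1 <= (J n).2, increasing_intervals J n &
      forall i, (i < n)%N -> (J i).2 <= (J n).1].
Proof.
move=> hJ; have [J0 JJ] := hJ.1 n (ltnSn n); split => //.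
  exact: increasing_intervalsS.
by move=> i ilt; apply: hJ.2.
Qed.

(** Replacing one factor at a time acts as a derivation, so the factor is the derivative of
    [beta ^+ n] in the direction [gamma]. Each step of the recursion multiplies the former value by
    [beta] and adds [beta ^+ n * gamma]. *)
Lemma ip_increments1 W beta gamma J J' n m : compatible V W -> centered V W ->
  covariation V B W beta -> covariation V M W gamma ->
  increasing_intervals J n -> increasing_intervals J' m ->
  ip (increments1 B M J n) (increments W J' m) =
  (n == m)%:R * (n%:R * beta ^+ n.-1 * gamma) * \prod_(i < n) overlap (J i) (J' i).
Proof.
move=> cW zW covB covM; elim: n m => [|n ih] [|m] hJ hJ'.
- by rewrite ip0l !(mul0r,mulr0).
- by rewrite ip0l !(mul0r,mulr0).
- have [J0 JJ hJn Jn] := past hJ; rewrite !mul0r increments0 ipC /=.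
  have V1 := increments1_adapted cB cM hJn J0 Jn.
  have V2 := increments_adapted cB hJn J0 Jn.
  have V3 : V (J n).1 (fun=> 1) by case: aV => _ _ _; exact.
  have J20 := le_trans J0 JJ.
  rewrite ipDr//; last 3 first.
  + exact: LV J20 (cB J0 JJ V1).
  + exact: LV J20 (cM J0 JJ V2).
  + exact: LV J0 V3.
  by rewrite zB ?zM ?addr0.
have [J0 JJ hJn Jn] := past hJ; have [J'0 JJ' hJm Jm] := past hJ'.
rewrite /= (_ : increments W J' m.+1 = fun w => increments W J' m w *
  (W (J' m).2 w - W (J' m).1 w)); last by apply/funext => w; exact: incrementsS.
have V1 := increments1_adapted cB cM hJn J0 Jn.
have V2 := increments_adapted cB hJn J0 Jn.
have V3 := increments_adapted cW hJm J'0 Jm.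
have J20 := le_trans J0 JJ; have J'20 := le_trans J'0 JJ'.
rewrite ipDl//; last 3 first.
+ exact: LV J20 (cB J0 JJ V1).
+ exact: LV J20 (cM J0 JJ V2).
+ exact: LV J'20 (cW _ _ _ J'0 JJ' V3).
rewrite (ip_increments cB cW zB zW covB)// (ip_increments cM cW zM zW covM)//.
rewrite ih// (ip_increments_prod cB cW zB zW covB)//.
rewrite -!surjective_pairing eqSS; have [->|nm] := eqVneq n m; last first.
  by rewrite !mul0r !mulr0 addr0.
(* At [m = 0] the truncated predecessor does no harm, because of the factor 0. *)
have E : m%:R * (beta * beta ^+ m.-1) = m%:R * beta ^+ m.
  by case: (m) => [|k]; rewrite ?mul0r// exprS.
have D : m.+1%:R * beta ^+ m = m%:R * (beta * beta ^+ m.-1) + beta ^+ m.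
  by rewrite E -natr1 mulrDl mul1r.
by rewrite big_ord_recr/= D; ring.
Qed.

(** Of the four terms, the two ending with increments of different processes vanish, as B and M have
    covariation 0. The pair ending with M has no other replacement and adds 1 to the factor. *)
Lemma ip_increments1_increments1 J J' n m :
  increasing_intervals J n -> increasing_intervals J' m ->
  ip (increments1 B M J n) (increments1 B M J' m) =
  (n == m)%:R * n%:R * \prod_(i < n) overlap (J i) (J' i).
Proof.
elim: n m => [|n ih] [|m] hJ hJ'.
- by rewrite ip0l !(mul0r,mulr0).
- by rewrite ip0l !(mul0r,mulr0).
- by rewrite ipC ip0l !(mul0r,mulr0).
have [J0 JJ hJn Jn] := past hJ; have [J'0 JJ' hJm Jm] := past hJ'.
have V1 := increments1_adapted cB cM hJn J0 Jn.
have V2 := increments_adapted cB hJn J0 Jn.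
have V1' := increments1_adapted cB cM hJm J'0 Jm.
have V2' := increments_adapted cB hJm J'0 Jm.
have J20 := le_trans J0 JJ; have J'20 := le_trans J'0 JJ'.
have L1 := LV J20 (cB J0 JJ V1); have L2' := LV J20 (cM J0 JJ V2).
have L3 := LV J'20 (cB J'0 JJ' V1'); have L4 := LV J'20 (cM J'0 JJ' V2').
rewrite /= (ipDl _ L1 L2' (L2D measurableT L3 L4))//.
rewrite (ipDr _ L3 L4 L1)// (ipDr _ L3 L4 L2')//.
rewrite (ip_increments cB cB zB zB covBB)// (ip_increments cB cM zB zM covBM)//.
rewrite (ip_increments cM cB zM zB (covariationC covBM))//.
rewrite (ip_increments cM cM zM zM covMM)//.
rewrite ih// (ip_increments_prod cB cB zB zB covBB)//.
rewrite -!surjective_pairing eqSS; have [->|nm] := eqVneq n m; last first.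
  by rewrite !mul0r !mulr0 !addr0.
by rewrite big_ord_recr/= expr1n -natr1; ring.
Qed.

End one_replacement.

End intervals.
End adapted_families.

(** * Conditional mean and variance of increments *)

Section orthogonal_increments.
Context d (T : measurableType d) (R : realType) (P : probability T R).
Implicit Types (G : R -> set (set T)) (X : R -> T -> R).
Local Notation L2 := (L2 P setT).
Local Notation ip := (ip P setT).

(** The common ground of B and M: conditional mean 0 and conditional variance [t - s], expressed by
    integrals over the events of [G s]. *)
Definition orthogonal_increments G X :=
  [/\ filtration G,
      forall t, 0 <= t -> adapted (G t) (X t),
      forall t, 0 <= t -> L2 (X t),
      forall s t A, 0 <= s -> s <= t -> G s A ->
        \int[P]_(w in A) (X t w - X s w) = 0 &
      forall s t A, 0 <= s -> s <= t -> G s A ->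
        (\int[P]_(w in A) ((X t w - X s w) ^+ 2)%:E = (t - s)%:E * P A)%E].

Definition past G (s : R) (f : T -> R) := L2 f /\ adapted (G s) f.

Lemma L2_cst (a : R) : L2 (fun=> a).
Proof.
split; first exact: measurable_cst.
rewrite /sqnorm integral_cst// [X in (_ * X)%E]probability_setT mule1; exact: ltry.
Qed.

Lemma L2_integrable f : L2 f -> P.-integrable setT (EFin \o f).
Proof.
move=> Lf; have := L2_integrableM measurableT Lf (L2_cst 1).
by apply: eq_integrable => // w _; rewrite mulr1.
Qed.

Lemma ip11 : ip (fun=> 1) (fun=> 1) = 1.
Proof.
by rewrite ipE Rintegral_cst// mulr1 [X in fine X]probability_setT mul1r.
Qed.

Variables (G : R -> set (set T)).
Hypothesis fG : filtration G.

Let sG s : 0 <= s -> sigma_algebra setT (G s).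
Proof. by case: fG => + _ _; exact. Qed.

Let GT s : 0 <= s -> G s `<=` measurable.
Proof. by case: fG => _ + _; exact. Qed.

Let Gle s t : 0 <= s -> s <= t -> G s `<=` G t.
Proof. by case: fG => _ _; exact. Qed.

Lemma adapted_indic s (A : set T) : 0 <= s -> G s A ->
  adapted (G s) (\1_A : T -> R).
Proof.
move=> s0 GA; apply/(adaptedP (sG s0)).
by apply: (@measurable_indic _ (g_sigma_algebraType (G s))); exact: sub_sigma_algebra.
Qed.

Lemma past_family : adapted_family P (past G).
Proof.
split.
- by move=> s f s0 [].
- by move=> s t f s0 st [Lf af]; split => // U mU; apply: (Gle s0 st); exact: af.
- move=> s a f g s0 [Lf af] [Lg ag]; split.
    by apply: L2D => //; exact: L2Z.
  apply: (adaptedD (sG s0)) => //; apply: (adaptedM (sG s0)) => //.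
  exact: (adapted_cst (sG s0)).
- by move=> s s0; split; [exact: L2_cst|exact: (adapted_cst (sG s0))].
Qed.

Section increments.
Variable X : R -> T -> R.
Hypothesis aX : forall t, 0 <= t -> adapted (G t) (X t).
Hypothesis LX : forall t, 0 <= t -> L2 (X t).
Hypothesis zX : forall s t A, 0 <= s -> s <= t -> G s A ->
  \int[P]_(w in A) (X t w - X s w) = 0.

Lemma past_ip0 s t f : 0 <= s -> s <= t -> adapted (G s) f ->
  P.-integrable setT (fun w => (f w * (X t w - X s w))%:E) ->
  \int[P]_w (f w * (X t w - X s w)) = 0.
Proof.
move=> s0 st af ifX.
apply: (@integral_adapted0 _ _ _ _ (sG s0) (GT s0)) => //.
- by apply: L2_integrable; apply: L2B => //; apply: LX => //; exact: le_trans st.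
- by move=> A GA; exact: zX.
Qed.

Hypothesis vX : forall s t A, 0 <= s -> s <= t -> G s A ->
  (\int[P]_(w in A) ((X t w - X s w) ^+ 2)%:E = (t - s)%:E * P A)%E.

Let mXX s t : 0 <= s -> s <= t -> measurable_fun setT (fun w => X t w - X s w).
Proof.
move=> s0 st; have t0 := le_trans s0 st; apply: measurable_funB.
  by apply: (adapted_measurable (GT t0)); exact: aX.
by apply: (adapted_measurable (GT s0)); exact: aX.
Qed.

(** On [G s] the squared increment and the constant [t - s] are interchangeable densities. Both
    sides may a priori be infinite; that [f] times the increment is square integrable is read off
    from this identity. *)
Lemma past_sqnorm s t f : 0 <= s -> s <= t -> past G s f ->
  sqnorm P setT (fun w => f w * (X t w - X s w)) = ((t - s)%:E * sqnorm P setT f)%E.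
Proof.
move=> s0 st [Lf af].
have mf2 : measurable_fun setT (fun w => (f w ^+ 2)%:E).
  by apply/measurable_EFinP; apply: measurable_funX; exact: L2_measurable Lf.
transitivity (\int[P]_w (f w ^+ 2 * (X t w - X s w) ^+ 2)%:E)%E.
  by apply: eq_integral => w _; rewrite exprMn.
rewrite (@ge0_integral_adapted _ _ _ _ (sG s0) (GT s0) P P _ (fun=> t - s) (fun w => f w ^+ 2)).
- under eq_integral do rewrite mulrC EFinM.
  rewrite ge0_integralZl// ?lee_fin ?subr_ge0// => w _.
  by rewrite lee_fin sqr_ge0.
- by apply: measurable_funX; exact: mXX.
- exact: measurable_cst.
- by move=> w; exact: sqr_ge0.
- by move=> w; rewrite subr_ge0.
- move=> A GA; rewrite vX// integral_cst//; exact: (GT s0).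
- rewrite (_ : (fun w => _) = fun w => f w * f w); first exact: (adaptedM (sG s0)).
  by apply/funext => w; rewrite expr2.
- by move=> w; exact: sqr_ge0.
Qed.

Lemma past_compatible : compatible (past G) X.
Proof.
move=> s t f s0 st Vf; have t0 := le_trans s0 st; have [Lf af] := Vf.
have af' : adapted (G t) f by move=> U mU; apply: (Gle s0 st); exact: af.
have aXs : adapted (G t) (X s) by move=> U mU; apply: (Gle s0 st); exact: aX.
split; last first.
  apply: (adaptedM (sG t0)) => //; apply: (adaptedB (sG t0)) => //; exact: aX.
split.
  by apply: measurable_funM; [exact: L2_measurable Lf|exact: mXX].
rewrite past_sqnorm// lte_mul_pinfty ?lee_fin ?subr_ge0//.
by case: Lf.
Qed.

Let Lpast t f : past G t f -> L2 f. Proof. by case. Qed.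

Lemma past_centered : centered P (past G) X.
Proof.
move=> s t f g s0 st Vf Vg; have [Lf af] := Vf; have [Lg ag] := Vg.
have LgX := Lpast (past_compatible s0 st Vg).
rewrite ipE; under eq_Rintegral do rewrite mulrA.
apply: past_ip0 => //; first exact: (adaptedM (sG s0)).
have := L2_integrableM measurableT Lf LgX.
by apply: eq_integrable => // w _; rewrite mulrA.
Qed.

(** Polarization of [past_sqnorm], through its value at [f + g]. *)
Lemma past_covariation : covariation P (past G) X X 1.
Proof.
move=> s t f g s0 st Vf Vg; have [Lf af] := Vf; have [Lg ag] := Vg.
have LfX := Lpast (past_compatible s0 st Vf).
have LgX := Lpast (past_compatible s0 st Vg).
have H h : past G s h -> ip (fun w => h w * (X t w - X s w))
    (fun w => h w * (X t w - X s w)) = (t - s) * ip h h.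
  move=> Vh; have := past_sqnorm s0 st Vh.
  rewrite sqnormE//; last exact: Lpast (past_compatible s0 st Vh).
  by rewrite sqnormE//; [move=> []|exact: Lpast Vh].
have Vfg : past G s (fun w => 1 * f w + g w).
  by case: past_family => _ _ + _; apply.
have := H _ Vfg; rewrite (_ : (fun w => _ * (X t w - X s w)) =
  fun w => f w * (X t w - X s w) + g w * (X t w - X s w)); last first.
  by apply/funext => w; rewrite mul1r mulrDl.
rewrite (_ : (fun w => 1 * f w + g w) = fun w => f w + g w); last first.
  by apply/funext => w; rewrite mul1r.
have LXD := L2D measurableT LfX LgX; have LD := L2D measurableT Lf Lg.
rewrite (ipDl measurableT LfX LgX LXD) (ipDr measurableT LfX LgX LfX) (ipDr measurableT LfX LgX LgX).
rewrite (ipDl measurableT Lf Lg LD) (ipDr measurableT Lf Lg Lf) (ipDr measurableT Lf Lg Lg).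
rewrite !H// (ipC _ _ (fun w => g w * _)) (ipC _ _ g) => E.
by rewrite mul1r; lra.
Qed.

End increments.
End orthogonal_increments.

Section normal_martingale.
Context d (T : measurableType d) (R : realType) (P : probability T R).

(** (M_t - M_s)^2 is the increment of the martingale M_t^2 - t, plus t - s, minus 2 M_s (M_t - M_s).
    The last term integrates to 0 over past events because M_s is adapted. *)
Lemma normal_martingale_orthogonal (M : R -> T -> R) : normal_martingale P M ->
  exists G, orthogonal_increments P G M.
Proof.
move=> [G [fG mM LM _ mM2]]; exists G.
have [aM0 iM eM] := mM; have aM t : 0 <= t -> adapted (G t) (M t) by move=> t0 U; exact: aM0.
have [aM2 iM2 eM2] := mM2.
have GT s : 0 <= s -> G s `<=` measurable by case: fG => _ + _; exact.
have sG s : 0 <= s -> sigma_algebra setT (G s) by case: fG => + _ _; exact.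
have sub (A : set T) f : measurable A -> P.-integrable setT (EFin \o f) ->
    P.-integrable A (EFin \o f).
  by move=> mA; exact: integrableS.
have z s t A : 0 <= s -> s <= t -> G s A -> \int[P]_(w in A) (M t w - M s w) = 0.
  move=> s0 st GA; have t0 := le_trans s0 st; have mA := GT s s0 A GA.
  rewrite RintegralB//; try by apply: sub => //; exact: iM.
  by rewrite /Rintegral (eM s t A)// subrr.
split => // s t A s0 st GA; have t0 := le_trans s0 st; have mA := GT s s0 A GA.
have LMt := LM t t0; have LMs := LM s s0; have LMB := L2B measurableT LMt LMs.
(* The indicator of [A] joins the past factor, so that [past_ip0] also covers integrals over [A]. *)
have LMsA : L2 P setT (fun w => \1_A w * M s w).
  split.
    by apply: measurable_funM; [exact: measurable_indic|exact: L2_measurable LMs].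
  apply: le_lt_trans (LMs.2); apply: ge0_le_integral => //.
  - by move=> w _; rewrite lee_fin sqr_ge0.
  - apply/measurable_EFinP/measurable_funX/measurable_funM.
      exact: measurable_indic.
    exact: L2_measurable LMs.
  - by apply/measurable_EFinP/measurable_funX; exact: L2_measurable LMs.
  - move=> w _; rewrite lee_fin exprMn indicE; case: (_ \in _).
      by rewrite expr1n mul1r.
    by rewrite expr0n/= mul0r sqr_ge0.
have cross : \int[P]_(w in A) (M s w * (M t w - M s w)) = 0.
  rewrite Rintegral_mkcond.
  rewrite -[RHS](past_ip0 fG LM z s0 st (f := fun w => \1_A w * M s w)).
  - apply: eq_Rintegral => w _; rewrite patchE indicE.
    by case: (_ \in _); rewrite ?mul1r ?mul0r.
  - apply: (adaptedM (sG s s0)); last exact: aM.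
    exact: adapted_indic.
  - exact: L2_integrableM.
have I1 : P.-integrable A (fun w => ((M t w - M s w) ^+ 2)%:E).
  by apply: sub => //; exact: L2_integrable_sqr.
have I2 : P.-integrable A (fun w => (M s w * (M t w - M s w))%:E).
  by apply: sub => //; exact: L2_integrableM.
have PA : P A \is a fin_num by exact: fin_num_measure.
have It : P.-integrable A (EFin \o fun w => M t w ^+ 2 - t).
  by apply: sub => //; exact: iM2.
have Is : P.-integrable A (EFin \o fun w => M s w ^+ 2 - s).
  by apply: sub => //; exact: iM2.
have Ic (c : R) : P.-integrable A (EFin \o fun=> c).
  by apply: sub => //; apply: L2_integrable; exact: L2_cst.
have E : \int[P]_(w in A) (M t w ^+ 2 - t) = \int[P]_(w in A) (M s w ^+ 2 - s).
  by rewrite /Rintegral (eM2 s t A).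
have key : \int[P]_(w in A) ((M t w - M s w) ^+ 2) = (t - s) * fine (P A).
  rewrite (_ : (fun w => _) = fun w => ((M t w ^+ 2 - t) - (M s w ^+ 2 - s)) +
      ((t - s) - 2 * (M s w * (M t w - M s w)))); last first.
    by apply/funext => w; ring.
  have I3 : P.-integrable A (EFin \o fun w => 2 * (M s w * (M t w - M s w))).
    exact: (integrableZl mA 2 I2).
  have I4 : P.-integrable A (EFin \o fun w => (M t w ^+ 2 - t) - (M s w ^+ 2 - s)).
    exact: (integrableB mA It Is).
  have I5 : P.-integrable A (EFin \o fun w => (t - s) - 2 * (M s w * (M t w - M s w))).
    exact: (integrableB mA (Ic (t - s)) I3).
  rewrite (RintegralD mA I4 I5) (RintegralB mA It Is) (RintegralB mA (Ic _) I3).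
  rewrite (RintegralZl _ mA I2) cross mulr0 subr0 E subrr add0r.
  by rewrite Rintegral_cst.
rewrite -(fineK PA) -EFinM -key /Rintegral fineK//.
exact: integrable_fin_num.
Qed.

End normal_martingale.

Lemma normal_prob_integral (R : realType) (s : R) (phi : R -> R) :
  measurable_fun setT phi -> (forall x, 0 <= phi x) ->
  (\int[normal_prob 0 s]_x (phi x)%:E =
   \int[@lebesgue_measure R]_x (phi x * normal_pdf 0 s x)%:E)%E.
Proof.
move=> mphi phi0.
transitivity (\int[normal_prob 0 s]_x (phi x * 1)%:E)%E.
  by apply: eq_integral => x _; rewrite mulr1.
apply: (@ge0_integral_adapted _ _ _ _
  (sigma_algebra_measurable (measurableTypeR R))) => //.
- exact: measurable_normal_pdf.
- by move=> x; exact: normal_pdf_ge0.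
- by move=> A mA; rewrite integral_cst// mul1e.
- by move=> U mU; rewrite -[X in measurable X]setTI; exact: mphi.
Qed.

(** * Increments of Brownian motion *)

Section brownian_motion.
Context d (T : measurableType d) (R : realType) (P : probability T R).
Variable B : R -> T -> R.
Hypothesis hB : brownian_motion P B.

Let G (t : R) : set (set T) := history B `[0, t].

Let mB t : 0 <= t -> measurable_fun setT (B t).
Proof. by case: hB => + _ _ _ _; exact. Qed.

Lemma history_filtration : filtration G.
Proof.
split.
- by move=> t t0; exact: smallest_sigma_algebra.
- move=> t t0; apply: smallest_sub; first exact: sigma_algebra_measurable.
  move=> _ [u [U [+ mU ->]]]; rewrite /= in_itv/= => /andP[u0 _].
  by rewrite -[X in measurable X]setTI; exact: mB.
- move=> s t s0 st; apply: sub_sigma_algebra2 => _ [u [U [+ mU ->]]].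
  rewrite /= in_itv/= => /andP[u0 us]; exists u, U; split => //.
  by rewrite /= in_itv/= u0 (le_trans us).
Qed.

Lemma history_adapted t : 0 <= t -> adapted (G t) (B t).
Proof.
move=> t0 U mU; apply: sub_sigma_algebra; exists t, U; split => //.
by rewrite /= in_itv/= t0 lexx.
Qed.

Let mBB s t : 0 <= s -> s < t -> measurable_fun setT (B t \- B s).
Proof.
by move=> s0 st; apply: measurable_funB; apply: mB => //; rewrite (le_trans s0)// ltW.
Qed.

(** Here the sub-sigma-algebra is the one generated by the increment, and the two densities are the
    indicator of [A] and the constant [P A]; independence says that they agree on it. *)
Lemma brownian_increment_integral s t A (phi : R -> R) : 0 <= s -> s < t -> G s A ->
  measurable_fun setT phi -> (forall x, 0 <= phi x) ->
  (\int[P]_(w in A) (phi (B t w - B s w))%:E =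
   P A * \int[@lebesgue_measure R]_x (phi x * normal_pdf 0 (Num.sqrt (t - s)) x)%:E)%E.
Proof.
move=> s0 st GA mphi phi0.
have mA : measurable A by have [_ + _] := history_filtration; apply; first exact: s0.
have mD := mBB s0 st; set D := B t \- B s in mD.
have [_ _ _ lawB indB] := hB.
pose GD := preimage_set_system setT D (@measurable _ (measurableTypeR R)).
have sGD : sigma_algebra setT GD.
  by apply: sigma_algebra_preimage; exact: sigma_algebra_measurable.
have GDT : GD `<=` measurable by move=> _ [U mU <-]; exact: mD.
have PA : P A \is a fin_num by exact: fin_num_measure.
have PA0 : 0 <= fine (P A) by rewrite fine_ge0.
have mphiD : measurable_fun setT (phi \o D) by exact: measurableT_comp.
transitivity (\int[P]_w (phi (D w) * \1_A w)%:E)%E.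
  rewrite integral_mkcond; apply: eq_integral => w _; rewrite patchE indicE.
  by case: (_ \in _); rewrite ?mulr1 ?mulr0.
rewrite (@ge0_integral_adapted _ _ _ GD sGD GDT P P _ (fun=> fine (P A)) (phi \o D)).
- under eq_integral do rewrite mulrC EFinM.
  rewrite ge0_integralZl//; last 2 first.
  + exact/measurable_EFinP.
  + by move=> w _; rewrite lee_fin; exact: phi0.
  rewrite fineK//; congr (_ * _)%E.
  rewrite -normal_prob_integral//.
  have := @ge0_integral_pushforward _ _ T (measurableTypeR R) _ D mD P setT (EFin \o phi) measurableT.
  rewrite preimage_setT => <-.
  + apply: eq_measure_integral => U mU _.
    exact: (lawB s t U s0 st mU).
  + exact/measurable_EFinP.
  + by move=> x _; rewrite lee_fin.
- exact: measurable_indic.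
- exact: measurable_cst.
- by move=> w; rewrite indicE.
- by [].
- move=> _ [U mU <-]; rewrite setTI integral_indic//; last first.
    by rewrite -[X in measurable X]setTI; exact: mD.
  rewrite integral_cst; last by rewrite -[X in measurable X]setTI; exact: mD.
  rewrite fineK//; exact: (indB s t A U s0 st GA mU).
- by move=> U mU; exists (phi @^-1` U); [rewrite -[X in measurable X]setTI; exact: mphi|rewrite setTI].
- by move=> w; exact: phi0.
Qed.

(** Only increments have a prescribed law, so [B 0], which is almost surely 0, is split off. *)
Lemma brownian_L2 t : 0 <= t -> L2 P setT (B t).
Proof.
move=> t0; have [_ B00 _ _ _] := hB.
have L0 : L2 P setT (B 0).
  split; first exact: mB.
  rewrite (_ : sqnorm _ _ _ = 0%E) ?ltry//.
  apply/sqnorm_eq0 => //; first exact: mB.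
  by apply: filterS B00 => w.
move: t0; rewrite le_eqVlt => /orP[/eqP <-//|t0].
have L1 : L2 P setT (fun w => B t w - B 0 w).
  split; first exact: mBB.
  have GT0 : G 0 setT.
    have [+ _ _] := history_filtration => /(_ 0 (lexx 0)) sg.
    by case: sg => g0 gC _; rewrite -(setD0 setT); exact: gC.
  rewrite /sqnorm (brownian_increment_integral (phi := fun x => x ^+ 2) (lexx 0) t0 GT0).
  - under eq_integral do rewrite EFinM.
    rewrite normal_pdf_second_moment; last by rewrite subr0 gt_eqF// sqrtr_gt0.
    by rewrite [X in (X * _)%E]probability_setT mul1e ltry.
  - exact: exprn_measurable.
  - by move=> x; exact: sqr_ge0.
by have := L2D measurableT L1 L0; under eq_fun do rewrite subrK.
Qed.

Lemma brownian_orthogonal : orthogonal_increments P G B.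
Proof.
have fG := history_filtration.
have GT s A : 0 <= s -> G s A -> measurable A by move=> s0; case: fG => _ + _; exact.
split => //.
- by move=> t; exact: history_adapted.
- by move=> t; exact: brownian_L2.
- move=> s t A s0; rewrite le_eqVlt => /orP[/eqP ->|st] GA.
    under eq_Rintegral do rewrite subrr.
    by rewrite /Rintegral integral0.
  have mA := GT s A s0 GA; have t0 := le_trans s0 (ltW st).
  have iB : P.-integrable A (EFin \o fun w => B t w - B s w).
    apply: (@integrableS _ _ _ _ setT) => //; apply: L2_integrable.
    by apply: L2B => //; exact: brownian_L2.
  have mB' : measurable_fun A (EFin \o fun w => B t w - B s w) by exact: measurable_int iB.
  set s' := Num.sqrt (t - s).
  have e1 : (\int[P]_(w in A) (Num.max (B t w - B s w) 0)%:E = P A *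
      \int[@lebesgue_measure R]_x (Num.max x 0 * normal_pdf 0 s' x)%:E)%E.
    apply: (brownian_increment_integral (phi := fun x => Num.max x 0) s0 st GA) => //.
      by apply: measurable_maxr => //; exact: measurable_cst.
    by move=> x; rewrite le_max lexx orbT.
  have e2 : (\int[P]_(w in A) (Num.max (- (B t w - B s w)) 0)%:E = P A *
      \int[@lebesgue_measure R]_x (Num.max (- x) 0 * normal_pdf 0 s' x)%:E)%E.
    apply: (brownian_increment_integral (phi := fun x => Num.max (- x) 0) s0 st GA) => //.
      by apply: measurable_maxr; [exact: oppr_measurable|exact: measurable_cst].
    by move=> x; rewrite le_max lexx orbT.
  (* Reflection preserves Lebesgue measure and the centered normal density, so the positive and
     negative parts of the increment have the same integral over [A]. *)
  have e3 : (\int[@lebesgue_measure R]_x (Num.max (- x) 0 * normal_pdf 0 s' x)%:E =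
      \int[@lebesgue_measure R]_x (Num.max x 0 * normal_pdf 0 s' x)%:E)%E.
    have mN : measurable_fun setT (-%R : measurableTypeR R -> measurableTypeR R).
      exact: oppr_measurable.
    have mh : measurable_fun setT (fun x : R => (Num.max x 0 * normal_pdf 0 s' x)%:E).
      apply/measurable_EFinP; apply: measurable_funM.
        by apply: measurable_maxr => //; exact: measurable_cst.
      exact: measurable_normal_pdf.
    have := @ge0_integral_pushforward _ _ _ _ R _ mN (@lebesgue_measure R) setT
      (fun x : R => (Num.max x 0 * normal_pdf 0 s' x)%:E) measurableT mh.
    rewrite preimage_setT => h; transitivity
      (\int[pushforward (@lebesgue_measure R) (-%R : measurableTypeR R -> measurableTypeR R)]_x
        (Num.max x 0 * normal_pdf 0 s' x)%:E)%E.
      rewrite h; last by move=> x _; rewrite lee_fin mulr_ge0 ?normal_pdf_ge0// le_max lexx orbT.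
      by apply: eq_integral => x _ /=; rewrite normal_pdf_sym// sqrtr_eq0 -ltNge subr_gt0.
    by apply: eq_measure_integral => U mU _; exact: lebesgue_measureN.
  pose W w := B t w - B s w.
  have pE : (\int[P]_(w in A) (EFin \o W)^\+%E w = P A *
      \int[@lebesgue_measure R]_x (Num.max x 0 * normal_pdf 0 s' x)%:E)%E.
    by rewrite funerpos -e1.
  have nE : (\int[P]_(w in A) (EFin \o W)^\-%E w = P A *
      \int[@lebesgue_measure R]_x (Num.max x 0 * normal_pdf 0 s' x)%:E)%E.
    by rewrite funerneg -e3 -e2.
  rewrite /Rintegral -[X in fine X = _]/(\int[P]_(w in A) (EFin \o W) w)%E integralE nE -pE subee//.
  by apply: integrable_fin_num => //; exact: integrable_funepos.
- move=> s t A s0; rewrite le_eqVlt => /orP[/eqP ->|st] GA.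
    rewrite subrr mul0e; under eq_integral do rewrite subrr expr0n/=.
    exact: integral0.
  rewrite (brownian_increment_integral (phi := fun x => x ^+ 2) s0 st GA).
  + under eq_integral do rewrite EFinM.
    rewrite normal_pdf_second_moment; last by rewrite sqrtr_eq0 -ltNge subr_gt0.
    by rewrite sqr_sqrtr ?subr_ge0 ?(ltW st)// muleC.
  + exact: exprn_measurable.
  + by move=> x; exact: sqr_ge0.
Qed.

End brownian_motion.

(** * Tensors on the product space *)

Section product_space.
Context {R : realType} {d1 d2 : measure_display}
  {T1 : measurableType d1} {T2 : measurableType d2}.
Variables (P1 : probability T1 R) (P2 : probability T2 R).
Local Notation P := (P1 \x P2)%E.

Lemma sqnorm_tensor (f : T1 -> R) (g : T2 -> R) : measurable_fun setT f -> measurable_fun setT g ->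
  sqnorm P setT (fun w => f w.1 * g w.2) =
  (sqnorm P1 setT f * sqnorm P2 setT g)%E.
Proof.
move=> mf mg.
have mf1 : measurable_fun setT (fun w : T1 * T2 => f w.1) by exact: measurableT_comp.
have mg2 : measurable_fun setT (fun w : T1 * T2 => g w.2) by exact: measurableT_comp.
rewrite /sqnorm fubini_tonelli1; last 2 first.
- by apply/measurable_EFinP/measurable_funX/measurable_funM.
- by move=> w; rewrite lee_fin sqr_ge0.
rewrite -ge0_integralZr//; last 3 first.
- by apply/measurable_EFinP/measurable_funX.
- by move=> w _; rewrite lee_fin sqr_ge0.
- by apply: integral_ge0 => w _; rewrite lee_fin sqr_ge0.
apply: eq_integral => x _; rewrite /fubini_F/= -ge0_integralZl//.
- by apply: eq_integral => y _; rewrite exprMn.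
- by apply/measurable_EFinP/measurable_funX.
- by move=> w _; rewrite lee_fin sqr_ge0.
- by rewrite lee_fin sqr_ge0.
Qed.

Lemma L2_tensor f g : L2 P1 setT f -> L2 P2 setT g -> L2 P setT (fun w => f w.1 * g w.2).
Proof.
move=> [mf If] [mg Ig]; split.
  by apply: measurable_funM; exact: measurableT_comp.
rewrite sqnorm_tensor// lte_mul_pinfty// ?sqnorm_ge0//.
by rewrite ge0_fin_numE// sqnorm_ge0.
Qed.

Lemma ip_tensor f g f' g' : L2 P1 setT f -> L2 P2 setT g ->
  L2 P1 setT f' -> L2 P2 setT g' ->
  ip P setT (fun w => f w.1 * g w.2) (fun w => f' w.1 * g' w.2) =
  ip P1 setT f f' * ip P2 setT g g'.
Proof.
move=> Lf Lg Lf' Lg'.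
have i1 := L2_integrableM measurableT Lf Lf'.
have i2 := L2_integrableM measurableT Lg Lg'.
have i3 := L2_integrableM measurableT (L2_tensor Lf Lg) (L2_tensor Lf' Lg').
rewrite /ip /Rintegral -integral12_prod_meas1//.
rewrite -[RHS]/(fine _%:E) EFinM !fineK; try exact: integrable_fin_num.
set k := (\int[P2]_y _)%E; have kfin : k \is a fin_num by exact: integrable_fin_num.
congr fine; rewrite -(fineK kfin) -integralZr//.
apply: eq_integral => x _; rewrite fineK// /k /fubini_F/=.
rewrite -integralZl//; apply: eq_integral => y _.
by rewrite -EFinM; congr EFin; ring.
Qed.

(** The algebraic span contains the constant 1 and is stable under multiplication by increments of
    either process, so it contains all products that occur. The list form gives an induction that
    splits off one tensor at a time. *)
Inductive tensor_span (V1 : (T1 -> R) -> Prop) (V2 : (T2 -> R) -> Prop) :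
    (T1 * T2 -> R) -> Prop :=
| tensor_span0 : tensor_span V1 V2 (fun=> 0)
| tensor_spanD f g h : V1 f -> V2 g -> tensor_span V1 V2 h ->
    tensor_span V1 V2 (fun w => f w.1 * g w.2 + h w).

Section tensor_family.
Variables (V1 : R -> (T1 -> R) -> Prop) (V2 : R -> (T2 -> R) -> Prop).
Hypotheses (aV1 : adapted_family P1 V1) (aV2 : adapted_family P2 V2).

Definition tensor_past (s : R) := tensor_span (V1 s) (V2 s).

Let one1 s : 0 <= s -> V1 s (fun=> 1). Proof. by case: aV1 => _ _ _; exact. Qed.
Let one2 s : 0 <= s -> V2 s (fun=> 1). Proof. by case: aV2 => _ _ _; exact. Qed.

Let VL1 s f : 0 <= s -> V1 s f -> L2 P1 setT f.
Proof. by move=> s0; case: aV1 => + _ _ _; exact. Qed.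
Let VL2 s f : 0 <= s -> V2 s f -> L2 P2 setT f.
Proof. by move=> s0; case: aV2 => + _ _ _; exact. Qed.
Let Vle1 s t f : 0 <= s -> s <= t -> V1 s f -> V1 t f.
Proof. by case: aV1 => _ + _ _; exact. Qed.
Let Vle2 s t f : 0 <= s -> s <= t -> V2 s f -> V2 t f.
Proof. by case: aV2 => _ + _ _; exact. Qed.

Let VZ1 s a f : 0 <= s -> V1 s f -> V1 s (fun w => a * f w).
Proof.
case: aV1 => _ _ lin _ s0 Vf.
have V0 : V1 s (fun=> 0).
  have := lin s (-1) _ _ s0 (one1 s0) (one1 s0).
  by under eq_fun do rewrite mulr1 addNr.
by have := lin s a f _ s0 Vf V0; under eq_fun do rewrite addr0.
Qed.

Let VL s f : 0 <= s -> tensor_past s f -> L2 P setT f.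
Proof.
move=> s0; elim=> [|{}f g h Vf Vg Vh Lh]; first exact: L2_0.
apply: L2D => //; apply: L2_tensor; [exact: VL1 Vf|exact: VL2 Vg].
Qed.

Lemma tensor_past_family : adapted_family P tensor_past.
Proof.
split.
- exact: VL.
- move=> s t f s0 st; elim=> [|{}f g h Vf Vg Vh Wh]; first exact: tensor_span0.
  by apply: tensor_spanD => //; [exact: Vle1 Vf|exact: Vle2 Vg].
- move=> s a f g s0; elim=> [|{}f f' h Vf Vf' Vh ih] Vg.
    by under eq_fun do rewrite mulr0 add0r.
  rewrite (_ : (fun w => _) = fun w => (a * f w.1) * f' w.2 + (a * h w + g w)).
    by apply: (tensor_spanD (f := fun w1 => a * f w1)); [exact: VZ1|by []|exact: ih].
  by apply/funext => w; ring.
- move=> s s0; have := tensor_spanD (one1 s0) (one2 s0) (tensor_span0 (V1 s) (V2 s)).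
  by under eq_fun do rewrite mulr1 addr0.
Qed.

(* An identity between bilinear expressions needs to be checked on tensors only. *)
Lemma tensor_past_ip s (u v : T1 * T2 -> R) c f g : 0 <= s ->
  (forall f, tensor_past s f -> L2 P setT (fun w => f w * u w)) ->
  (forall f, tensor_past s f -> L2 P setT (fun w => f w * v w)) ->
  (forall f1 f2 g1 g2, V1 s f1 -> V2 s f2 -> V1 s g1 -> V2 s g2 ->
    ip P setT (fun w => f1 w.1 * f2 w.2 * u w) (fun w => g1 w.1 * g2 w.2 * v w) =
    c * ip P setT (fun w => f1 w.1 * f2 w.2) (fun w => g1 w.1 * g2 w.2)) ->
  tensor_past s f -> tensor_past s g ->
  ip P setT (fun w => f w * u w) (fun w => g w * v w) = c * ip P setT f g.
Proof.
move=> s0 Lu Lv H; elim=> [|{}f f' h Vf Vf' Vh ih] Vg.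
  by under [X in ip _ _ X _]eq_fun do rewrite mul0r; rewrite !ip0l mulr0.
have Vff : tensor_past s (fun w => f w.1 * f' w.2).
  by have := tensor_spanD Vf Vf' (tensor_span0 _ _); under eq_fun do rewrite addr0.
rewrite (_ : (fun w => _ * u w) = fun w => f w.1 * f' w.2 * u w + h w * u w); last first.
  by apply/funext => w; rewrite mulrDl.
rewrite (ipDl measurableT (Lu _ Vff) (Lu _ Vh) (Lv _ Vg)) ih//.
rewrite (ipDl measurableT (VL s0 Vff) (VL s0 Vh) (VL s0 Vg)) mulrDr.
congr (_ + _).
clear ih; elim: Vg => [|{}g g' k Vg Vg' Vk ihg].
  by under [X in ip _ _ _ X]eq_fun do rewrite mul0r; rewrite !ip0r mulr0.
have Vgg : tensor_past s (fun w => g w.1 * g' w.2).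
  by have := tensor_spanD Vg Vg' (tensor_span0 _ _); under eq_fun do rewrite addr0.
rewrite (_ : (fun w => _ * v w) = fun w => g w.1 * g' w.2 * v w + k w * v w); last first.
  by apply/funext => w; rewrite mulrDl.
rewrite (ipDr measurableT (Lv _ Vgg) (Lv _ Vk) (Lu _ Vff)) ihg//.
by rewrite (ipDr measurableT (VL s0 Vgg) (VL s0 Vk) (VL s0 Vff)) mulrDr H.
Qed.

Variables (B : R -> T1 -> R) (M : R -> T2 -> R).
Hypotheses (cB : compatible V1 B) (cM : compatible V2 M).
Hypotheses (zB : centered P1 V1 B) (zM : centered P2 V2 M).
Hypotheses (vB : covariation P1 V1 B B 1) (vM : covariation P2 V2 M M 1).

Definition process1 (t : R) (w : T1 * T2) := B t w.1.
Definition process2 (t : R) (w : T1 * T2) := M t w.2.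

Lemma process1_compatible : compatible tensor_past process1.
Proof.
move=> s t f s0 st; elim=> [|{}f g h Vf Vg Vh ih].
  by under eq_fun do rewrite mul0r; exact: tensor_span0.
rewrite (_ : (fun w => _) = fun w => (f w.1 * (B t w.1 - B s w.1)) * g w.2 +
    h w * (process1 t w - process1 s w)).
  apply: (tensor_spanD (f := fun w1 => f w1 * (B t w1 - B s w1))) => //.
    exact: cB.
  exact: Vle2 Vg.
by apply/funext => w; rewrite /process1; ring.
Qed.

Lemma process2_compatible : compatible tensor_past process2.
Proof.
move=> s t f s0 st; elim=> [|{}f g h Vf Vg Vh ih].
  by under eq_fun do rewrite mul0r; exact: tensor_span0.
rewrite (_ : (fun w => _) = fun w => f w.1 * (g w.2 * (M t w.2 - M s w.2)) +
    h w * (process2 t w - process2 s w)).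
  apply: (tensor_spanD (g := fun w2 => g w2 * (M t w2 - M s w2))) => //.
    exact: Vle1 Vf.
  exact: cM.
by apply/funext => w; rewrite /process2; ring.
Qed.

Let Lp1 s t f : 0 <= s -> s <= t -> tensor_past s f ->
  L2 P setT (fun w => f w * (process1 t w - process1 s w)).
Proof.
move=> s0 st Vf; apply: (VL (le_trans s0 st)); exact: process1_compatible.
Qed.

Let Lp2 s t f : 0 <= s -> s <= t -> tensor_past s f ->
  L2 P setT (fun w => f w * (process2 t w - process2 s w)).
Proof.
move=> s0 st Vf; apply: (VL (le_trans s0 st)); exact: process2_compatible.
Qed.

Let L1 s f : 0 <= s -> tensor_past s f -> L2 P setT (fun w => f w * 1).
Proof. by move=> s0 Vf; under eq_fun do rewrite mulr1; exact: VL Vf. Qed.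

Let LB s t f : 0 <= s -> s <= t -> V1 s f -> L2 P1 setT (fun w => f w * (B t w - B s w)).
Proof. by move=> s0 st Vf; apply: (VL1 (le_trans s0 st)); exact: cB. Qed.

Let LM s t f : 0 <= s -> s <= t -> V2 s f -> L2 P2 setT (fun w => f w * (M t w - M s w)).
Proof. by move=> s0 st Vf; apply: (VL2 (le_trans s0 st)); exact: cM. Qed.

Let T1E s t (f1 : T1 -> R) (f2 : T2 -> R) :
  (fun w => f1 w.1 * f2 w.2 * (process1 t w - process1 s w)) =
  (fun w => (f1 w.1 * (B t w.1 - B s w.1)) * f2 w.2).
Proof. by apply/funext => w; rewrite /process1; ring. Qed.

Let T2E s t (f1 : T1 -> R) (f2 : T2 -> R) :
  (fun w => f1 w.1 * f2 w.2 * (process2 t w - process2 s w)) =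
  (fun w => f1 w.1 * (f2 w.2 * (M t w.2 - M s w.2))).
Proof. by apply/funext => w; rewrite /process2; ring. Qed.

Let tensor_ip := @ip_tensor.

Lemma process1_centered : centered P tensor_past process1.
Proof.
move=> s t f g s0 st Vf Vg.
rewrite -[RHS](mul0r (ip P setT f g)).
rewrite -(tensor_past_ip (u := fun=> 1) (v := fun w => process1 t w - process1 s w) s0)//.
- by congr ip; apply/funext => w; rewrite mulr1.
- by move=> k; exact: L1.
- by move=> k; exact: Lp1.
move=> f1 f2 g1 g2 Vf1 Vf2 Vg1 Vg2; rewrite mul0r T1E.
under [X in ip _ _ X _]eq_fun do rewrite mulr1.
rewrite (tensor_ip (VL1 s0 Vf1) (VL2 s0 Vf2) (LB s0 st Vg1) (VL2 s0 Vg2)).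
by rewrite zB// mul0r.
Qed.

Lemma process2_centered : centered P tensor_past process2.
Proof.
move=> s t f g s0 st Vf Vg.
rewrite -[RHS](mul0r (ip P setT f g)).
rewrite -(tensor_past_ip (u := fun=> 1) (v := fun w => process2 t w - process2 s w) s0)//.
- by congr ip; apply/funext => w; rewrite mulr1.
- by move=> k; exact: L1.
- by move=> k; exact: Lp2.
move=> f1 f2 g1 g2 Vf1 Vf2 Vg1 Vg2; rewrite mul0r T2E.
under [X in ip _ _ X _]eq_fun do rewrite mulr1.
rewrite (tensor_ip (VL1 s0 Vf1) (VL2 s0 Vf2) (VL1 s0 Vg1) (LM s0 st Vg2)).
by rewrite zM// mulr0.
Qed.

Lemma process11_covariation : covariation P tensor_past process1 process1 1.
Proof.
move=> s t f g s0 st Vf Vg; rewrite mul1r.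
apply: (tensor_past_ip s0) => //; try by move=> k; exact: Lp1.
move=> f1 f2 g1 g2 Vf1 Vf2 Vg1 Vg2; rewrite !T1E.
rewrite (tensor_ip (LB s0 st Vf1) (VL2 s0 Vf2) (LB s0 st Vg1) (VL2 s0 Vg2)).
rewrite (tensor_ip (VL1 s0 Vf1) (VL2 s0 Vf2) (VL1 s0 Vg1) (VL2 s0 Vg2)).
by rewrite vB// mul1r mulrA.
Qed.

Lemma process22_covariation : covariation P tensor_past process2 process2 1.
Proof.
move=> s t f g s0 st Vf Vg; rewrite mul1r.
apply: (tensor_past_ip s0) => //; try by move=> k; exact: Lp2.
move=> f1 f2 g1 g2 Vf1 Vf2 Vg1 Vg2; rewrite !T2E.
rewrite (tensor_ip (VL1 s0 Vf1) (LM s0 st Vf2) (VL1 s0 Vg1) (LM s0 st Vg2)).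
rewrite (tensor_ip (VL1 s0 Vf1) (VL2 s0 Vf2) (VL1 s0 Vg1) (VL2 s0 Vg2)).
by rewrite vM// mul1r mulrCA.
Qed.

(** The independence of B and M enters here: the inner product factorizes, and its second factor
    vanishes because M is centered. *)
Lemma process12_covariation : covariation P tensor_past process1 process2 0.
Proof.
move=> s t f g s0 st Vf Vg; rewrite mul0r.
apply: (tensor_past_ip s0) => //.
- by move=> k; exact: Lp1.
- by move=> k; exact: Lp2.
move=> f1 f2 g1 g2 Vf1 Vf2 Vg1 Vg2; rewrite T1E T2E mul0r.
rewrite (tensor_ip (LB s0 st Vf1) (VL2 s0 Vf2) (VL1 s0 Vg1) (LM s0 st Vg2)).
by rewrite zM// mulr0.
Qed.

End tensor_family.
End product_space.

(** * Lebesgue measure on the simplex *)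

Section simplex_measure.
Variable R : realType.
Local Notation mR := (measurableTypeR R).
Local Notation leb := (@lebesgue_measure R).
Local Notation nleb := (nlebesgue R).

Lemma tnth_consT0 n (s : mR) (x : n.-tuple mR) : tnth (consT (s, x)) ord0 = s.
Proof. by rewrite (tnth_nth s). Qed.

Lemma tnth_consT_lift n (s : mR) (x : n.-tuple mR) (i : 'I_n) :
  tnth (consT (s, x)) (lift ord0 i) = tnth x i.
Proof. by rewrite !(tnth_nth s). Qed.

Lemma nlebesgue_integralS n (h : n.+1.-tuple mR -> \bar R) :
  measurable_fun setT h -> (forall x, 0 <= h x)%E ->
  (\int[nleb n.+1]_x h x = \int[(leb \x nleb n)%E]_p h (consT p))%E.
Proof.
move=> mh h0; have := @ge0_integral_pushforward _ _ _ _ R _ (@measurable_consT R n)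
  (leb \x nleb n)%E setT h measurableT mh (fun x _ => h0 x).
by rewrite preimage_setT.
Qed.

Lemma measurable_orthant n : measurable (@orthant R n).
Proof.
rewrite (_ : @orthant R n = \bigcap_(i in [set: 'I_n]) [set x | 0 <= (tnth x i : R)]).
  apply: fin_bigcap_measurable => [|i _]; first exact: finite_finset.
  rewrite (_ : [set x | _] = (fun x : n.-tuple mR => tnth x i : mR) @^-1` `[0, +oo[%classic).
    by rewrite -[X in measurable X]setTI; exact: measurable_tnth.
  by apply/seteqP; split=> x /=; rewrite in_itv/= andbT.
by apply/seteqP; split=> [x h i _|x h i]; [exact: h|exact: (h i Logic.I)].
Qed.

Lemma measurable_simplex n : measurable (@simplex R n).
Proof.
have mt (i : 'I_n) : measurable_fun setT (fun x : n.-tuple mR => tnth x i : R).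
  exact: measurable_tnth.
have m1 (i : 'I_n) : measurable [set x : n.-tuple mR | 0 < (tnth x i : R)].
  rewrite -[X in measurable X]setTI; have := measurable_fun_ltr (measurable_cst (0 : R)) (mt i).
  by move/(_ measurableT [set true]) => /=; rewrite /preimage/=; apply.
have m2 (i j : 'I_n) : measurable [set x : n.-tuple mR | (i < j)%N -> (tnth x i : R) < (tnth x j : R)].
  have [ij|ij] := boolP (i < j)%N; last first.
    rewrite (_ : [set x | _] = setT) ?measurableT//; apply/seteqP; split=> // x _ /=.
  rewrite (_ : [set x | _] = [set x : n.-tuple mR | (tnth x i : R) < (tnth x j : R)]); last first.
    by apply/seteqP; split=> x /=; [exact|].
  rewrite -[X in measurable X]setTI; have := measurable_fun_ltr (mt i) (mt j).
  by move/(_ measurableT [set true]) => /=; rewrite /preimage/=; apply.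
rewrite (_ : @simplex R n = \bigcap_(i in [set: 'I_n]) [set x | 0 < (tnth x i : R)] `&`
  \bigcap_(i in [set: 'I_n]) \bigcap_(j in [set: 'I_n])
    [set x : n.-tuple mR | (i < j)%N -> (tnth x i : R) < (tnth x j : R)]).
  apply: measurableI; first by apply: fin_bigcap_measurable => //; exact: finite_finset.
  apply: fin_bigcap_measurable => [|i _]; first exact: finite_finset.
  by apply: fin_bigcap_measurable => [|j _ //]; exact: finite_finset.
apply/seteqP; split=> x [h1 h2]; split=> //=.
- by move=> i _; exact: h1.
- by move=> i _ j _; exact: h2.
- by move=> i; exact: (h1 i).
- by move=> i j; exact: (h2 i Logic.I j).
Qed.

Lemma nlebesgue_box n (A : 'I_n -> set mR) : (forall i, measurable (A i)) ->
  (\int[nleb n]_x (\prod_(i < n) \1_(A i) (tnth x i))%:E =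
   \prod_(i < n) leb (A i))%E.
Proof.
elim: n A => [|n ih] A mA.
  rewrite /= (eq_integral (fun=> 1%E)); last by move=> x _; rewrite big_ord0.
  by rewrite integral_cst// big_ord0 mul1e; exact: diracT.
have m1 k (C : 'I_k -> set mR) : (forall i, measurable (C i)) ->
    measurable_fun setT (fun x : k.-tuple mR => (\prod_(i < k) \1_(C i) (tnth x i) : R)%:E).
  move=> mC; apply/measurable_EFinP; apply: measurable_prod => i _.
  apply: measurableT_comp; first exact: measurable_indic.
  exact: measurable_tnth.
rewrite nlebesgue_integralS//; last 2 first.
- exact: m1.
- by move=> x; rewrite lee_fin; apply: prodr_ge0 => i _; rewrite indicE.
rewrite fubini_tonelli1; last 2 first.
- exact: (measurableT_comp (m1 n.+1 A mA) (@measurable_consT R n)).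
- by move=> x; rewrite lee_fin; apply: prodr_ge0 => i _; rewrite indicE.
rewrite big_ord_recl -ih; last by move=> i; exact: mA.
set I := (\int[nleb n]_x _)%E; rewrite /fubini_F.
transitivity (\int[leb]_s ((\1_(A ord0) s)%:E * I))%E.
  apply: eq_integral => s _; rewrite -ge0_integralZl//.
  - apply: eq_integral => x _; rewrite big_ord_recl -EFinM tnth_consT0.
    by congr (_ * _)%:E; apply: eq_bigr => i _; rewrite tnth_consT_lift.
  - by apply: m1 => i; exact: mA.
  - by move=> x _; rewrite lee_fin; apply: prodr_ge0 => i _; rewrite indicE.
rewrite ge0_integralZr//.
- by rewrite integral_indic ?setIT//.
- by apply/measurable_EFinP; exact: measurable_indic.
- by apply: integral_ge0 => x _; rewrite lee_fin; apply: prodr_ge0 => i _; rewrite indicE.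
Qed.

Definition insert n (i : 'I_n.+1) (s : mR) (x : n.-tuple mR) : n.+1.-tuple mR :=
  [tuple oapp (tnth x) s (unlift i k) | k < n.+1].

Lemma tnth_insert n (i : 'I_n.+1) s (x : n.-tuple mR) : tnth (insert i s x) i = s.
Proof. by rewrite tnth_mktuple unlift_none. Qed.

Lemma tnth_insert_lift n (i : 'I_n.+1) s (x : n.-tuple mR) j :
  tnth (insert i s x) (lift i j) = tnth x j.
Proof. by rewrite tnth_mktuple liftK. Qed.

Lemma insert0 n s (x : n.-tuple mR) : insert ord0 s x = consT (s, x).
Proof.
apply: eq_from_tnth => k; case: (unliftP ord0 k) => [j ->|->].
  by rewrite tnth_insert_lift tnth_consT_lift.
by rewrite tnth_insert tnth_consT0.
Qed.

Lemma insertS n (i : 'I_n.+1) s y (x : n.-tuple mR) :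
  insert (lift ord0 i) s (consT (y, x)) = consT (y, insert i s x).
Proof.
apply: eq_from_tnth => k; case: (unliftP ord0 k) => [j ->|->].
  rewrite tnth_consT_lift; case: (unliftP i j) => [l ->|->].
    rewrite tnth_insert_lift (_ : lift ord0 (lift i l) = lift (lift ord0 i) (lift ord0 l)).
      by rewrite tnth_insert_lift tnth_consT_lift.
    by apply: val_inj; rewrite /= /bump/= !add1n ltnS addnS.
  by rewrite !tnth_insert.
rewrite tnth_consT0 (_ : ord0 = lift (lift ord0 i) ord0).
  by rewrite tnth_insert_lift tnth_consT0.
by apply: val_inj.
Qed.

Lemma measurable_insert n (i : 'I_n.+1) :
  measurable_fun setT (fun p : mR * n.-tuple mR => insert i p.1 p.2).
Proof.
apply/measurable_fun_tnthP => k; case: (unliftP i k) => [j ->|->].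
  rewrite (_ : _ \o _ = fun p => tnth p.2 j); last first.
    by apply/funext => p /=; rewrite tnth_insert_lift.
  by apply: (measurableT_comp (f := @tnth n mR ^~ j)) => //; exact: measurable_tnth.
rewrite (_ : _ \o _ = fst); first exact: measurable_fst.
by apply/funext => p /=; rewrite tnth_insert.
Qed.

(** Moving the first coordinate to position i preserves the measure: the induction swaps the two
    leading coordinates by Tonelli's theorem and then moves s within the tail. *)
Lemma nlebesgue_insert n (i : 'I_n.+1) (h : n.+1.-tuple mR -> \bar R) :
  measurable_fun setT h -> (forall x, 0 <= h x)%E ->
  (\int[(leb \x nleb n)%E]_p h (insert i p.1 p.2) = \int[nleb n.+1]_x h x)%E.
Proof.
elim: n i h => [|n ih] i h mh h0.
  rewrite nlebesgue_integralS//; apply: eq_integral => -[s x] _ /=.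
  by rewrite (ord1 i) insert0.
case: (unliftP ord0 i) => [j ->|->]; last first.
  by rewrite nlebesgue_integralS//; apply: eq_integral => -[s x] _ /=; rewrite insert0.
have mhi k : measurable_fun setT (fun p : mR * _ => h (insert k p.1 p.2)).
  exact: measurableT_comp (measurable_insert k).
have mcons (y : mR) : measurable_fun setT (fun z : n.+1.-tuple mR => h (consT (y, z))).
  apply: (measurableT_comp mh).
  exact: (measurableT_comp (@measurable_consT R _) (pair1_measurable y)).
rewrite (fubini_tonelli1 _ (mhi (lift ord0 j)) (fun p => h0 _)).
have mhc : measurable_fun setT (fun p : mR * n.+1.-tuple mR => h (consT p)).
  exact: (measurableT_comp mh (@measurable_consT R _)).
rewrite nlebesgue_integralS// [RHS](fubini_tonelli1 _ mhc (fun p => h0 _)).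
transitivity (\int[leb]_s \int[leb]_y \int[nleb n]_x h (consT (y, insert j s x)))%E.
  apply: eq_integral => s _; rewrite /fubini_F nlebesgue_integralS//; last first.
    apply: measurableT_comp => //.
    exact: (measurableT_comp (measurable_insert (lift ord0 j)) (pair1_measurable s)).
  have mhs : measurable_fun setT (fun q : mR * n.-tuple mR =>
      h (insert (lift ord0 j) s (consT q))).
    apply: (measurableT_comp (f := fun z => h (insert (lift ord0 j) s z))).
      apply: measurableT_comp => //.
      exact: (measurableT_comp (measurable_insert (lift ord0 j)) (pair1_measurable s)).
    exact: measurable_consT.
  rewrite (fubini_tonelli1 _ mhs (fun p => h0 _)).
  by apply: eq_integral => y _; apply: eq_integral => x _; rewrite /= insertS.
pose k (q : (mR * mR) * n.-tuple mR) := h (consT (q.1.2, insert j q.1.1 q.2)).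
have mk : measurable_fun setT k.
  apply: measurableT_comp => //; apply: measurable_cons.
    exact: (measurableT_comp measurable_snd measurable_fst).
  apply: (measurableT_comp (measurable_insert j) (g := fun q => (q.1.1, q.2))).
  apply/measurable_fun_pairP; split; last exact: measurable_snd.
  exact: (measurableT_comp measurable_fst measurable_fst).
pose K (p : mR * mR) := (\int[nleb n]_x k (p, x))%E.
have mK : measurable_fun setT K.
  exact: (measurable_fun_fubini_tonelli_F (m2 := nleb n) k mk (fun q => h0 _)).
have K0 p : (0 <= K p)%E by apply: integral_ge0 => x _; exact: h0.
have := fubini_tonelli (m1 := leb) (m2 := leb) K mK K0; rewrite /K /k/= => ->.
apply: eq_integral => y _; rewrite /fubini_F -(ih j)//.
rewrite fubini_tonelli1//.
apply: (measurableT_comp (f := fun z => h (consT (y, z)))) => //.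
exact: measurable_insert.
Qed.

(** For i < k the entry x_(k-1) would lie above s in the first tuple and below s in the second. *)
Lemma insert_simplex_inj n (i k : 'I_n.+1) s (x : n.-tuple mR) :
  simplex (insert i s x) -> simplex (insert k s x) -> i = k.
Proof.
wlog ik : i k / (i < k)%N.
  move=> H hi hk; have [ik|ki|/val_inj//] := ltngtP i k; first exact: H.
  by apply/esym/H.
move=> [_ hi] [_ hk].
have k1 : (k.-1 < n)%N by rewrite -ltnS (leq_trans _ (ltn_ord k))// ltnS prednK// (leq_ltn_trans _ ik).
pose j := Ordinal k1.
have kp : (0 < k)%N by exact: leq_ltn_trans ik.
have e1 : lift i j = k.
  by apply: val_inj; rewrite /= /bump -ltnS prednK// ik add1n prednK.
have e2 : (lift k j < k)%N.
  by rewrite /= /bump; case: leqP; lia.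
have := hi i (lift i j); rewrite e1 => /(_ ik); rewrite tnth_insert -{1}e1 tnth_insert_lift => h1.
by have := hk (lift k j) k e2; rewrite tnth_insert tnth_insert_lift ltNge (ltW h1).
Qed.

Lemma insert_simplex_sub n (i : 'I_n.+1) s (x : n.-tuple mR) :
  simplex (insert i s x) -> 0 < (s : R) /\ simplex x.
Proof.
move=> [h1 h2]; split; first by have := h1 i; rewrite tnth_insert.
split=> [j|j k jk]; first by have := h1 (lift i j); rewrite tnth_insert_lift.
have := h2 (lift i j) (lift i k); rewrite !tnth_insert_lift; apply.
by rewrite /= /bump; case: (leqP i j) => ij; case: (leqP i k) => ik;
  rewrite ?add1n ?add0n ?ltnS//; lia.
Qed.

Lemma bump_lt m j k : (bump m j < bump m k)%N -> (j < k)%N.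
Proof. by rewrite /bump; case: (leqP m j); case: (leqP m k); lia. Qed.

Lemma bump_ltl m j : (bump m j < m)%N -> (j < m)%N.
Proof. by rewrite /bump; case: (leqP m j); lia. Qed.

Lemma bump_ltr m j : (m < bump m j)%N -> (m <= j)%N.
Proof. by rewrite /bump; case: (leqP m j); lia. Qed.

Lemma insert_simplex_ex n s (x : n.-tuple mR) :
  0 < (s : R) -> simplex x -> (forall j, s <> tnth x j) ->
  exists i : 'I_n.+1, simplex (insert i s x).
Proof.
move=> s0 [x0 xx] sx.
(* The position of s is that of the first entry exceeding it, or the end if there is none. *)
pose m := find (fun y : R => s < y) (x : seq R).
have mn : (m < n.+1)%N by rewrite ltnS -[n in (_ <= n)%N](size_tuple x) find_size.
have lo (j : 'I_n) : (j < m)%N -> (tnth x j : R) < s.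
  move=> jm; have := before_find 0 jm; rewrite -tnth_nth => /negbT; rewrite -leNgt.
  by rewrite le_eqVlt => /orP[/eqP e|//]; have := sx j; rewrite e.
have hi (j : 'I_n) : (m <= j)%N -> (s : R) < tnth x j.
  move=> mj; have hs : has (fun y : R => s < y) (x : seq R).
    by rewrite has_find size_tuple (leq_ltn_trans mj).
  have mn' : (m < n)%N by exact: leq_ltn_trans mj (ltn_ord j).
  have := nth_find 0 hs; rewrite -/m -[m]/(val (Ordinal mn')) -tnth_nth => h.
  have := mj; rewrite leq_eqVlt => /orP[/eqP e|lt].
    by rewrite (_ : j = Ordinal mn')//; apply: val_inj.
  by apply: (lt_trans h); apply: xx.
exists (Ordinal mn); split=> [k|a b].
  by case: (unliftP (Ordinal mn) k) => [j ->|->]; rewrite ?tnth_insert_lift ?tnth_insert.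
case: (unliftP (Ordinal mn) a) => [j ->|->]; case: (unliftP (Ordinal mn) b) => [k ->|->];
  rewrite ?tnth_insert_lift ?tnth_insert ?ltnn//= => ab.
- by apply: xx; exact: bump_lt ab.
- by apply: lo; exact: bump_ltl ab.
- by apply: hi; exact: bump_ltr ab.
Qed.

(** Up to a null set, a pair of a time s > 0 and a point x of the simplex is a set of n + 1 times
    with one of them marked: exactly one insertion lands in the simplex. Each of the n + 1 positions
    contributes the same integral. *)
Lemma simplex_insert_integral n (g : mR * n.-tuple mR -> \bar R)
    (h : n.+1.-tuple mR -> \bar R) :
  measurable_fun setT g -> (forall p, 0 <= g p)%E ->
  measurable_fun setT h -> (forall x, 0 <= h x)%E ->
  (forall p, ~ (0 < (p.1 : R) /\ simplex p.2) -> g p = 0%E) ->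
  (forall i s x, simplex (insert i s x) -> g (s, x) = h (insert i s x)) ->
  (\int[(leb \x nleb n)%E]_p g p = (n.+1)%:R%:E * \int[nleb n.+1]_(x in @simplex R n.+1) h x)%E.
Proof.
move=> mg g0 mh h0 gout gh.
pose h' x : \bar R := (h x * (\1_(@simplex R n.+1) x)%:E)%E.
have h'in x : simplex x -> h' x = h x by move=> xs; rewrite /h' indicE mem_set// mule1.
have h'out x : ~ simplex x -> h' x = 0%E by move=> xs; rewrite /h' indicE memNset// mule0.
have mh' : measurable_fun setT h'.
  apply: emeasurable_funM => //; apply/measurable_EFinP/measurable_indic.
  exact: measurable_simplex.
have h'0 x : (0 <= h' x)%E by rewrite /h' mule_ge0// lee_fin indicE.
have mhi (i : 'I_n.+1) : measurable_fun setT (fun p : mR * _ => h' (insert i p.1 p.2)).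
  exact: measurableT_comp (measurable_insert i).
have -> : (\int[nleb n.+1]_(x in @simplex R n.+1) h x = \int[nleb n.+1]_x h' x)%E.
  rewrite integral_mkcond; apply: eq_integral => x _; rewrite patchE /h' indicE.
  by case: (_ \in _); rewrite ?mule1 ?mule0.
transitivity (\int[(leb \x nleb n)%E]_p \sum_(i < n.+1) h' (insert i p.1 p.2))%E.
  have ms : measurable_fun setT (fun p : mR * n.-tuple mR => \sum_(i < n.+1) h' (insert i p.1 p.2))%E.
    by apply: emeasurable_sum => i _; exact: mhi.
  have s0 p : (0 <= \sum_(i < n.+1) h' (insert i p.1 p.2))%E by exact: sume_ge0.
  rewrite (fubini_tonelli2 _ mg g0) (fubini_tonelli2 _ ms s0).
  apply: eq_integral => x _; rewrite /fubini_G.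
  apply: ge0_ae_eq_integral => //.
  - exact: (measurableT_comp mg (pair2_measurable x)).
  - exact: (measurableT_comp ms (pair2_measurable x)).
  (* For fixed x the exceptional times are the finitely many entries of x, where no insertion is
     strictly increasing. *)
  have cx : countable (range (tnth x)) by apply: finite_set_countable; exact: finite_image.
  exists (range (tnth x)); split.
  - exact: countable_measurable.
  - exact: countable_lebesgue_measure0.
  - move=> s /=; apply: contra_notP => sx _.
    have [[i hi]|no] := pselect (exists i, simplex (insert i s x)).
      rewrite (bigD1 i)//= big1 ?adde0.
        by rewrite h'in// (gh i).
      move=> k ki; apply: h'out => hk.
      by move/eqP : ki; apply; exact: (insert_simplex_inj hk hi).
    rewrite big1.
      apply: gout => -[/= spos xs]; apply: no; apply: insert_simplex_ex => //.
      by move=> j e; apply: sx; exists j => //; rewrite e.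
    by move=> i _; apply: h'out => hi; apply: no; exists i.
rewrite (ge0_integral_sum _ measurableT mhi (fun i p _ => h'0 _)).
rewrite (eq_bigr (fun=> \int[nleb n.+1]_x h' x)%E); last first.
  by move=> i _; rewrite nlebesgue_insert.
by rewrite sumr_const card_ord mule_natl.
Qed.

End simplex_measure.

Lemma measurable_fun_indicM d (T : measurableType d) (R : realType) (D : set T) (f : T -> R) :
  measurable D -> measurable_fun D f -> measurable_fun setT (fun x => f x * \1_D x).
Proof.
move=> mD /(measurable_restrictT f mD).1; apply: eq_measurable_fun => x _.
by rewrite patchE indicE; case: (_ \in _); rewrite ?mulr1 ?mulr0.
Qed.

(** * Symmetric functions, boxes and the factor n! *)

Section symmetric_functions.
Variable R : realType.
Local Notation mR := (measurableTypeR R).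
Local Notation leb := (@lebesgue_measure R).
Local Notation nleb := (nlebesgue R).

Definition symmetric_fun n (f : n.-tuple mR -> R) :=
  forall (s : 'S_n) (x : n.-tuple mR), f [tuple tnth x (s i) | i < n] = f x.

Lemma symmetric_perm_eq n (f : n.-tuple mR -> R) (x y : n.-tuple mR) :
  symmetric_fun f -> perm_eq (x : seq R) (y : seq R) -> f x = f y.
Proof.
move=> sf xy; have /tuple_permP[s e] : perm_eq (x : seq R) (y : seq R) by [].
rewrite -(sf s y); congr f; exact: val_inj.
Qed.

Lemma insert_perm_eq n (i : 'I_n.+1) (s : mR) (x : n.-tuple mR) :
  perm_eq (insert i s x : seq R) (consT (s, x) : seq R).
Proof.
elim: n i x => [|n ih] i x; first by rewrite (ord1 i) insert0.
case: (unliftP ord0 i) => [j ->|->]; last by rewrite insert0.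
case/tupleP: x => y x; rewrite -[[tuple of y :: x]]/(consT (y, x)) insertS.
rewrite /= ; apply: (@perm_trans _ [:: y, s & x]).
  by rewrite perm_cons; exact: ih.
by apply/seq.permP => a /=; rewrite addnCA.
Qed.

Lemma symmetric_insert n (f : n.+1.-tuple mR -> R) (i : 'I_n.+1) s (x : n.-tuple mR) :
  symmetric_fun f -> f (insert i s x) = f (consT (s, x)).
Proof. by move=> sf; apply: symmetric_perm_eq => //; exact: insert_perm_eq. Qed.

Lemma symmetric_cons n (f : n.+1.-tuple mR -> R) (s : mR) :
  symmetric_fun f -> symmetric_fun (fun x : n.-tuple mR => f (consT (s, x))).
Proof.
move=> sf p x; apply: symmetric_perm_eq => //=; rewrite perm_cons.
by apply/tuple_permP; exists p.
Qed.

Lemma orthant_cons n (s : mR) (x : n.-tuple mR) :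
  orthant (consT (s, x)) <-> 0 <= (s : R) /\ orthant x.
Proof.
split=> [h|[s0 h] i].
  split; first by have := h ord0; rewrite tnth_consT0.
  by move=> i; have := h (lift ord0 i); rewrite tnth_consT_lift.
by case: (unliftP ord0 i) => [j ->|->]; rewrite ?tnth_consT_lift ?tnth_consT0.
Qed.

Lemma simplex_orthant n : @simplex R n `<=` @orthant R n.
Proof. by move=> x [h _] i; exact/ltW/h. Qed.

(** Induction on n: with the first variable s > 0 fixed, ordering the other n variables costs n!,
    and then s is a marked one among n + 1 ordered times, which costs n + 1. *)
Lemma sqnorm_orthant n (f : n.-tuple mR -> R) :
  measurable_fun (@orthant R n) f -> symmetric_fun f ->
  sqnorm (nleb n) (@orthant R n) f = (n`!%:R%:E * sqnorm (nleb n) (@simplex R n) f)%E.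
Proof.
elim: n f => [|n ih] f mf sf.
  rewrite fact0 mul1e; congr sqnorm; apply/seteqP; split=> x _; last by move=> [].
  by split=> [[]|[]].
(* [f] is measurable on the orthant only, so it is extended by 0. *)
pose H x : \bar R := ((f x * \1_(@orthant R n.+1) x) ^+ 2)%:E.
have mH : measurable_fun setT H.
  apply/measurable_EFinP/measurable_funX/measurable_fun_indicM => //.
  exact: measurable_orthant.
have H0 x : (0 <= H x)%E by rewrite lee_fin sqr_ge0.
have HE x : orthant x -> H x = (f x ^+ 2)%:E.
  by move=> xo; rewrite /H indicE mem_set// mulr1.
pose I (s : mR) : R := \1_(`]0, +oo[%classic : set R) s.
have mI : measurable_fun setT I by exact: measurable_indic.
pose J (x : n.-tuple mR) : R := \1_(@simplex R n) x.
have mJ : measurable_fun setT J by apply: measurable_indic; exact: measurable_simplex.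
have IE (s : mR) : I s = (0 < (s : R))%R%:R by rewrite /I indicE mem_setE in_itv/= andbT.
pose g (p : mR * n.-tuple mR) : \bar R := ((I p.1)%:E * (J p.2)%:E * H (consT p))%E.
have mHc : measurable_fun setT (fun p : mR * n.-tuple mR => H (consT p)).
  exact: (measurableT_comp mH (@measurable_consT R n)).
have mg : measurable_fun setT g.
  apply: emeasurable_funM => //; apply: emeasurable_funM; apply/measurable_EFinP.
    exact: (measurableT_comp mI measurable_fst).
  exact: (measurableT_comp mJ measurable_snd).
have g0 p : (0 <= g p)%E.
  by rewrite /g mule_ge0// mule_ge0// lee_fin /I /J indicE.
have main : (\int[(leb \x nleb n)%E]_p g p =
    (n.+1)%:R%:E * \int[nleb n.+1]_(x in @simplex R n.+1) H x)%E.
  apply: simplex_insert_integral => //.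
    move=> p h; rewrite /g IE /J indicE; case: (boolP (p.2 \in _)) => [|_].
      rewrite inE => ps; rewrite (_ : (0 < p.1) = false) ?mul0e//.
      by apply/negP => p0; apply: h.
    by rewrite mule0 mul0e.
  move=> i s x hs; have [s0 xs] := insert_simplex_sub hs.
  rewrite /g IE s0 /J indicE mem_set//= !mul1e !HE.
  - by rewrite symmetric_insert.
  - exact: simplex_orthant.
  - by apply/orthant_cons; split; [exact: ltW|exact: simplex_orthant].
have -> : sqnorm (nleb n.+1) (@orthant R n.+1) f = (\int[nleb n.+1]_x H x)%E.
  rewrite /sqnorm integral_mkcond; apply: eq_integral => x _.
  rewrite patchE /H indicE; case: (_ \in _); rewrite ?mulr1// mulr0 expr0n//=.
have -> : sqnorm (nleb n.+1) (@simplex R n.+1) f =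
    (\int[nleb n.+1]_(x in @simplex R n.+1) H x)%E.
  apply: eq_integral => x; rewrite inE => xs.
  by rewrite HE//; exact: simplex_orthant.
rewrite nlebesgue_integralS// (fubini_tonelli1 _ mHc (fun p => H0 _)).
rewrite factS mulnC natrM EFinM -muleA -main (fubini_tonelli1 _ mg g0).
rewrite -ge0_integralZl//; last 2 first.
- exact: (measurable_fun_fubini_tonelli_F (m2 := nleb n) g mg g0).
- by move=> s _; apply: integral_ge0 => x _.
apply: ge0_ae_eq_integral => //.
- exact: (measurable_fun_fubini_tonelli_F (m2 := nleb n) _ mHc (fun p => H0 _)).
- apply: measurable_funeM.
  exact: (measurable_fun_fubini_tonelli_F (m2 := nleb n) g mg g0).
- by move=> s _; apply: integral_ge0 => x _.
- by move=> s _; apply: mule_ge0; [rewrite lee_fin|apply: integral_ge0].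
(* The time 0 is excepted: the orthant admits it, the simplex does not. *)
exists [set 0]; split; first exact: measurable_set1.
  exact: lebesgue_measure_set1.
move=> s /=; apply: contra_notP => s0 _; rewrite /fubini_F.
have [spos|sneg] := ltP 0 (s : R); last first.
  have sn : (s : R) < 0 by rewrite lt_neqAle sneg andbT; apply/eqP.
  rewrite [RHS](_ : _ = 0%E); last first.
    rewrite integral0_eq ?mule0// => x _.
    by rewrite /g IE/= (ltNge 0 s) sneg mul0e mul0e.
  rewrite integral0_eq// => x _; rewrite /H indicE memNset ?mulr0 ?expr0n//=.
  by move=> /orthant_cons[]; rewrite leNgt sn.
transitivity (sqnorm (nleb n) (@orthant R n) (fun x => f (consT (s, x)))).
  rewrite /sqnorm [RHS]integral_mkcond; apply: eq_integral => x _.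
  rewrite patchE; case: ifPn => [|].
    by rewrite inE => xo; rewrite HE//; apply/orthant_cons; split => //; exact: ltW.
  rewrite notin_setE => xo; rewrite /H indicE memNset ?mulr0 ?expr0n//=.
  by move=> /orthant_cons[].
rewrite ih; last 2 first.
- have mc : measurable_fun setT (fun x : n.-tuple mR => consT (s, x)).
    exact: (measurableT_comp (@measurable_consT R n) (pair1_measurable s)).
  apply: (measurable_comp (F := @orthant R n.+1)) => //.
  - exact: measurable_orthant.
  - by move=> _ [x xo <-]; apply/orthant_cons; split => //; exact: ltW.
  - exact: measurable_funTS.
- exact: symmetric_cons.
congr (_ * _)%E; rewrite /sqnorm [LHS]integral_mkcond; apply: eq_integral => x _.
rewrite patchE /g IE spos mul1e /J indicE; case: ifPn => [|_]; last by rewrite mul0e.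
rewrite inE => xs; rewrite mul1e HE//.
by apply/orthant_cons; split; [exact: ltW|exact: simplex_orthant].
Qed.

Definition box n (b : n.-tuple (R * R)) (x : n.-tuple mR) : R :=
  \prod_(i < n) \1_(`](tnth b i).1, (tnth b i).2]%classic) (tnth x i).

Lemma box_simplex n (b : n.-tuple (R * R)) x :
  rectangle_in_simplex b -> box b x != 0 -> simplex x.
Proof.
move=> [h1 h2]; rewrite /box prodf_seq_neq0 => /allP h.
have {}h i : (tnth b i).1 < (tnth x i : R) <= (tnth b i).2.
  have := h i (mem_index_enum _); rewrite /= indicE.
  by case: (boolP (_ \in _)); rewrite ?eqxx// inE/= in_itv.
split=> [i|i j ij].
  have /andP[+ _] := h i; have /andP[+ _] := h1 i; exact: le_lt_trans.
have /andP[_ xi] := h i; have /andP[xj _] := h j.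
exact: (le_lt_trans xi (le_lt_trans (h2 i j ij) xj)).
Qed.

Lemma measurable_box n (b : n.-tuple (R * R)) : measurable_fun setT (box b).
Proof.
apply: measurable_prod => i _; apply: measurableT_comp; first exact: measurable_indic.
exact: measurable_tnth.
Qed.

Lemma lebesgue_overlap (I J : R * R) :
  leb (`]I.1, I.2]%classic `&` `]J.1, J.2]%classic) = (overlap I J)%:E.
Proof.
rewrite (_ : _ `&` _ = `]Num.max I.1 J.1, Num.min I.2 J.2]%classic).
  rewrite lebesgue_measure_itv/= lte_fin /overlap; case: ltP => h.
    by rewrite -EFinB [Num.max 0 _]max_r ?subr_ge0 ?(ltW h).
  by rewrite max_l ?subr_le0.
apply/seteqP; split=> x /=; rewrite !in_itv/= gt_max le_min.
  by move=> [/andP[-> ->] /andP[-> ->]].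
by move=> /andP[/andP[-> ->] /andP[-> ->]].
Qed.

Lemma box_integral n (b b' : n.-tuple (R * R)) : rectangle_in_simplex b ->
  (\int[nleb n]_(x in @simplex R n) (box b x * box b' x)%:E =
   (\prod_(i < n) overlap (tnth b i) (tnth b' i))%:E)%E.
Proof.
move=> rb.
transitivity (\int[nleb n]_x (\prod_(i < n)
   \1_(`](tnth b i).1, (tnth b i).2]%classic `&` `](tnth b' i).1, (tnth b' i).2]%classic) (tnth x i))%:E)%E.
  rewrite integral_mkcond; apply: eq_integral => x _; rewrite patchE.
  have -> : \prod_(i < n) \1_(`](tnth b i).1, (tnth b i).2]%classic `&`
      `](tnth b' i).1, (tnth b' i).2]%classic) (tnth x i) = box b x * box b' x :> R.
    rewrite /box -big_split/=; apply: eq_bigr => i _.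
    by rewrite !indicE in_setI; case: (_ \in _); rewrite ?mul1r ?mul0r.
  case: ifPn => //; rewrite notin_setE => xs.
  have [->|b0] := eqVneq (box b x) 0; first by rewrite mul0r.
  by exfalso; apply: xs; exact: box_simplex b0.
rewrite nlebesgue_box; last by move=> i; apply: measurableI; exact: measurable_itv.
by rewrite -prodEFin; apply: eq_bigr => i _; rewrite lebesgue_overlap.
Qed.

Lemma L2_box n (b : n.-tuple (R * R)) : rectangle_in_simplex b ->
  L2 (nleb n) (@simplex R n) (box b).
Proof.
move=> rb; split; first by apply: measurable_funTS; exact: measurable_box.
by rewrite /sqnorm; under eq_integral do rewrite expr2; rewrite box_integral// ltry.
Qed.

Lemma ip_box n (b b' : n.-tuple (R * R)) : rectangle_in_simplex b ->
  ip (nleb n) (@simplex R n) (box b) (box b') =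
  \prod_(i < n) overlap (nth (0, 0) b i) (nth (0, 0) b' i).
Proof.
move=> rb; rewrite /ip /Rintegral box_integral//=.
by apply: eq_bigr => i _; rewrite !(tnth_nth (0, 0)).
Qed.

Lemma step_funE n (c : seq (R * n.-tuple (R * R))) (x : n.-tuple mR) :
  step_fun c x = \sum_(p <- c) p.1 * box p.2 x.
Proof. by []. Qed.

Lemma simplex1 (x : 1.-tuple mR) : simplex x <-> 0 < (thead x : R).
Proof.
split=> [[h _]|h]; first by have := h ord0.
split=> [i|i j]; first by rewrite (ord1 i).
by rewrite (ord1 i) (ord1 j).
Qed.

Lemma integral_simplex1 (h : mR -> \bar R) :
  measurable_fun (`]0, +oo[%classic : set R) h -> (forall s, 0 <= h s)%E ->
  (\int[nleb 1]_(x in @simplex R 1) h (thead x) = \int[leb]_(s in (`]0%R, +oo[%classic : set R)) h s)%E.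
Proof.
move=> mh h0.
pose h' s : \bar R := (h \_ (`]0%R, +oo[%classic : set R)) s.
have mh' : measurable_fun setT h' by apply: (measurable_restrictT h _).1 mh; exact: measurable_itv.
have h'0 s : (0 <= h' s)%E by rewrite /h' patchE; case: ifP.
have mt : measurable_fun setT (fun x : 1.-tuple mR => h' (thead x)).
  by apply: measurableT_comp => //; exact: measurable_tnth.
transitivity (\int[nleb 1]_x h' (thead x))%E.
  rewrite integral_mkcond; apply: eq_integral => x _; rewrite /h' !patchE.
  congr (if _ then _ else _); apply/idP/idP; rewrite !inE/= in_itv/= andbT => /simplex1//.
rewrite nlebesgue_integralS// fubini_tonelli1//; last first.
  exact: (measurableT_comp mt (@measurable_consT R 0)).
rewrite [RHS]integral_mkcond; apply: eq_integral => s _.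
rewrite /fubini_F/= (eq_integral (fun=> h' s)); last by move=> x _; rewrite theadE.
by rewrite integral_cst// [X in (_ * X)%E]diracT mule1.
Qed.

End symmetric_functions.

Lemma sqnorm_triangle d (T : measurableType d) (R : realType)
    (mu : {measure set T -> \bar R}) (D : set T) (f g h : T -> R) :
  measurable D -> L2 mu D f -> L2 mu D g -> L2 mu D h ->
  (sqnorm mu D (fun x => f x - h x)%R <=
   2%:E * sqnorm mu D (fun x => f x - g x)%R + 2%:E * sqnorm mu D (fun x => g x - h x)%R)%E.
Proof.
move=> mD Lf Lg Lh.
rewrite (_ : (fun x => f x - h x) = (fun x => (f x - g x) + (g x - h x))); last first.
  by apply/funext => x; rewrite addrA subrK.
by have := sqnorm_add_le mu mD (L2_measurable (L2B mD Lf Lg)) (L2_measurable (L2B mD Lg Lh)).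
Qed.

(** * Isometric integrals *)

Section chaos_systems.
Context d (T : measurableType d) (R : realType).
Variables (mu : {measure set T -> \bar R}) (D : set T).
Hypothesis mD : measurable D.
Local Notation mR := (measurableTypeR R).
Local Notation nleb := (nlebesgue R).
Local Notation simp n := (@simplex R n).
Local Notation L2n n := (L2 (nleb n) (@simplex R n)).
Local Notation ipn n := (ip (nleb n) (@simplex R n)).
Local Notation sqn n := (sqnorm (nleb n) (@simplex R n)).
Local Notation steps n := (seq (R * n.-tuple (R * R))).
Implicit Types (Phi Psi : forall n, n.-tuple (R * R) -> T -> R) (kappa : nat -> R).

Let mS n : measurable (@simplex R n).
Proof. exact: measurable_simplex. Qed.

Lemma L2cvg_eq d' (T' : measurableType d') (nu : {measure set T' -> \bar R}) E
    (u v : nat -> T' -> R) X :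
  (forall k x, u k x = v k x) -> L2cvg nu E u X -> L2cvg nu E v X.
Proof. by move=> uv; have -> : u = v by apply/funext => k; exact/funext. Qed.

Lemma sqnorm_subrr d' (T' : measurableType d') (nu : {measure set T' -> \bar R}) E
    (f : T' -> R) : sqnorm nu E (fun x => f x - f x) = 0%E.
Proof.
rewrite /sqnorm; under eq_integral do rewrite subrr expr0n/=.
exact: integral0.
Qed.

Definition rectangles n (c : steps n) :=
  forall p, p \in c -> rectangle_in_simplex p.2.

Definition simple_integral Phi n (c : steps n) (w : T) : R :=
  \sum_(p <- c) p.1 * Phi n p.2 w.

(** The pattern of [iterated_integral] with arbitrary elementary products [Phi] and an arbitrary
    domain [D], so that it covers DF, G and the remainder as well; for [increment_product] on the
    whole space it is convertible with the original. *)
Definition kernel_integral Phi n (f : n.-tuple mR -> R) X :=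
  [/\ L2n n f, L2 mu D X &
      exists c : nat -> steps n,
        [/\ forall k, rectangles (c k),
            L2cvg (nleb n) (simp n) (fun k => step_fun (c k)) f &
            L2cvg mu D (fun k => simple_integral Phi (c k)) X]].

Definition kernels_integral Phi (f : forall n, n.-tuple mR -> R) X :=
  L2 mu D X /\
  exists J : nat -> T -> R,
    (forall n, kernel_integral Phi (@f n) (J n)) /\
    L2cvg mu D (fun N w => \sum_(0 <= n < N) J n w) X.

(* kappa is 1 for B, M and Y^theta, n for DF and G, and [remainder_weight] for
   the remainder Y^theta - Y^0 - theta G. *)
Definition orthogonal_system Phi kappa :=
  [/\ forall n b, rectangle_in_simplex b -> L2 mu D (Phi n b),
      forall n, 0 <= kappa n &
      forall n m b b', rectangle_in_simplex b -> rectangle_in_simplex b' ->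
        ip mu D (Phi n b) (Phi m b') = (n == m)%:R * kappa n *
          \prod_(i < n) overlap (nth (0, 0) b i) (nth (0, 0) b' i)].

Definition combine_steps n a (c c' : steps n) : steps n :=
  [seq (a * p.1, p.2) | p <- c] ++ c'.

Lemma combine_rectangles n a (c c' : steps n) :
  rectangles c -> rectangles c' -> rectangles (combine_steps a c c').
Proof.
move=> rc rc' p; rewrite mem_cat => /orP[/mapP[q qc ->]|]; last exact: rc'.
exact: (rc q qc).
Qed.

Lemma simple_integral_combine Phi n a (c c' : steps n) w :
  simple_integral Phi (combine_steps a c c') w =
  a * simple_integral Phi c w + simple_integral Phi c' w.
Proof.
rewrite /simple_integral big_cat big_map/=; congr (_ + _).
by rewrite mulr_sumr; apply: eq_bigr => p _; rewrite mulrA.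
Qed.

Lemma step_fun_combine n a (c c' : steps n) (x : n.-tuple mR) :
  step_fun (combine_steps a c c') x = a * step_fun c x + step_fun c' x.
Proof.
rewrite !step_funE big_cat big_map/=; congr (_ + _).
by rewrite mulr_sumr; apply: eq_bigr => p _; rewrite mulrA.
Qed.

Lemma L2_step n (c : steps n) : rectangles c -> L2n n (step_fun c).
Proof.
move=> rc; apply: (L2_sum (@mS n) (F := fun p x => p.1 * box p.2 x)).
by move=> p pc; apply: (L2Z (@mS n)); exact/L2_box/rc.
Qed.

Lemma L2_simple_integral Phi n (c : steps n) :
  (forall b, rectangle_in_simplex b -> L2 mu D (Phi n b)) -> rectangles c ->
  L2 mu D (simple_integral Phi c).
Proof.
move=> LPhi rc; apply: (L2_sum mD (F := fun p x => p.1 * Phi n p.2 x)) => p pc.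
by apply: L2Z => //; exact/LPhi/rc.
Qed.

Section one_system.
Variables (Phi : forall n, n.-tuple (R * R) -> T -> R) (kappa : nat -> R).
Hypothesis hPhi : orthogonal_system Phi kappa.

Let LPhi n b : rectangle_in_simplex b -> L2 mu D (@Phi n b).
Proof. by have [+ _ _] := hPhi; apply. Qed.

Let kappa_ge0 n : 0 <= kappa n.
Proof. by have [_ + _] := hPhi; apply. Qed.

Lemma L2_simple n (c : steps n) : rectangles c -> L2 mu D (simple_integral Phi c).
Proof. by apply: L2_simple_integral => b; exact: LPhi. Qed.

Lemma simple_ip_nm n m (c : steps n) (c' : steps m) : rectangles c -> rectangles c' ->
  ip mu D (simple_integral Phi c) (simple_integral Phi c') =
  \sum_(p <- c) \sum_(q <- c') p.1 * q.1 * ((n == m)%:R * kappa n *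
    \prod_(i < n) overlap (nth (0, 0) p.2 i) (nth (0, 0) q.2 i)).
Proof.
move=> rc rc'; rewrite /simple_integral ip_suml//; last 2 first.
- by move=> p pc; apply: L2Z => //; exact/LPhi/rc.
- exact: L2_simple.
rewrite big_seq [RHS]big_seq; apply: eq_bigr => p pc.
rewrite ip_sumr//; last 2 first.
- by move=> q qc; apply: L2Z => //; exact/LPhi/rc'.
- by apply: L2Z => //; exact/LPhi/rc.
rewrite big_seq [RHS]big_seq; apply: eq_bigr => q qc.
have Lp := LPhi (rc _ pc); have Lq := LPhi (rc' _ qc).
rewrite ipZl// ?ipZr//; last exact: L2Z.
have [_ _ ->] := hPhi; [by rewrite mulrA|exact: rc|exact: rc'].
Qed.

Lemma simple_ip0 n m (c : steps n) (c' : steps m) : rectangles c -> rectangles c' ->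
  n != m -> ip mu D (simple_integral Phi c) (simple_integral Phi c') = 0.
Proof.
move=> rc rc' /negbTE nm; rewrite simple_ip_nm// big1// => p _; rewrite big1// => q _.
by rewrite nm !mul0r mulr0.
Qed.

(** Both inner products expand into the same products of overlaps, by the orthogonality of the
    system on one side and by [ip_box] on the other. *)
Lemma simple_ip n (c c' : steps n) : rectangles c -> rectangles c' ->
  ip mu D (simple_integral Phi c) (simple_integral Phi c') =
  kappa n * ipn n (step_fun c) (step_fun c').
Proof.
move=> rc rc'; rewrite simple_ip_nm//.
have -> : ipn n (step_fun c) (step_fun c') =
    \sum_(p <- c) \sum_(q <- c') p.1 * q.1 *
      \prod_(i < n) overlap (nth (0, 0) p.2 i) (nth (0, 0) q.2 i).
  rewrite (ip_suml (@mS n) (F := fun p x => p.1 * box p.2 x)); last 2 first.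
  - by move=> p pc; apply: (L2Z (@mS n)); exact/L2_box/rc.
  - exact: L2_step.
  rewrite big_seq [RHS]big_seq; apply: eq_bigr => p pc.
  rewrite (ip_sumr (@mS n) (F := fun p x => p.1 * box p.2 x)); last 2 first.
  - by move=> q qc; apply: (L2Z (@mS n)); exact/L2_box/rc'.
  - by apply: (L2Z (@mS n)); exact/L2_box/rc.
  rewrite big_seq [RHS]big_seq; apply: eq_bigr => q qc.
  have Lp := L2_box (rc _ pc); have Lq := L2_box (rc' _ qc).
  rewrite (ipZl (@mS n) _ Lp (L2Z (@mS n) _ Lq)) (ipZr (@mS n) _ Lq Lp).
  by rewrite ip_box ?mulrA//; exact: rc.
rewrite mulr_sumr; apply: eq_bigr => p _; rewrite mulr_sumr; apply: eq_bigr => q _.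
by rewrite eqxx mul1r mulrCA.
Qed.

Lemma kernel_integral_L2 n (f : n.-tuple mR -> R) X :
  kernel_integral Phi f X -> L2n n f /\ L2 mu D X.
Proof. by case. Qed.

Lemma kernel_integral_simple n (c : steps n) : rectangles c ->
  kernel_integral Phi (step_fun c) (simple_integral Phi c).
Proof.
move=> rc; split; [exact: L2_step|exact: L2_simple|exists (fun=> c); split => //].
- by rewrite /L2cvg sqnorm_subrr; exact: cvg_cst.
- by rewrite /L2cvg sqnorm_subrr; exact: cvg_cst.
Qed.

Lemma kernel_integral0 n :
  kernel_integral Phi (fun _ : n.-tuple mR => 0) (fun=> 0).
Proof.
have := @kernel_integral_simple n [::].
rewrite (_ : step_fun _ = fun=> 0); last first.
  by apply/funext => x; rewrite step_funE big_nil.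
rewrite (_ : simple_integral _ _ = fun=> 0); first by apply.
by apply/funext => x; rewrite /simple_integral big_nil.
Qed.

Lemma kernel_integral_combine n a (f g : n.-tuple mR -> R) X Y :
  kernel_integral Phi f X -> kernel_integral Phi g Y ->
  kernel_integral Phi (fun x => a * f x + g x) (fun w => a * X w + Y w).
Proof.
move=> [Lf LX [c [rc cf cX]]] [Lg LY [c' [rc' cg cY]]].
split; [exact: (L2D (@mS n) (L2Z (@mS n) a Lf))|exact: (L2D mD (L2Z mD a LX))|].
exists (fun k => combine_steps a (c k) (c' k)); split.
- by move=> k; exact: combine_rectangles.
- apply: L2cvg_eq (L2cvgZD (@mS n) a _ _ Lf Lg cf cg) => [k x|k|k].
  + by rewrite step_fun_combine.
  + exact: L2_step.
  + exact: L2_step.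
- apply: L2cvg_eq (L2cvgZD mD a _ _ LX LY cX cY) => [k x|k|k].
  + by rewrite simple_integral_combine.
  + exact: L2_simple.
  + exact: L2_simple.
Qed.

Lemma kernel_integralB n (f g : n.-tuple mR -> R) X Y :
  kernel_integral Phi f X -> kernel_integral Phi g Y ->
  kernel_integral Phi (fun x => f x - g x) (fun w => X w - Y w).
Proof.
move=> fX gY; have := kernel_integral_combine (-1) gY fX.
by under [X in kernel_integral _ X]funext do rewrite mulN1r addrC;
   under [X in kernel_integral _ _ X]funext do rewrite mulN1r addrC.
Qed.

Lemma kernel_integral_ip n (f g : n.-tuple mR -> R) X Y :
  kernel_integral Phi f X -> kernel_integral Phi g Y ->
  ip mu D X Y = kappa n * ipn n f g.
Proof.
move=> [Lf LX [c [rc cf cX]]] [Lg LY [c' [rc' cg cY]]].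
have h1 := L2cvg_ip mD (fun k => L2_simple (rc k)) (fun k => L2_simple (rc' k))
  LX LY cX cY.
have h2 := L2cvg_ip (@mS n) (fun k => L2_step (rc k)) (fun k => L2_step (rc' k))
  Lf Lg cf cg.
apply: (cvg_unique _ h1) => //.
under [X in X @ _]funext do rewrite simple_ip//.
exact: (cvgM (cvg_cst _) h2).
Qed.

Lemma kernel_integral_ip0 n m (f : n.-tuple mR -> R) (g : m.-tuple mR -> R) X Y :
  n != m -> kernel_integral Phi f X -> kernel_integral Phi g Y -> ip mu D X Y = 0.
Proof.
move=> nm [Lf LX [c [rc cf cX]]] [Lg LY [c' [rc' cg cY]]].
have h1 := L2cvg_ip mD (fun k => L2_simple (rc k)) (fun k => L2_simple (rc' k))
  LX LY cX cY.
apply: (cvg_unique _ h1) => //.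
under [X in X @ _]funext do rewrite simple_ip0//.
exact: cvg_cst.
Qed.

Lemma kernel_integral_sqnorm n (f : n.-tuple mR -> R) X :
  kernel_integral Phi f X -> sqnorm mu D X = ((kappa n)%:E * sqn n f)%E.
Proof.
move=> fX; have [Lf LX] := kernel_integral_L2 fX.
by rewrite (sqnormE mD LX) (sqnormE (@mS n) Lf) (kernel_integral_ip fX fX) EFinM.
Qed.

(** An integral comes with its own approximating steps; the isometry allows any other steps with the
    same limit. This makes it possible to add integrals of one kernel against two systems. *)
Lemma kernel_integral_along n (f : n.-tuple mR -> R) X (c : nat -> steps n) :
  kernel_integral Phi f X -> (forall k, rectangles (c k)) ->
  L2cvg (nleb n) (simp n) (fun k => step_fun (c k)) f ->
  L2cvg mu D (fun k => simple_integral Phi (c k)) X.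
Proof.
move=> fX rc cf; rewrite /L2cvg.
under [X in X @ _]funext => k do
  rewrite (kernel_integral_sqnorm (kernel_integralB (kernel_integral_simple (rc k)) fX)).
by rewrite -(mule0 (kappa n)%:E); apply: cvgeZl.
Qed.

Lemma kernel_integral_sum n (f : nat -> n.-tuple mR -> R) (X : nat -> T -> R) N :
  (forall k, kernel_integral Phi (f k) (X k)) ->
  kernel_integral Phi (fun x => \sum_(0 <= k < N) f k x) (fun w => \sum_(0 <= k < N) X k w).
Proof.
move=> fX; elim: N => [|N ih].
  have -> : (fun x => \sum_(0 <= k < 0) f k x) = fun=> 0.
    by apply/funext => x; rewrite big_geq.
  have -> : (fun w => \sum_(0 <= k < 0) X k w) = fun=> 0.
    by apply/funext => w; rewrite big_geq.
  exact: kernel_integral0.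
have := kernel_integral_combine 1 (fX N) ih.
have -> : (fun x => 1 * f N x + \sum_(0 <= k < N) f k x) = fun x => \sum_(0 <= k < N.+1) f k x.
  by apply/funext => x; rewrite big_nat_recr//= mul1r addrC.
have -> // : (fun w => 1 * X N w + \sum_(0 <= k < N) X k w) = fun w => \sum_(0 <= k < N.+1) X k w.
by apply/funext => w; rewrite big_nat_recr//= mul1r addrC.
Qed.

Lemma kernel_integral_ae n (f g : n.-tuple mR -> R) X Y :
  kernel_integral Phi f X -> L2n n g -> sqn n (fun x => f x - g x) = 0%E ->
  L2 mu D Y -> sqnorm mu D (fun w => X w - Y w) = 0%E -> kernel_integral Phi g Y.
Proof.
move=> [Lf LX [c [rc cf cX]]] Lg fg LY XY; split => //; exists c; split => //.
  by apply: (L2cvg_ae (@mS n) _ Lf Lg fg cf) => k; exact: (L2_step (rc k)).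
by apply: (L2cvg_ae mD _ LX LY XY cX) => k; exact: (L2_simple (rc k)).
Qed.

(** At a level of weight 0 every integral is almost everywhere 0. It serves for level 0 of DF and of
    G. *)
Lemma kernel_integral_degenerate n (f : n.-tuple mR -> R) X : kappa n = 0 ->
  kernel_integral Phi f X -> kernel_integral Phi f (fun=> 0).
Proof.
move=> k0 fX; have [Lf LX] := kernel_integral_L2 fX.
apply: (kernel_integral_ae fX Lf); first exact: sqnorm_subrr.
  exact: L2_0.
under [X in sqnorm _ _ X]funext do rewrite subr0.
by rewrite (kernel_integral_sqnorm fX) k0 mul0e.
Qed.

(** Steps are chosen diagonally: for each precision some N is close to the limit, and then one
    member of its approximating sequence is close to both the kernel [f N] and the integral
    [X N]. *)
Lemma kernel_integral_closed n (f : nat -> n.-tuple mR -> R) (X : nat -> T -> R) g Y :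
  (forall k, kernel_integral Phi (f k) (X k)) -> L2n n g -> L2 mu D Y ->
  L2cvg (nleb n) (simp n) f g -> L2cvg mu D X Y -> kernel_integral Phi g Y.
Proof.
move=> fX Lg LY fg XY.
have Lf k : L2n n (f k) by have [] := fX k.
have LX k : L2 mu D (X k) by have [] := fX k.
have dbl (a : R) : (2%:E * (a / 4)%:E + 2%:E * (a / 4)%:E = a%:E)%E.
  by rewrite -!EFinM -EFinD; congr EFin; field.
have step k : exists c : steps n, [/\ rectangles c,
    (sqn n (fun x => step_fun c x - g x)%R <= (half_pow R k)%:E)%E &
    (sqnorm mu D (fun w => simple_integral Phi c w - Y w)%R <= (half_pow R k)%:E)%E].
  (* A quarter, since [sqnorm_triangle] doubles each of its two terms. *)
  have e0 : 0 < half_pow R k / 4 by rewrite divr_gt0// half_pow_gt0.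
  have /cvge0_seqP-/(_ (fun i => sqnorm_ge0 _ _ _) _ e0)[N1 hN1] := fg.
  have /cvge0_seqP-/(_ (fun i => sqnorm_ge0 _ _ _) _ e0)[N2 hN2] := XY.
  pose N := maxn N1 N2; have {}hN1 := hN1 N (leq_maxl _ _); have {}hN2 := hN2 N (leq_maxr _ _).
  have [_ _ [c [rc cf cX]]] := fX N.
  have /cvge0_seqP-/(_ (fun i => sqnorm_ge0 _ _ _) _ e0)[K1 hK1] := cf.
  have /cvge0_seqP-/(_ (fun i => sqnorm_ge0 _ _ _) _ e0)[K2 hK2] := cX.
  pose K := maxn K1 K2; have {}hK1 := hK1 K (leq_maxl _ _); have {}hK2 := hK2 K (leq_maxr _ _).
  exists (c K); split; first exact: rc.
    apply: le_trans (sqnorm_triangle (@mS n) (L2_step (rc K)) (Lf N) Lg) _.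
    by rewrite -dbl leeD// lee_pmul2l.
  apply: le_trans (sqnorm_triangle mD (L2_simple (rc K)) (LX N) LY) _.
  by rewrite -dbl leeD// lee_pmul2l.
have {step}[c hc] := choice step.
split => //; exists c; split; first by move=> k; have [] := hc k.
- apply/cvge0_seqP => [k|e e0]; first exact: sqnorm_ge0.
  have [N hN] := half_pow_small e0; exists N => k Nk.
  by have [_ h _] := hc k; apply: (le_trans h); rewrite lee_fin; exact: hN.
- apply/cvge0_seqP => [k|e e0]; first exact: sqnorm_ge0.
  have [N hN] := half_pow_small e0; exists N => k Nk.
  by have [_ _ h] := hc k; apply: (le_trans h); rewrite lee_fin; exact: hN.
Qed.

(** The isometry turns the Cauchy property of the step functions into that of their simple
    integrals. The steps [c] are data, taken over from an integral of the same kernel against B. *)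
Lemma kernel_integral_exists n (f : n.-tuple mR -> R) (c : nat -> steps n) :
  L2n n f -> (forall k, rectangles (c k)) ->
  L2cvg (nleb n) (simp n) (fun k => step_fun (c k)) f ->
  exists X, kernel_integral Phi f X.
Proof.
move=> Lf rc cf.
have [X LX cX] : exists2 X, L2 mu D X & L2cvg mu D (fun k => simple_integral Phi (c k)) X.
  apply: (L2_complete mD) => [k|e e0]; first exact: L2_simple.
  (* The 4 absorbs the doubling in [sqnorm_triangle], and [1 + kappa n] is positive even for weight
     0. *)
  have e1 : 0 < e / (4 * (1 + kappa n)) by rewrite divr_gt0// mulr_gt0// ltr_wpDr.
  have /cvge0_seqP-/(_ (fun i => sqnorm_ge0 _ _ _) _ e1)[N hN] := cf.
  exists N => i j Ni Nj.
  rewrite (kernel_integral_sqnorm (kernel_integralB (kernel_integral_simple (rc i))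
    (kernel_integral_simple (rc j)))).
  apply: (@le_trans _ _ ((kappa n)%:E * (e / (1 + kappa n))%:E)%E); last first.
    rewrite -EFinM lee_fin mulrCA ler_piMr ?(ltW e0)// ler_pdivrMr ?mul1r ?ler_wpDl//.
    by rewrite ltr_wpDr.
  rewrite lee_wpmul2l ?lee_fin//.
  apply: le_trans (sqnorm_triangle (@mS n) (L2_step (rc i)) Lf (L2_step (rc j))) _.
  have -> : (e / (1 + kappa n))%:E =
      (2%:E * (e / (4 * (1 + kappa n)))%:E + 2%:E * (e / (4 * (1 + kappa n)))%:E)%E.
    rewrite -!EFinM -EFinD; congr EFin; field.
    by rewrite gt_eqF// ltr_wpDr.
  rewrite leeD// lee_pmul2l//; first exact: hN.
  by rewrite sqnormBC; exact: hN.
by exists X; split => //; exists c.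
Qed.

Lemma sqnorm_partial_sum (f : forall n, n.-tuple mR -> R) (J : nat -> T -> R) K N :
  (forall n, kernel_integral Phi (@f n) (J n)) ->
  sqnorm mu D (fun w => \sum_(K <= n < N) J n w) =
  (\sum_(K <= n < N) (kappa n)%:E * sqn n (@f n))%E.
Proof.
move=> fJ; have LJ n : L2 mu D (J n) by have [] := fJ n.
rewrite sqnormE//; last exact: L2_sum.
rewrite ip_suml//; last exact: L2_sum.
rewrite -sumEFin; apply: eq_big_nat => n /andP[Kn nN].
rewrite -(kernel_integral_sqnorm (fJ n)) (sqnormE mD (LJ n)) ip_sumr//; congr EFin.
rewrite (bigD1_seq n) ?mem_index_iota ?Kn ?nN ?iota_uniq//=.
rewrite big1 ?addr0// => i ni.
by apply: (kernel_integral_ip0 _ (fJ n) (fJ i)); rewrite eq_sym.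
Qed.

Let term_ge0 (f : forall n, n.-tuple mR -> R) n : (0 <= (kappa n)%:E * sqn n (@f n))%E.
Proof. by rewrite mule_ge0 ?sqnorm_ge0// lee_fin. Qed.

Lemma kernels_integral_sqnorm (f : forall n, n.-tuple mR -> R) X :
  kernels_integral Phi f X ->
  sqnorm mu D X = (\sum_(0 <= n <oo) (kappa n)%:E * sqn n (@f n))%E.
Proof.
move=> [LX [J [fJ cJ]]]; have LJ n : L2 mu D (J n) by have [] := fJ n.
have LS N : L2 mu D (fun w => \sum_(0 <= n < N) J n w) by exact: L2_sum.
have h := L2cvg_ip mD LS LS LX LX cJ cJ.
apply/esym/cvg_lim => //; rewrite sqnormE//.
under [X in X @ _]funext do rewrite -(sqnorm_partial_sum _ _ fJ) sqnormE//.
by apply/fine_cvgP; split; [exact: nearW|exact: h].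
Qed.

Lemma kernels_integral_exists (f : forall n, n.-tuple mR -> R) (J : nat -> T -> R) :
  (forall n, kernel_integral Phi (@f n) (J n)) ->
  (\sum_(0 <= n <oo) (kappa n)%:E * sqn n (@f n) < +oo)%E ->
  exists2 X, L2 mu D X & L2cvg mu D (fun N w => \sum_(0 <= n < N) J n w) X.
Proof.
move=> fJ foo; have LJ n : L2 mu D (J n) by have [] := fJ n.
have LS N : L2 mu D (fun w => \sum_(0 <= n < N) J n w) by exact: L2_sum.
apply: L2_complete => // e e0.
have tail := nneseries_tail_cvg foo (fun k _ => term_ge0 f k).
have [|N hN] := (cvge0_seqP _).1 tail e e0.
  by move=> k; apply: nneseries_ge0 => i _ _; exact: term_ge0.
suff main m n : (N <= n)%N -> (n <= m)%N ->
    (sqnorm mu D (fun x => (\sum_(0 <= i < m) J i x - \sum_(0 <= i < n) J i x)%R) <= e%:E)%E.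
  exists N => m n Nm Nn; have [|/ltnW] := leqP n m; first exact: main.
  by rewrite sqnormBC; exact: main.
move=> Nn nm; rewrite (_ : (fun x => _) = (fun x => \sum_(n <= i < m) J i x)); last first.
  by apply/funext => x; rewrite [X in X - _](big_cat_nat (n := n))//= addrAC subrr add0r.
rewrite (sqnorm_partial_sum _ _ fJ); apply: le_trans (hN n Nn).
apply: nneseries_lim_ge => // i _; exact: term_ge0.
Qed.

Lemma kernels_integral_combine a (f g : forall n, n.-tuple mR -> R) X Y :
  kernels_integral Phi f X -> kernels_integral Phi g Y ->
  kernels_integral Phi (fun n x => a * f n x + g n x) (fun w => a * X w + Y w).
Proof.
move=> [LX [J [fJ cJ]]] [LY [K [gK cK]]].
have LJ n : L2 mu D (J n) by have [] := fJ n.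
have LK n : L2 mu D (K n) by have [] := gK n.
split; first by apply: L2D => //; exact: L2Z.
exists (fun n w => a * J n w + K n w); split.
  by move=> n; exact: kernel_integral_combine.
apply: L2cvg_eq (L2cvgZD mD a _ _ LX LY cJ cK) => [N w|N|N]; try exact: L2_sum.
by rewrite big_split mulr_sumr.
Qed.

Lemma kernels_integralB (f g : forall n, n.-tuple mR -> R) X Y :
  kernels_integral Phi f X -> kernels_integral Phi g Y ->
  kernels_integral Phi (fun n x => f n x - g n x) (fun w => X w - Y w).
Proof.
move=> fX gY; have := kernels_integral_combine (-1) gY fX.
under [X in kernels_integral _ _ X]funext do rewrite mulN1r addrC.
rewrite (_ : (fun n x => _) = (fun n x => f n x - g n x))//.
by apply/functional_extensionality_dep => n; apply/funext => x; rewrite mulN1r addrC.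
Qed.

Lemma kernels_integral_unique (f g : forall n, n.-tuple mR -> R) X Y :
  kernels_integral Phi f X -> kernels_integral Phi g Y ->
  (forall n, sqn n (fun x => f n x - g n x) = 0%E) ->
  sqnorm mu D (fun w => X w - Y w) = 0%E.
Proof.
move=> fX gY fg; rewrite (kernels_integral_sqnorm (kernels_integralB fX gY)).
by rewrite eseries0// => n _ _; rewrite fg mule0.
Qed.

(** The squared norm of the difference is a series of nonnegative terms, so each term vanishes:
    kernels are determined almost everywhere at every level of positive weight. *)
Lemma kernels_integral_inj (f g : forall n, n.-tuple mR -> R) X Y n :
  kernels_integral Phi f X -> kernels_integral Phi g Y ->
  sqnorm mu D (fun w => X w - Y w) = 0%E -> 0 < kappa n ->
  sqn n (fun x => f n x - g n x) = 0%E.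
Proof.
move=> fX gY; rewrite (kernels_integral_sqnorm (kernels_integralB fX gY)) => h k0.
have := nneseriesD1 (n := n) (P := xpredT) (fun i _ => term_ge0 (fun n x => f n x - g n x) i) isT.
rewrite h => /esym/eqP; rewrite padde_eq0; last 2 first.
  exact: (term_ge0 (fun n x => f n x - g n x)).
  by apply: nneseries_ge0 => i _ _; exact: (term_ge0 (fun n x => f n x - g n x)).
move=> /andP[/eqP + _]; move=> /eqP; rewrite mule_eq0 eqe gt_eqF//= => /eqP.
by [].
Qed.

Lemma kernels_integral_ae (f g : forall n, n.-tuple mR -> R) X Y :
  kernels_integral Phi f X -> (forall n, L2n n (@g n)) ->
  (forall n, sqn n (fun x => f n x - g n x) = 0%E) ->
  L2 mu D Y -> sqnorm mu D (fun w => X w - Y w) = 0%E -> kernels_integral Phi g Y.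
Proof.
move=> [LX [J [fJ cJ]]] Lg fg LY XY; have LJ n : L2 mu D (J n) by have [] := fJ n.
split => //; exists J; split.
  move=> n; apply: (kernel_integral_ae (fJ n) (Lg n) (fg n) (LJ n)).
  exact: sqnorm_subrr.
by apply: (L2cvg_ae mD _ LX LY XY cJ) => N; exact: L2_sum.
Qed.

End one_system.

Section combined_system.
Variables (Phi Psi : forall n, n.-tuple (R * R) -> T -> R) (kappa : nat -> R) (a : R).
Hypotheses (LPhi : forall n b, rectangle_in_simplex b -> L2 mu D (@Phi n b))
  (hPsi : orthogonal_system Psi kappa).

Let Xi n b w := a * @Phi n b w + Psi b w.

Lemma simple_integral_system n (c : steps n) :
  simple_integral Xi c = fun w => a * simple_integral Phi c w + simple_integral Psi c w.
Proof.
apply/funext => w; rewrite /simple_integral mulr_sumr -big_split/=.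
by apply: eq_bigr => p _; rewrite /Xi mulrDr mulrCA.
Qed.

(** The steps of [X] are kept and [Y] is recomputed along them, so the isometry is used for [Psi]
    alone. The lemma can therefore be iterated, with the combination obtained so far in the role of
    [Phi]. *)
Lemma kernel_integral_system n (f : n.-tuple mR -> R) X Y :
  kernel_integral Phi f X -> kernel_integral Psi f Y ->
  kernel_integral Xi f (fun w => a * X w + Y w).
Proof.
move=> [Lf LX [c [rc cf cX]]] fY; have [_ LY _] := fY.
have cY := kernel_integral_along hPsi fY rc cf.
split => //; first by apply: L2D => //; exact: L2Z.
exists c; split => //; under [X in L2cvg _ _ X]funext do rewrite simple_integral_system.
by apply: (L2cvgZD mD) => // k; [exact: (L2_simple_integral (@LPhi n))|exact: (L2_simple hPsi)].
Qed.

Lemma kernels_integral_system (f : forall n, n.-tuple mR -> R) X Y :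
  kernels_integral Phi f X -> kernels_integral Psi f Y ->
  kernels_integral Xi f (fun w => a * X w + Y w).
Proof.
move=> [LX [J [fJ cJ]]] [LY [K [fK cK]]].
have LJ n : L2 mu D (J n) by have [] := fJ n.
have LK n : L2 mu D (K n) by have [] := fK n.
split; first by apply: L2D => //; exact: L2Z.
exists (fun n w => a * J n w + K n w); split.
  by move=> n; exact: kernel_integral_system.
apply: L2cvg_eq (L2cvgZD mD a _ _ LX LY cJ cK) => [N w|N|N]; try exact: L2_sum.
by rewrite big_split mulr_sumr.
Qed.

End combined_system.
End chaos_systems.

(** * Sections of functions on a product *)

Section product_sections.
Context d1 d2 (T1 : measurableType d1) (T2 : measurableType d2) (R : realType).
Variables (m1 : {sigma_finite_measure set T1 -> \bar R})
  (m2 : {sigma_finite_measure set T2 -> \bar R}) (A : set T2).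
Hypothesis mA : measurable A.

Let mTA : measurable (([set: T1] : set T1) `*` A).
Proof. exact: measurableX. Qed.

Variable f : T1 * T2 -> R.
Hypothesis mf : measurable_fun (setT `*` A) f.

Let g (p : T1 * T2) : \bar R := ((f p * \1_(setT `*` A) p) ^+ 2)%:E.

Let mg : measurable_fun setT g.
Proof. by apply/measurable_EFinP/measurable_funX; exact: measurable_fun_indicM. Qed.

Let g0 p : (0 <= g p)%E.
Proof. by rewrite lee_fin sqr_ge0. Qed.

Let gE w s : A s -> g (w, s) = (f (w, s) ^+ 2)%:E.
Proof. by move=> As; rewrite /g indicE mem_set// mulr1. Qed.

Let gE0 w s : ~ A s -> g (w, s) = 0%E.
Proof. by move=> As; rewrite /g indicE memNset ?mulr0 ?expr0n//= => -[]. Qed.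

Lemma measurable_section1 w : measurable_fun A (fun s => f (w, s)).
Proof.
apply: (measurable_comp mTA _ mf); first by move=> _ [s As <-].
exact/measurable_funTS/pair1_measurable.
Qed.

Lemma measurable_section2 s : A s -> measurable_fun setT (fun w => f (w, s)).
Proof.
move=> As; apply: (measurable_comp mTA _ mf); first by move=> _ [w _ <-].
exact: pair2_measurable.
Qed.

Lemma section1_fubini w : sqnorm m2 A (fun s => f (w, s)) = fubini_F m2 g w.
Proof.
rewrite /sqnorm integral_mkcond; apply: eq_integral => s _; rewrite patchE.
case: ifPn => [/set_mem As|]; first by rewrite gE.
by rewrite notin_setE => As; rewrite gE0.
Qed.

Lemma section2_fubini s : A s -> sqnorm m1 setT (fun w => f (w, s)) = fubini_G m1 g s.
Proof. by move=> As; apply: eq_integral => w _; rewrite gE. Qed.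

Lemma sqnorm_product_fubini :
  sqnorm (m1 \x m2)%E (setT `*` A) f = (\int[m1 \x m2]_p g p)%E.
Proof.
rewrite /sqnorm integral_mkcond; apply: eq_integral => -[w s] _; rewrite patchE.
case: ifPn => [|]; first by rewrite inE => -[_ /= As]; rewrite gE.
by rewrite notin_setE => h; rewrite gE0// => As; exact: h.
Qed.

Lemma measurable_sqnorm_section1 :
  measurable_fun setT (fun w => sqnorm m2 A (fun s => f (w, s))).
Proof.
rewrite (_ : (fun w => _) = fubini_F m2 g); last first.
  by apply/funext => w; exact: section1_fubini.
exact: (measurable_fun_fubini_tonelli_F (m2 := m2) g mg g0).
Qed.

Lemma measurable_sqnorm_section2 :
  measurable_fun A (fun s => sqnorm m1 setT (fun w => f (w, s))).
Proof.
apply: (@eq_measurable_fun _ _ _ _ _ (fubini_G m1 g)).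
  by move=> s; rewrite inE => As; rewrite section2_fubini.
apply: measurable_funTS.
exact: (measurable_fun_fubini_tonelli_G (m1 := m1) g mg g0).
Qed.

Lemma sqnorm_section1 : sqnorm (m1 \x m2)%E (setT `*` A) f =
  (\int[m1]_w sqnorm m2 A (fun s => f (w, s)))%E.
Proof.
rewrite sqnorm_product_fubini (fubini_tonelli1 g mg g0).
by apply: eq_integral => w _; rewrite section1_fubini.
Qed.

Lemma sqnorm_section2 : sqnorm (m1 \x m2)%E (setT `*` A) f =
  (\int[m2]_(s in A) sqnorm m1 setT (fun w => f (w, s)))%E.
Proof.
rewrite sqnorm_product_fubini (fubini_tonelli2 g mg g0) [RHS]integral_mkcond.
apply: eq_integral => s _; rewrite patchE.
case: ifPn => [|]; rewrite (inE, notin_setE) => As; first by rewrite section2_fubini.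
by rewrite /fubini_G integral0_eq// => w _; rewrite gE0.
Qed.

Let ge0_ae_lty d (T : measurableType d) (m : {measure set T -> \bar R}) D (u : T -> \bar R) :
  measurable D -> measurable_fun D u -> (forall x, 0 <= u x)%E ->
  (\int[m]_(x in D) u x < +oo)%E -> {ae m, forall x, D x -> (u x < +oo)%E}.
Proof.
move=> mD mu u0 uoo; have iu : m.-integrable D u.
  by apply/integrableP; split => //; under eq_integral do rewrite gee0_abs//.
by apply: filterS (integrable_ae mD iu) => x + Dx => /(_ Dx); rewrite fin_numE => /andP[_];
  rewrite ltey.
Qed.

Let ge0_ae_eq0 d (T : measurableType d) (m : {measure set T -> \bar R}) D (u : T -> \bar R) :
  measurable D -> measurable_fun D u -> (forall x, 0 <= u x)%E ->
  (\int[m]_(x in D) u x = 0)%E -> {ae m, forall x, D x -> u x = 0%E}.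
Proof.
move=> mD mu u0 uz; have := (ae_eq_integral_abs m mD mu).1; apply.
by rewrite -[RHS]uz; apply: eq_integral => x _; rewrite gee0_abs.
Qed.

Lemma L2_section1 : L2 (m1 \x m2)%E (setT `*` A) f ->
  {ae m1, forall w, L2 m2 A (fun s => f (w, s))}.
Proof.
move=> [_ +]; rewrite sqnorm_section1 => /(ge0_ae_lty measurableT measurable_sqnorm_section1).
move=> /(_ (fun w => sqnorm_ge0 _ _ _)); apply: filterS => w /(_ I) h; split => //.
exact: measurable_section1.
Qed.

Lemma L2_section2 : L2 (m1 \x m2)%E (setT `*` A) f ->
  {ae m2, forall s, A s -> L2 m1 setT (fun w => f (w, s))}.
Proof.
move=> [_ +]; rewrite sqnorm_section2 => /(ge0_ae_lty mA measurable_sqnorm_section2).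
move=> /(_ (fun w => sqnorm_ge0 _ _ _)); apply: filterS => s /[swap] As /(_ As) h; split => //.
exact: measurable_section2.
Qed.

Lemma sqnorm0_section1 : sqnorm (m1 \x m2)%E (setT `*` A) f = 0%E <->
  {ae m1, forall w, sqnorm m2 A (fun s => f (w, s)) = 0%E}.
Proof.
rewrite sqnorm_section1; split => h.
  have := ge0_ae_eq0 measurableT measurable_sqnorm_section1 (fun w => sqnorm_ge0 _ _ _) h.
  by apply: filterS => w; exact.
rewrite (ae_eq_integral (fun=> 0%E))// ?integral0//.
- exact: measurable_sqnorm_section1.
- by apply: filterS h => w.
Qed.

Lemma sqnorm0_section2 : sqnorm (m1 \x m2)%E (setT `*` A) f = 0%E <->
  {ae m2, forall s, A s -> sqnorm m1 setT (fun w => f (w, s)) = 0%E}.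
Proof.
rewrite sqnorm_section2; split => h.
  exact: ge0_ae_eq0 mA measurable_sqnorm_section2 (fun w => sqnorm_ge0 _ _ _) h.
by rewrite (ae_eq_integral (fun=> 0%E))// ?integral0//; exact: measurable_sqnorm_section2.
Qed.

End product_sections.

Section fast_sections.
Context d1 d2 (T1 : measurableType d1) (T2 : measurableType d2) (R : realType).
Variables (m1 : {sigma_finite_measure set T1 -> \bar R})
  (m2 : {sigma_finite_measure set T2 -> \bar R}) (A : set T2).
Hypothesis mA : measurable A.
Variables (u : nat -> T1 * T2 -> R) (X : T1 * T2 -> R).
Hypothesis mu : forall k, measurable_fun (setT `*` A) (u k).
Hypothesis mX : measurable_fun (setT `*` A) X.
Hypothesis fast : forall k, (sqnorm (m1 \x m2)%E (setT `*` A) (fun p => u k p - X p)%R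
  <= (half_pow R k)%:E)%E.

Let mB k : measurable_fun (setT `*` A) (fun p => u k p - X p).
Proof. exact: measurable_funB. Qed.

(** By Tonelli's theorem the squared distances between sections have integrals bounded by
    [half_pow R k], so [ae_fast_cvg0] applies. *)
Lemma fast_section1 : {ae m1, forall w,
  L2cvg m2 A (fun k s => u k (w, s)) (fun s => X (w, s))}.
Proof.
have := ae_fast_cvg0 measurableT (fun k => measurable_sqnorm_section1 m2 mA (mB k))
  (fun k w => sqnorm_ge0 _ _ _).
move=> /(_ m1) h;
apply: filterS (h _) => [w|k]; first exact.
by rewrite -(sqnorm_section1 m1 m2 mA (mB k)).
Qed.

Lemma fast_section2 : {ae m2, forall s, A s ->
  L2cvg m1 setT (fun k w => u k (w, s)) (fun w => X (w, s))}.
Proof.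
have := ae_fast_cvg0 mA (fun k => measurable_sqnorm_section2 m1 mA (mB k))
  (fun k w => sqnorm_ge0 _ _ _).
by move=> /(_ m2); apply => k; rewrite -(sqnorm_section2 m1 m2 mA (mB k)).
Qed.

End fast_sections.

Lemma L2cvg_fast d (T : measurableType d) (R : realType)
    (mu : {measure set T -> \bar R}) D (u : nat -> T -> R) X (e : nat -> R) :
  (forall k, 0 < e k) -> L2cvg mu D u X ->
  exists N : nat -> nat, forall k j, (N k <= j)%N ->
    (sqnorm mu D (fun x => u j x - X x)%R <= (e k)%:E)%E.
Proof.
move=> e0 uX; suff h k : exists N, forall j, (N <= j)%N ->
    (sqnorm mu D (fun x => u j x - X x)%R <= (e k)%:E)%E.
  by have [N hN] := choice h; exists N.
exact: (cvge0_seqP (fun i => sqnorm_ge0 _ _ _)).1 uX _ (e0 k).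
Qed.

Lemma rectangle_increasing (R : realType) n (b : n.-tuple (R * R)) :
  rectangle_in_simplex b -> increasing_intervals (nth (0, 0) b) n.
Proof.
move=> [h1 h2]; split=> [i ni|i j ij jn].
  by have := h1 (Ordinal ni); rewrite !(tnth_nth (0, 0)) => /andP[].
by have := h2 (Ordinal (ltn_trans ij jn)) (Ordinal jn) ij; rewrite !(tnth_nth (0, 0)).
Qed.

Definition increment_product (R : realType) (T : Type) (Y : R -> T -> R) n
    (b : n.-tuple (R * R)) (w : T) : R :=
  \prod_(i < n) (Y (tnth b i).2 w - Y (tnth b i).1 w).

(* The derivative at theta = 0 of [increment_product] for Y cos theta + Z sin theta. *)
Definition replaced_product (R : realType) d (T : measurableType d) (Y Z : R -> T -> R) n
    (b : n.-tuple (R * R)) : T -> R :=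
  increments1 Y Z (nth (0, 0) b) n.

Lemma chaos_integralE (R : realType) d (T : measurableType d) (P : {measure set T -> \bar R})
    Y (f : forall n, n.-tuple (measurableTypeR R) -> R) X :
  chaos_integral P Y f X <-> kernels_integral P setT (@increment_product R T Y) f X.
Proof. by []. Qed.

(** * The systems of Y^theta, of G and of the remainder *)

Section systems.
Context d (T : measurableType d) (R : realType).
Variables (mu : {measure set T -> \bar R}).

Lemma increment_productE (Y : R -> T -> R) n (b : n.-tuple (R * R)) :
  increment_product Y b = increments Y (nth (0, 0) b) n.
Proof.
by apply/funext => w; apply: eq_bigr => i _; rewrite !(tnth_nth (0, 0)).
Qed.

(** Positivity of the weights is automatic: for the unit intervals ]i, i + 1] all overlaps are 1, so
    [kappa n] is the squared norm of an elementary product. For [remainder_weight] the sign is not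
    visible from the formula. *)
Lemma orthogonal_systemP D (Phi : forall n, n.-tuple (R * R) -> T -> R) (kappa : nat -> R) :
  (forall n b, rectangle_in_simplex b -> L2 mu D (Phi n b)) ->
  (forall n m b b', rectangle_in_simplex b -> rectangle_in_simplex b' ->
        ip mu D (Phi n b) (Phi m b') = (n == m)%:R * kappa n *
          \prod_(i < n) overlap (nth (0, 0) b i) (nth (0, 0) b' i)) ->
  orthogonal_system mu D Phi kappa.
Proof.
move=> L h; split => // n.
pose b := [tuple (i%:R, i.+1%:R) : R * R | i < n].
have rb : rectangle_in_simplex b.
  split=> [i|i j ij]; rewrite !tnth_mktuple/=; first by rewrite ler0n ler_nat/=.
  by rewrite ler_nat.
have := h n n b b rb rb; rewrite eqxx mul1r big1 ?mulr1; last first.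
  move=> i _; rewrite -tnth_nth tnth_mktuple /overlap/= minxx maxxx.
  by rewrite -natrB// subSnn max_r.
by move=> <-; exact: ip_ge0.
Qed.

Variables (V : R -> (T -> R) -> Prop).
Hypotheses (aV : adapted_family mu V) (mu1 : ip mu setT (fun=> 1) (fun=> 1) = 1).

Let horizon n (b : n.-tuple (R * R)) : rectangle_in_simplex b ->
  exists2 t, 0 <= t & forall i, (i < n)%N -> (nth (0, 0) b i).2 <= t.
Proof.
move=> [h _]; exists (\sum_(i < n) (tnth b i).2).
  by apply: sumr_ge0 => i _; have /andP[/le_trans] := h i; apply.
move=> i ni; rewrite -[i]/(val (Ordinal ni)) -tnth_nth (bigD1 (Ordinal ni))//=.
by rewrite lerDl; apply: sumr_ge0 => j _; have /andP[/le_trans] := h j; apply.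
Qed.

Lemma L2_increment_product Y n (b : n.-tuple (R * R)) : compatible V Y ->
  rectangle_in_simplex b -> L2 mu setT (increment_product Y b).
Proof.
move=> cY rb; have [t t0 ht] := horizon rb; rewrite increment_productE.
have [L _ _ _] := aV; apply: (L t) => //.
by apply: (increments_adapted aV) => //; exact: rectangle_increasing.
Qed.

Lemma L2_replaced_product Y Z n (b : n.-tuple (R * R)) : compatible V Y -> compatible V Z ->
  rectangle_in_simplex b -> L2 mu setT (replaced_product Y Z b).
Proof.
move=> cY cZ rb; have [t t0 ht] := horizon rb.
have [L _ _ _] := aV; apply: (L t) => //.
by apply: (increments1_adapted aV) => //; exact: rectangle_increasing.
Qed.

Lemma ip_increment_product Y Z rho n m (b : n.-tuple (R * R)) (b' : m.-tuple (R * R)) :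
  compatible V Y -> compatible V Z -> centered mu V Y -> centered mu V Z ->
  covariation mu V Y Z rho -> rectangle_in_simplex b -> rectangle_in_simplex b' ->
  ip mu setT (increment_product Y b) (increment_product Z b') =
  (n == m)%:R * rho ^+ n * \prod_(i < n) overlap (nth (0, 0) b i) (nth (0, 0) b' i).
Proof.
move=> cY cZ zY zZ cov rb rb'; rewrite !increment_productE.
by apply: (ip_increments_prod aV) => //; exact: rectangle_increasing.
Qed.

Lemma increment_product_system Y : compatible V Y -> centered mu V Y ->
  covariation mu V Y Y 1 ->
  orthogonal_system mu setT (@increment_product R T Y) (fun=> 1).
Proof.
move=> cY zY cov; apply: orthogonal_systemP => [n b|n m b b' rb rb'].
  exact: L2_increment_product.
by rewrite (ip_increment_product cY cY zY zY cov)// expr1n.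
Qed.

Section rotation.
Variables (B M : R -> T -> R).
Hypotheses (cB : compatible V B) (cM : compatible V M).
Hypotheses (zB : centered mu V B) (zM : centered mu V M).
Hypotheses (covBB : covariation mu V B B 1) (covMM : covariation mu V M M 1)
  (covBM : covariation mu V B M 0).

Definition rotate (theta t : R) (w : T) : R := B t w * cos theta + M t w * sin theta.

Let cY theta : compatible V (rotate theta).
Proof. exact: (compatible_comb aV _ _ cB cM). Qed.

Let zY theta : centered mu V (rotate theta).
Proof. exact: (centered_comb aV _ _ cB cM zB zM). Qed.

Let covY theta Z r1 r2 : compatible V Z -> covariation mu V B Z r1 ->
  covariation mu V M Z r2 ->
  covariation mu V (rotate theta) Z (cos theta * r1 + sin theta * r2).
Proof. by move=> cZ h1 h2; exact: (covariation_comb aV _ _ cB cM cZ h1 h2). Qed.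

Let covBY theta : covariation mu V B (rotate theta) (cos theta).
Proof.
have := covariationC (covY theta cB covBB (covariationC covBM)).
by rewrite mulr1 mulr0 addr0.
Qed.

Let covMY theta : covariation mu V M (rotate theta) (sin theta).
Proof.
have := covariationC (covY theta cM covBM covMM).
by rewrite mulr1 mulr0 add0r.
Qed.

Let covYY theta phi : covariation mu V (rotate theta) (rotate phi)
  (cos theta * cos phi + sin theta * sin phi).
Proof. exact: (covY theta (@cY phi) (@covBY phi) (@covMY phi)). Qed.

Lemma rotate_system theta :
  orthogonal_system mu setT (@increment_product R T (rotate theta)) (fun=> 1).
Proof.
apply: (increment_product_system (@cY theta) (@zY theta)).
by have := @covYY theta theta; rewrite -!expr2 cos2Dsin2.
Qed.

Lemma replaced_system :
  orthogonal_system mu setT (@replaced_product R d T B M) (fun n => n%:R).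
Proof.
apply: orthogonal_systemP => [n b|n m b b' rb rb']; first exact: L2_replaced_product.
by apply: (ip_increments1_increments1 aV) => //; exact: rectangle_increasing.
Qed.

(** Nested in the form [a * Phi + Psi], as produced by two uses of [kernels_integral_system]. *)
Definition remainder_system theta n (b : n.-tuple (R * R)) (w : T) : R :=
  -1 * (theta * replaced_product B M b w + increment_product (rotate 0) b w) +
  increment_product (rotate theta) b w.

(* The factors of <Y^theta, Y^0>, <G, Y^theta> and <G, G> are cos theta ^ n,
   n cos theta ^ (n - 1) sin theta and n, whereas G is orthogonal to Y^0. *)
Definition remainder_weight (theta : R) (n : nat) : R :=
  2 * (1 - cos theta ^+ n) - 2 * n%:R * cos theta ^+ n.-1 * sin theta * theta +
  n%:R * theta ^+ 2.

(** All inner products between Y^theta, Y^0 and G carry the same factor [o] of overlaps and vanish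
    between different levels, so the weights combine by bilinearity. *)
Lemma remainder_orthogonal theta :
  orthogonal_system mu setT (@remainder_system theta) (remainder_weight theta).
Proof.
have LY phi n (b : n.-tuple (R * R)) : rectangle_in_simplex b ->
    L2 mu setT (increment_product (rotate phi) b) by exact: L2_increment_product.
have LG n (b : n.-tuple (R * R)) : rectangle_in_simplex b ->
    L2 mu setT (replaced_product B M b) by exact: L2_replaced_product.
have LtG n (b : n.-tuple (R * R)) : rectangle_in_simplex b ->
    L2 mu setT (fun w => theta * replaced_product B M b w).
  by move=> rb; apply: L2Z => //; exact: LG.
have LW n (b : n.-tuple (R * R)) : rectangle_in_simplex b -> L2 mu setT (fun w =>
    theta * replaced_product B M b w + increment_product (rotate 0) b w).
  by move=> rb; apply: L2D => //; [exact: LtG|exact: LY].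
have LNW n (b : n.-tuple (R * R)) : rectangle_in_simplex b -> L2 mu setT (fun w =>
    -1 * (theta * replaced_product B M b w + increment_product (rotate 0) b w)).
  by move=> rb; apply: L2Z => //; exact: LW.
have LQ n (b : n.-tuple (R * R)) : rectangle_in_simplex b ->
    L2 mu setT (remainder_system theta b).
  by move=> rb; apply: L2D => //; [exact: LNW|exact: LY].
apply: orthogonal_systemP => [|n m b b' rb rb']; first exact: LQ.
pose o := \prod_(i < n) overlap (nth (0, 0) b i) (nth (0, 0) b' i).
have hYY phi psi : ip mu setT (increment_product (rotate phi) b)
    (increment_product (rotate psi) b') =
    (n == m)%:R * (cos phi * cos psi + sin phi * sin psi) ^+ n * o.
  exact: ip_increment_product.
have hGG : ip mu setT (replaced_product B M b) (replaced_product B M b') =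
    (n == m)%:R * n%:R * o.
  by apply: (ip_increments1_increments1 aV) => //; exact: rectangle_increasing.
have hGY' k l (c : k.-tuple (R * R)) (c' : l.-tuple (R * R)) psi :
    rectangle_in_simplex c -> rectangle_in_simplex c' ->
    ip mu setT (replaced_product B M c) (increment_product (rotate psi) c') =
    (k == l)%:R * (k%:R * cos psi ^+ k.-1 * sin psi) *
    \prod_(i < k) overlap (nth (0, 0) c i) (nth (0, 0) c' i).
  move=> rc rc'; rewrite increment_productE.
  by apply: (ip_increments1 aV) => //; exact: rectangle_increasing.
have hGY psi : ip mu setT (replaced_product B M b) (increment_product (rotate psi) b') =
    (n == m)%:R * (n%:R * cos psi ^+ n.-1 * sin psi) * o.
  exact: hGY'.
(* The boxes exchange their roles in [hGY']; as overlaps are symmetric, the value is the same. *)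
have hYG psi : ip mu setT (increment_product (rotate psi) b) (replaced_product B M b') =
    (n == m)%:R * (n%:R * cos psi ^+ n.-1 * sin psi) * o.
  rewrite ipC hGY'//.
  rewrite eq_sym; case: eqVneq => [e|]; last by rewrite !mul0r.
  subst m; congr (_ * _ * _).
  by apply: eq_bigr => i _; congr (Num.max 0 (_ - _)); [exact: minC|exact: maxC].
have {}LQ := LQ _ b' rb'; have {}LNW1 := LNW _ b rb; have {}LNW2 := LNW _ b' rb'.
have {}LW1 := LW _ b rb; have {}LW2 := LW _ b' rb'.
have {}LtG1 := LtG _ b rb; have {}LtG2 := LtG _ b' rb'.
have {}LG1 := LG _ b rb; have {}LG2 := LG _ b' rb'.
have LY1 phi := LY phi _ b rb; have LY2 phi := LY phi _ b' rb'.
have e f (Lf : L2 mu setT f) : ip mu setT f (remainder_system theta b') =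
    -1 * (theta * ip mu setT f (replaced_product B M b') +
      ip mu setT f (increment_product (rotate 0) b')) +
    ip mu setT f (increment_product (rotate theta) b').
  by rewrite ipDr// ipZr// ipDr// ipZr.
rewrite ipDl// ipZl// ipDl// ipZl// !e// !hYY !hGY !hYG hGG cos0 sin0.
rewrite !mulr1 !mulr0 !mul0r !addr0 !expr1n -/o -!expr2 cos2Dsin2 expr1n mul1r /remainder_weight.
by ring.
Qed.

End rotation.
End systems.

(** * The Malliavin derivative and the gradient *)

Section replacement_formula.
Context d1 d2 (R : realType) (T1 : measurableType d1) (T2 : measurableType d2).
Variables (B : R -> T1 -> R) (Z : R -> T2 -> R).

(** Regroups the recursion on the last interval by the interval that is replaced; [bump i] skips the
    index i. *)
Lemma increments1E d (T : measurableType d) (Y W : R -> T -> R) (J : nat -> R * R) n w :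
  increments1 Y W J n.+1 w = \sum_(i < n.+1) (W (J i).2 w - W (J i).1 w) *
    increments Y (fun j => J (bump i j)) n w.
Proof.
elim: n => [|n ih].
  by rewrite big_ord_recr big_ord0/= /increments !big_ord0 mul0r add0r add0r mul1r mulr1.
rewrite big_ord_recr/=; rewrite -/(increments1 Y W J n.+1 w) ih mulr_suml; congr (_ + _).
  apply: eq_bigr => i _; have e : bump i n = n.+1 by rewrite /bump -ltnS ltn_ord.
  by rewrite incrementsS e mulrA.
rewrite mulrC; congr (_ * _); apply: eq_bigr => i _.
by rewrite /bump leqNgt ltn_ord.
Qed.

Definition remove_interval n (b : n.+1.-tuple (R * R)) (i : 'I_n.+1) : n.-tuple (R * R) :=
  [tuple tnth b (lift i j) | j < n].

Lemma remove_intervalE n (b : n.+1.-tuple (R * R)) (i : 'I_n.+1) (Y : R -> T1 -> R) w :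
  increments Y (fun j => nth (0, 0) b (bump i j)) n w =
  increment_product Y (remove_interval b i) w.
Proof.
apply: eq_bigr => j _; rewrite !tnth_mktuple !(tnth_nth (0, 0)) /=.
by [].
Qed.

Lemma remove_interval_rectangle n (b : n.+1.-tuple (R * R)) i :
  rectangle_in_simplex b -> rectangle_in_simplex (remove_interval b i).
Proof.
move=> [h1 h2]; split=> [j|j k jk]; rewrite !tnth_mktuple//.
by apply: h2; rewrite /= !/bump; case: leqP; case: leqP; lia.
Qed.

Lemma replaced_productE n (b : n.+1.-tuple (R * R)) (w : T1 * T2) :
  replaced_product (process1 B) (process2 Z) b w =
  \sum_(i < n.+1) (Z (tnth b i).2 w.2 - Z (tnth b i).1 w.2) *
    increment_product B (remove_interval b i) w.1.
Proof.
rewrite /replaced_product increments1E; apply: eq_bigr => i _.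
by rewrite -(remove_intervalE b i B w.1) !(tnth_nth (0, 0)).
Qed.

(** For fixed omega_1 the replaced product is a one-fold step integral against Z: the coefficients
    are the products of the other increments of B. Z = M gives G, and Z = [time_indicator] gives the
    value of the same step function, which is DF. *)
Definition steps_at1 n (b : n.-tuple (R * R)) (w : T1) : seq (R * 1.-tuple (R * R)) :=
  match n return n.-tuple (R * R) -> seq (R * 1.-tuple (R * R)) with
  | 0 => fun=> [::]
  | n.+1 => fun b => [seq (increment_product B (remove_interval b i) w, [tuple tnth b i])
                     | i <- enum 'I_n.+1]
  end b.

Lemma steps_at1_rectangles n (b : n.-tuple (R * R)) w :
  rectangle_in_simplex b -> rectangles (steps_at1 b w).
Proof.
case: n b => [|n] b [h1 h2] //= p /mapP[i _ ->] /=; split=> [j|j k].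
  by rewrite (ord1 j) tnth0.
by rewrite (ord1 j) (ord1 k).
Qed.

Lemma steps_at1E n (b : n.-tuple (R * R)) (w : T1 * T2) :
  replaced_product (process1 B) (process2 Z) b w =
  simple_integral (@increment_product R T2 Z) (steps_at1 b w.1) w.2.
Proof.
case: n b => [|n] b; first by rewrite /simple_integral big_nil.
rewrite replaced_productE /simple_integral big_map big_enum/=; apply: eq_bigr => i _.
by rewrite /increment_product big_ord1/= !tnth0 mulrC.
Qed.

End replacement_formula.

Lemma ip_polar d (T : measurableType d) (R : realType) (mu : {measure set T -> \bar R})
    (D : set T) (f g : T -> R) : measurable D -> L2 mu D f -> L2 mu D g ->
  ip mu D (fun x => 1 * f x + g x) (fun x => 1 * f x + g x) =
  ip mu D f f + 2 * ip mu D f g + ip mu D g g.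
Proof.
move=> mD Lf Lg; have L1f := L2Z mD 1 Lf; have Lfg := L2D mD L1f Lg.
rewrite ipDl// ipZl// !ipDr// !ipZr// (ipC _ _ g f); ring.
Qed.

Definition time_indicator (R : realType) (t : R) (s : measurableTypeR R) : R := ((s : R) <= t)%R%:R.

(* D_s of [increment_product B b]: the increment over I of the process
   t |-> [s <= t] is the indicator of I at s. *)
Definition derivative_product (R : realType) d (T : measurableType d) (B : R -> T -> R) n
    (b : n.-tuple (R * R)) : T * measurableTypeR R -> R :=
  replaced_product (process1 B) (process2 (@time_indicator R)) b.

Section slices.
Variable R : realType.
Local Notation mR := (measurableTypeR R).
Local Notation leb := (@lebesgue_measure R).
Local Notation nleb := (nlebesgue R).
Local Notation steps n := (seq (R * n.-tuple (R * R))).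

(* If f vanishes off the simplex, at most one position of s contributes, so that
   this is the value of f at the finite set {s} U x. *)
Definition slice n (f : n.+1.-tuple mR -> R) (s : mR) (x : n.-tuple mR) : R :=
  \sum_(i < n.+1) f (insert i s x).

Lemma time_indicatorB (I : R * R) (s : mR) : I.1 <= I.2 ->
  time_indicator I.2 s - time_indicator I.1 s = \1_(`]I.1, I.2]%classic) (s : R).
Proof.
move=> h; rewrite /time_indicator indicE mem_setE/= in_itv/= ltNge.
have [s1|s1] := leP (s : R) I.1; first by rewrite (le_trans s1 h) subrr.
by rewrite subr0.
Qed.

Lemma box_insert n (b : n.+1.-tuple (R * R)) (i : 'I_n.+1) (s : mR) (x : n.-tuple mR) :
  box b (insert i s x) =
  \1_(`](tnth b i).1, (tnth b i).2]%classic) (s : R) * box (remove_interval b i) x.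
Proof.
rewrite /box (bigD1_ord i)//= tnth_insert; congr (_ * _).
by apply: eq_bigr => j _; rewrite tnth_insert_lift tnth_mktuple.
Qed.

Lemma slice_step n (c : steps n.+1) s (x : n.-tuple mR) :
  slice (step_fun c) s x = \sum_(p <- c) p.1 * slice (box p.2) s x.
Proof.
by rewrite /slice exchange_big/=; apply: eq_bigr => p _; rewrite mulr_sumr.
Qed.

Lemma slice_step_simplex n (c : steps n.+1) (i : 'I_n.+1) s (x : n.-tuple mR) :
  rectangles c -> simplex (insert i s x) ->
  slice (step_fun c) s x = step_fun c (insert i s x).
Proof.
move=> rc xs; rewrite slice_step step_funE big_seq [RHS]big_seq; apply: eq_bigr => p pc.
congr (_ * _); rewrite /slice (bigD1 i)//= big1 ?addr0// => k ki.
apply/eqP/negPn/negP => h; move/eqP: ki; apply.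
exact: (insert_simplex_inj (box_simplex (rc p pc) h) xs).
Qed.

Lemma measurable_step n (c : steps n) : measurable_fun setT (fun x : n.-tuple mR => step_fun c x).
Proof.
apply: measurable_sum => p; apply: measurable_funM; first exact: measurable_cst.
exact: measurable_box.
Qed.

Lemma measurable_slice_step n (c : steps n.+1) :
  measurable_fun setT (fun p : mR * n.-tuple mR => slice (step_fun c) p.1 p.2).
Proof.
apply: measurable_sum => i.
exact: (measurableT_comp (measurable_step c) (measurable_insert i)).
Qed.

(** The factor discards s <= 0, so that the error can be integrated over all real s while [f] is
    only seen on the orthant. *)
Definition slice_error n (c : steps n.+1) (f : n.+1.-tuple mR -> R) (p : mR * n.-tuple mR) : R :=
  (0 < (p.1 : R))%R%:R * (slice (step_fun c) p.1 p.2 - f (consT p)).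

Section error.
Variables (n : nat) (c : steps n.+1) (f : n.+1.-tuple mR -> R).
Hypotheses (rc : rectangles c) (mf : measurable_fun (@orthant R n.+1) f) (sf : symmetric_fun f).

Let fo := (fun x => f x * \1_(@orthant R n.+1) x).
Let mfo : measurable_fun setT fo.
Proof. exact: (measurable_fun_indicM (@measurable_orthant R n.+1) mf). Qed.

Let I (s : mR) : R := \1_(`]0%R, +oo[%classic : set R) s.
Let mI : measurable_fun setT I.
Proof. exact: measurable_indic. Qed.
Let IE (s : mR) : I s = (0 < (s : R))%R%:R.
Proof. by rewrite /I indicE mem_setE in_itv/= andbT. Qed.

Let h p := I p.1 * (slice (step_fun c) p.1 p.2 - fo (consT p)).
Let mh : measurable_fun setT h.
Proof.
apply: measurable_funM; first exact: (measurableT_comp mI measurable_fst).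
apply: measurable_funB; first exact: measurable_slice_step.
exact: (measurableT_comp mfo (@measurable_consT R n)).
Qed.

Let hE p : simplex p.2 -> slice_error c f p = h p.
Proof.
move=> xs; rewrite /slice_error /h IE; case: ltP => [p0|_]; last by rewrite !mul0r.
congr (_ * (_ - _)); rewrite /fo indicE mem_set ?mulr1//.
by case: p xs p0 => s x /= xs s0; apply/orthant_cons; split; [exact: ltW|exact: simplex_orthant].
Qed.

Lemma measurable_slice_error : measurable_fun (setT `*` @simplex R n) (slice_error c f).
Proof.
apply: (@eq_measurable_fun _ _ _ _ _ h).
  by move=> p; rewrite inE => -[_ ps]; rewrite hE.
exact: measurable_funTS.
Qed.

(** An instance of marking one of n + 1 ordered times, by [simplex_insert_integral]. So steps close
    to [f] have, on average over s, slices close to those of [f]. *)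
Lemma sqnorm_slice_error :
  sqnorm (leb \x nleb n)%E (setT `*` @simplex R n) (slice_error c f) =
  (n.+1%:R%:E * sqnorm (nleb n.+1) (@simplex R n.+1) (fun x => step_fun c x - f x)%R)%E.
Proof.
pose J (x : n.-tuple mR) : R := \1_(@simplex R n) x.
have mJ : measurable_fun setT J by apply: measurable_indic; exact: measurable_simplex.
pose g (p : mR * n.-tuple mR) : \bar R := ((h p * J p.2) ^+ 2)%:E.
have mg : measurable_fun setT g.
  apply/measurable_EFinP/measurable_funX/measurable_funM => //.
  exact: (measurableT_comp mJ measurable_snd).
pose k (x : n.+1.-tuple mR) : \bar R := ((step_fun c x - fo x) ^+ 2)%:E.
have mk : measurable_fun setT k.
  apply/measurable_EFinP/measurable_funX/measurable_funB => //.
  exact: measurable_step.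
transitivity (\int[(leb \x nleb n)%E]_p g p)%E.
  rewrite /sqnorm integral_mkcond; apply: eq_integral => p _; rewrite patchE.
  case: ifPn => [/set_mem[_ ps]|].
    by rewrite hE// /g /J indicE mem_set// mulr1.
  rewrite notin_setE => ps; rewrite /g /J indicE memNset ?mulr0 ?expr0n//.
  by move=> ps'; apply: ps.
rewrite (@simplex_insert_integral R n g k)//.
- congr (_ * _)%E; apply: eq_integral => x /set_mem xs.
  by rewrite /k /fo indicE mem_set ?mulr1//; exact: simplex_orthant.
- by move=> p; rewrite lee_fin sqr_ge0.
- by move=> x; rewrite lee_fin sqr_ge0.
- move=> p ps; rewrite /g /h IE /J indicE.
  case: ltP => [p0|_]; last by rewrite !mul0r expr0n.
  by rewrite memNset ?mulr0 ?expr0n// => xs; apply: ps.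
- move=> i s x xs; have [s0 xs'] := insert_simplex_sub xs.
  rewrite /g /h IE /= s0 mul1r /J indicE mem_set// mulr1 /k.
  rewrite (slice_step_simplex rc xs) /fo !indicE !mem_set ?mulr1//.
  + by rewrite (symmetric_insert i s x sf).
  + exact: simplex_orthant.
  + by apply/orthant_cons; split; [exact: ltW|exact: simplex_orthant].
Qed.

End error.
End slices.

(** * The derivative and its integral against M on step kernels *)

Section derivative_system.
Context {R : realType} {d1 d2 : measure_display}
  {T1 : measurableType d1} {T2 : measurableType d2}.
Variables (P1 : probability T1 R) (P2 : probability T2 R).
Variables (V1 : R -> (T1 -> R) -> Prop) (V2 : R -> (T2 -> R) -> Prop).
Hypotheses (aV1 : adapted_family P1 V1) (aV2 : adapted_family P2 V2).
Variables (B : R -> T1 -> R) (M : R -> T2 -> R).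
Hypotheses (cB : compatible V1 B) (cM : compatible V2 M).
Hypotheses (zB : centered P1 V1 B) (zM : centered P2 V2 M).
Hypotheses (vB : covariation P1 V1 B B 1) (vM : covariation P2 V2 M M 1).

Local Notation mR := (measurableTypeR R).
Local Notation leb := (@lebesgue_measure R).
Local Notation nleb := (nlebesgue R).
Local Notation steps n := (seq (R * n.-tuple (R * R))).
Local Notation P := (P1 \x P2)%E.
Local Notation Q := (P1 \x leb)%E.
Local Notation half := (`]0%R, +oo[%classic : set mR).
Local Notation QD := ([set: T1] `*` half).
Local Notation PhiB := (@increment_product R T1 B).
Local Notation PhiM := (@increment_product R T2 M).
Local Notation PhiD := (@derivative_product R _ T1 B).
Local Notation PhiG := (@replaced_product R _ (T1 * T2)%type (process1 B) (process2 M)).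

Let mhalf : measurable half.
Proof. exact: measurable_itv. Qed.

Let mQD : measurable QD.
Proof. exact: measurableX. Qed.

Lemma system_B : orthogonal_system P1 setT PhiB (fun=> 1).
Proof. exact: (increment_product_system aV1 (ip11 P1)). Qed.

Lemma system_M : orthogonal_system P2 setT PhiM (fun=> 1).
Proof. exact: (increment_product_system aV2 (ip11 P2)). Qed.

Let V := tensor_past V1 V2.
Let aV : adapted_family P V.
Proof. exact: tensor_past_family. Qed.
Let c1 : compatible V (process1 B).
Proof. exact: (process1_compatible aV2 cB). Qed.
Let c2 : compatible V (process2 M).
Proof. exact: (process2_compatible aV1 cM). Qed.
Let z1 : centered P V (process1 B).
Proof. exact: process1_centered. Qed.
Let z2 : centered P V (process2 M).
Proof. exact: process2_centered. Qed.
Let v11 : covariation P V (process1 B) (process1 B) 1.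
Proof. exact: process11_covariation. Qed.
Let v22 : covariation P V (process2 M) (process2 M) 1.
Proof. exact: process22_covariation. Qed.
Let v12 : covariation P V (process1 B) (process2 M) 0.
Proof. exact: process12_covariation. Qed.

Lemma system_G : orthogonal_system P setT PhiG (fun n => n%:R).
Proof. exact: (replaced_system aV (ip11 P) c1 c2 z1 z2 v11 v22 v12). Qed.

Lemma system_Y theta : orthogonal_system P setT
  (@increment_product R (T1 * T2)%type (rotated B M theta)) (fun=> 1).
Proof. exact: (rotate_system aV (ip11 P) c1 c2 z1 z2 v11 v22 v12). Qed.

Lemma system_R theta : orthogonal_system P setT
  (remainder_system (process1 B) (process2 M) theta) (remainder_weight theta).
Proof. exact: (remainder_orthogonal aV (ip11 P) c1 c2 z1 z2 v11 v22 v12). Qed.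

Lemma sqnorm_thead (h : mR -> R) : measurable_fun half h ->
  sqnorm (nleb 1) (@simplex R 1) (fun x : 1.-tuple mR => h (thead x)) = sqnorm leb half h.
Proof.
move=> mh; apply: (integral_simplex1 (h := fun s => (h s ^+ 2)%:E)).
  by apply/measurable_EFinP/measurable_funX.
by move=> s; rewrite lee_fin sqr_ge0.
Qed.

Lemma kernel_integral_thead (h : mR -> R) X :
  orthogonal_system P2 setT PhiM (fun=> 1) -> measurable_fun half h ->
  kernel_integral P2 setT PhiM (fun x : 1.-tuple mR => h (thead x)) X ->
  sqnorm P2 setT X = sqnorm leb half h.
Proof.
by move=> sysM mh /(kernel_integral_sqnorm measurableT sysM) ->; rewrite mul1e sqnorm_thead.
Qed.

(** The isometry of the integral against M in almost every fiber, integrated over omega_1. *)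
Lemma sqnorm_fiberwise (f : T1 * mR -> R) (F : T1 * T2 -> R) :
  measurable_fun QD f -> measurable_fun setT F ->
  {ae P1, forall w, kernel_integral P2 setT PhiM (fun x : 1.-tuple mR => f (w, thead x)) (fun w2 => F (w, w2))} ->
  sqnorm Q QD f = sqnorm P setT F.
Proof.
move=> mf mF h; rewrite -setXTT in mF *.
rewrite (sqnorm_section1 P1 leb mhalf mf) (sqnorm_section1 P1 P2 measurableT mF).
apply: ge0_ae_eq_integral => //.
- exact: measurable_sqnorm_section1.
- exact: measurable_sqnorm_section1.
- by move=> w _; exact: sqnorm_ge0.
- by move=> w _; exact: sqnorm_ge0.
apply: filterS h => w h _; apply/esym/(kernel_integral_thead system_M _ h).
exact: (measurable_section1 mhalf mf).
Qed.

Lemma derivative_productE n (b : n.+1.-tuple (R * R)) (w : T1 * mR) :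
  rectangle_in_simplex b -> PhiD b w = \sum_(i < n.+1)
    \1_(`](tnth b i).1, (tnth b i).2]%classic) (w.2 : R) *
    increment_product B (remove_interval b i) w.1.
Proof.
move=> [rb _]; rewrite /derivative_product replaced_productE; apply: eq_bigr => i _.
by rewrite time_indicatorB//; have /andP[] := rb i.
Qed.

Lemma measurable_increment_product n (b : n.-tuple (R * R)) : rectangle_in_simplex b ->
  measurable_fun setT (increment_product B b).
Proof.
move=> rb; have [LB _ _] := system_B; exact: L2_measurable (LB _ _ rb).
Qed.

Lemma measurable_derivative_product n (b : n.-tuple (R * R)) : rectangle_in_simplex b ->
  measurable_fun setT (PhiD b).
Proof.
case: n b => [|n] b rb; first exact: measurable_cst.
rewrite (_ : PhiD b = fun w => \sum_(i < n.+1)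
    \1_(`](tnth b i).1, (tnth b i).2]%classic : set R) (w.2 : R) *
    increment_product B (remove_interval b i) w.1); last first.
  by apply/funext => w; rewrite derivative_productE.
apply: measurable_sum => i; apply: measurable_funM.
  have mi : measurable_fun setT (\1_(`](tnth b i).1, (tnth b i).2]%classic : set mR) : mR -> R).
    by apply: measurable_indic; exact: measurable_itv.
  exact: (measurableT_comp mi measurable_snd).
apply: (measurableT_comp (measurable_increment_product _) measurable_fst).
exact: remove_interval_rectangle.
Qed.

(** One list [steps_at1] represents both functions: as a step function of time and as its integral
    against M. *)
Lemma product_fibers n (b : n.-tuple (R * R)) w : rectangle_in_simplex b ->
  kernel_integral P2 setT PhiM (fun x : 1.-tuple mR => PhiD b (w, thead x)) (fun w2 => PhiG b (w, w2)).
Proof.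
move=> rb; have re : rectangles (steps_at1 B b w) by exact: steps_at1_rectangles.
have := kernel_integral_simple measurableT system_M re.
have -> : simple_integral PhiM (steps_at1 B b w) = fun w2 => PhiG b (w, w2).
  by apply/funext => w2; rewrite (steps_at1E B M b (w, w2)).
have -> // : step_fun (steps_at1 B b w) = fun x : 1.-tuple mR => PhiD b (w, thead x).
apply/funext => x; rewrite /derivative_product steps_at1E /= step_funE /simple_integral.
rewrite big_seq [RHS]big_seq; apply: eq_bigr => p pc; congr (_ * _).
rewrite /box /increment_product !big_ord1 time_indicatorB//.
by have [/(_ ord0)/andP[]] := re _ pc.
Qed.

Lemma simple_fibers n (c : steps n) w : rectangles c ->
  kernel_integral P2 setT PhiM (fun x : 1.-tuple mR => simple_integral PhiD c (w, thead x))
    (fun w2 => simple_integral PhiG c (w, w2)).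
Proof.
elim: c => [_|p c ih rc].
  have -> : (fun x : 1.-tuple mR => simple_integral PhiD ([::] : steps n) (w, thead x)) =
      (fun=> 0) by apply/funext => x; rewrite /simple_integral big_nil.
  have -> : (fun w2 => simple_integral PhiG ([::] : steps n) (w, w2)) =
      (fun=> 0) by apply/funext => w2; rewrite /simple_integral big_nil.
  exact: (kernel_integral0 measurableT system_M 1%N).
have rp : rectangle_in_simplex p.2 by apply: rc; rewrite mem_head.
have {}ih : rectangles c -> _ := ih.
have rc' : rectangles c by move=> q qc; apply: rc; rewrite in_cons qc orbT.
have := kernel_integral_combine measurableT system_M p.1 (product_fibers w rp) (ih rc').
rewrite (_ : (fun x => p.1 * _ + _) = fun x : 1.-tuple mR => simple_integral PhiD (p :: c) (w, thead x)).
  rewrite (_ : (fun w0 => p.1 * _ + _) = fun w2 => simple_integral PhiG (p :: c) (w, w2)).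
    by [].
  by apply/funext => w2; rewrite /simple_integral !big_cons.
by apply/funext => x; rewrite /simple_integral !big_cons.
Qed.

(** Transported from [system_G]: in each fiber G is the integral of DF against M, so norms agree,
    also those of sums, and inner products follow by polarization. *)
Lemma system_D : orthogonal_system Q QD PhiD (fun n => n%:R).
Proof.
have [LG _ ipG] := system_G.
have mD n (b : n.-tuple (R * R)) : rectangle_in_simplex b -> measurable_fun QD (PhiD b).
  by move=> rb; apply: measurable_funTS; exact: measurable_derivative_product.
have sD n (b : n.-tuple (R * R)) : rectangle_in_simplex b ->
    sqnorm Q QD (PhiD b) = sqnorm P setT (PhiG b).
  move=> rb; apply: sqnorm_fiberwise; first exact: mD.
    exact: L2_measurable (LG _ _ rb).
  by apply: aeW => w; exact: product_fibers.
have LD n (b : n.-tuple (R * R)) : rectangle_in_simplex b -> L2 Q QD (PhiD b).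
  move=> rb; split; first exact: mD.
  by rewrite sD//; have [] := LG _ _ rb.
apply: orthogonal_systemP => // n m b b' rb rb'; rewrite -ipG//.
have Lb := LD _ _ rb; have Lb' := LD _ _ rb'.
have Gb := LG _ _ rb; have Gb' := LG _ _ rb'.
have : sqnorm Q QD (fun w => 1 * PhiD b w + PhiD b' w) =
       sqnorm P setT (fun w => 1 * PhiG b w + PhiG b' w).
  apply: sqnorm_fiberwise.
  - by apply: L2_measurable (L2D mQD (L2Z mQD _ Lb) Lb').
  - by apply: L2_measurable (L2D measurableT (L2Z measurableT _ Gb) Gb').
  apply: aeW => w.
  exact: (kernel_integral_combine measurableT system_M 1 (product_fibers w rb)
    (product_fibers w rb')).
rewrite (sqnormE mQD (L2D mQD (L2Z mQD 1 Lb) Lb')).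
rewrite (sqnormE measurableT (L2D measurableT (L2Z measurableT 1 Gb) Gb')).
move=> [] ; rewrite (ip_polar mQD Lb Lb') (ip_polar measurableT Gb Gb').
have := sD _ _ rb; rewrite (sqnormE mQD Lb) (sqnormE measurableT Gb) => -[->].
have := sD _ _ rb'; rewrite (sqnormE mQD Lb') (sqnormE measurableT Gb') => -[->].
by move=> /addIr/addrI/mulfI; apply.
Qed.

End derivative_system.

Lemma L2cvg_transfer d d' (T : measurableType d) (T' : measurableType d') (R : realType)
    (mu : {measure set T -> \bar R}) (nu : {measure set T' -> \bar R}) D E u X v Y :
  (forall k, sqnorm nu E (fun x => v k x - Y x) = sqnorm mu D (fun x => u k x - X x)) ->
  L2cvg mu D u X -> L2cvg nu E v Y.
Proof. by move=> h; rewrite /L2cvg; under [X in _ -> X @ _ --> _]eq_fun do rewrite h. Qed.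

(** * A single level of the chaos expansion *)

Section levels.
Context {R : realType} {d1 d2 : measure_display}
  {T1 : measurableType d1} {T2 : measurableType d2}.
Variables (P1 : probability T1 R) (P2 : probability T2 R).
Variables (B : R -> T1 -> R) (M : R -> T2 -> R).

Local Notation mR := (measurableTypeR R).
Local Notation leb := (@lebesgue_measure R).
Local Notation nleb := (nlebesgue R).
Local Notation steps n := (seq (R * n.-tuple (R * R))).
Local Notation P := (P1 \x P2)%E.
Local Notation Q := (P1 \x leb)%E.
Local Notation half := (`]0%R, +oo[%classic : set mR).
Local Notation QD := ([set: T1] `*` half).
Local Notation PhiB := (@increment_product R T1 B).
Local Notation PhiM := (@increment_product R T2 M).
Local Notation PhiD := (@derivative_product R _ T1 B).
Local Notation PhiG := (@replaced_product R _ (T1 * T2)%type (process1 B) (process2 M)).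

Hypotheses (sysB : orthogonal_system P1 setT PhiB (fun=> 1))
  (sysM : orthogonal_system P2 setT PhiM (fun=> 1))
  (sysG : orthogonal_system P setT PhiG (fun n => n%:R))
  (sysD : orthogonal_system Q QD PhiD (fun n => n%:R)).
Hypothesis fibers : forall n (c : steps n) w, rectangles c ->
  kernel_integral P2 setT PhiM (fun x : 1.-tuple mR => simple_integral PhiD c (w, thead x))
    (fun w2 => simple_integral PhiG c (w, w2)).

Let mhalf : measurable half.
Proof. exact: measurable_itv. Qed.

Let mQD : measurable QD.
Proof. exact: measurableX. Qed.

Let halfE (s : mR) : half s <-> (0 < (s : R))%R.
Proof. by rewrite /= in_itv/= andbT. Qed.

Lemma measurable_thead (h : mR -> R) : measurable_fun half h ->
  measurable_fun (@simplex R 1) (fun x : 1.-tuple mR => h (thead x)).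
Proof.
move=> mh; apply: (measurable_comp mhalf _ mh).
  by move=> _ [x /simplex1 xs <-]; apply/halfE.
by apply: measurable_funTS; exact: measurable_tnth.
Qed.

Lemma L2_thead (h : mR -> R) : L2 leb half h ->
  L2 (nleb 1) (@simplex R 1) (fun x : 1.-tuple mR => h (thead x)).
Proof.
by move=> [mh hoo]; split; [exact: measurable_thead|rewrite sqnorm_thead].
Qed.

Lemma L2cvg_thead (u : nat -> mR -> R) (h : mR -> R) :
  (forall k, measurable_fun half (u k)) -> measurable_fun half h ->
  L2cvg leb half u h ->
  L2cvg (nleb 1) (@simplex R 1) (fun k (x : 1.-tuple mR) => u k (thead x)) (fun x => h (thead x)).
Proof.
move=> mu mh; apply: L2cvg_transfer => k.
by rewrite (sqnorm_thead (h := fun s => u k s - h s))//; exact: measurable_funB.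
Qed.

(** At fixed s the increment over the removed interval becomes the indicator of that interval at s,
    a mere coefficient; the same coefficients arise when a box is evaluated at an inserted s. *)
Lemma section_kernel_integral n (c : steps n.+1) (s : mR) : rectangles c ->
  kernel_integral P1 setT PhiB (slice (step_fun c) s)
    (fun w => simple_integral PhiD c (w, s)).
Proof.
elim: c => [_|p c ih rc].
  have -> : slice (step_fun ([::] : steps n.+1)) s = fun=> 0.
    by apply/funext => x; rewrite slice_step big_nil.
  have -> : (fun w => simple_integral PhiD ([::] : steps n.+1) (w, s)) = fun=> 0.
    by apply/funext => w; rewrite /simple_integral big_nil.
  exact: (kernel_integral0 measurableT sysB n).
have rp : rectangle_in_simplex p.2 by apply: rc; rewrite mem_head.
have rc' : rectangles c by move=> q qc; apply: rc; rewrite in_cons qc orbT.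
pose e : steps n := [seq (\1_(`](tnth p.2 i).1, (tnth p.2 i).2]%classic) (s : R),
  remove_interval p.2 i) | i <- enum 'I_n.+1].
have re : rectangles e.
  by move=> q /mapP[i _ ->]; exact: remove_interval_rectangle.
have := kernel_integral_combine measurableT sysB p.1
  (kernel_integral_simple measurableT sysB re) (ih rc').
have -> : (fun x => p.1 * step_fun e x + slice (step_fun c) s x) =
    slice (step_fun (p :: c)) s.
  apply/funext => x; rewrite !slice_step big_cons; congr (p.1 * _ + _).
  rewrite step_funE big_map big_enum/=; apply: eq_bigr => i _.
  by rewrite box_insert.
have -> // : (fun w => p.1 * simple_integral PhiB e w + simple_integral PhiD c (w, s)) =
    fun w => simple_integral PhiD (p :: c) (w, s).
apply/funext => w; rewrite /simple_integral big_cons; congr (p.1 * _ + _).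
by rewrite big_map big_enum/= derivative_productE.
Qed.

(** One fast sequence of steps serves for DF and G. Fibers at fixed omega_1 and slices at fixed s
    then converge almost everywhere, and [kernel_integral_closed] identifies both limits. *)
Lemma levels n (f : n.+1.-tuple mR -> R) X :
  measurable_fun (@orthant R n.+1) f -> symmetric_fun f ->
  kernel_integral P1 setT PhiB f X ->
  exists Dn Gn, [/\ kernel_integral Q QD PhiD f Dn, kernel_integral P setT PhiG f Gn,
    {ae P1, forall w, kernel_integral P2 setT PhiM
      (fun x : 1.-tuple mR => Dn (w, thead x)) (fun w2 => Gn (w, w2))} &
    {ae leb, forall s : mR, 0 < (s : R) ->
      kernel_integral P1 setT PhiB (fun x => f (consT (s, x))) (fun w => Dn (w, s))}].
Proof.
move=> mf sf [Lf LX [c0 [rc0 cf0 _]]].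
(* Divided by [n.+1], which is the weight of this level for DF and G and also the factor in
   [sqnorm_slice_error]. *)
have e0 k : 0 < half_pow R k / n.+1%:R by rewrite divr_gt0// half_pow_gt0.
have [N hN] := L2cvg_fast e0 cf0.
pose c k := c0 (N k); have rc k : rectangles (c k) by exact: rc0.
have fast k : (n.+1%:R%:E * sqnorm (nleb n.+1) (@simplex R n.+1)
    (fun x => step_fun (c k) x - f x)%R <= (half_pow R k)%:E)%E.
  have := hN k _ (leqnn _); rewrite -(@lee_pmul2l _ n.+1%:R%:E)//= -EFinM mulrCA divff ?mulr1//.
have cf : L2cvg (nleb n.+1) (@simplex R n.+1) (fun k => step_fun (c k)) f.
  apply/cvge0_seqP => [k|e ee]; first exact: sqnorm_ge0.
  have [K hK] := half_pow_small ee; exists K => k Kk.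
  apply: (le_trans (hN k _ (leqnn _))); rewrite lee_fin; apply: le_trans (hK k Kk).
  by rewrite ler_pdivrMr// ler_peMr ?(ltW (half_pow_gt0 _ _))// ler1n.
have [Dn hD] := kernel_integral_exists mQD sysD Lf rc cf.
have [Gn hG] := kernel_integral_exists measurableT sysG Lf rc cf.
have [_ LD _] := hD; have [_ LG _] := hG.
have LDc k := L2_simple mQD sysD (rc k); have LGc k := L2_simple measurableT sysG (rc k).
have fastD k : (sqnorm Q QD (fun p => simple_integral PhiD (c k) p - Dn p)%R
    <= (half_pow R k)%:E)%E.
  have := kernel_integralB mQD sysD (kernel_integral_simple mQD sysD (rc k)) hD.
  by move=> /(kernel_integral_sqnorm mQD sysD) ->.
have fastG k : (sqnorm P setT (fun p => simple_integral PhiG (c k) p - Gn p)%R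
    <= (half_pow R k)%:E)%E.
  have := kernel_integralB measurableT sysG (kernel_integral_simple measurableT sysG (rc k)) hG.
  by move=> /(kernel_integral_sqnorm measurableT sysG) ->.
exists Dn, Gn; split => //.
- have a1 := fast_section1 mhalf (fun k => L2_measurable (LDc k)) (L2_measurable LD) fastD.
  rewrite -setXTT in LG LGc fastG.
  have a2 := fast_section1 measurableT (fun k => L2_measurable (LGc k)) (L2_measurable LG) fastG.
  have a3 := L2_section1 mhalf (L2_measurable LD) LD.
  have a4 := L2_section1 measurableT (L2_measurable LG) LG.
  apply: filterS (filterI a1 (filterI a2 (filterI a3 a4))) => w [h1 [h2 [h3 h4]]].
  apply: (kernel_integral_closed measurableT sysM (fun k => fibers w (rc k))) => //.
    exact: (L2_thead h3).
  apply: (L2cvg_thead _ _ h1) => [k|].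
    exact: (measurable_section1 mhalf (L2_measurable (LDc k))).
  exact: (L2_measurable h3).
- have b1 := fast_section2 mhalf (fun k => L2_measurable (LDc k)) (L2_measurable LD) fastD.
  have mSn := @measurable_simplex R n.
  have mE k := measurable_slice_error (c k) mf.
  have b2 : {ae leb, forall s : mR, (fun k => sqnorm (nleb n) (@simplex R n)
      (fun x => slice_error (c k) f (s, x))) @ \oo --> 0%E}.
    have := ae_fast_cvg0 measurableT (fun k => measurable_sqnorm_section1 (nleb n) mSn (mE k))
      (fun k w => sqnorm_ge0 _ _ _).
    move=> /(_ leb) h; apply: filterS (h _) => [s|k]; first exact.
    by rewrite -(sqnorm_section1 leb (nleb n) mSn (mE k)) sqnorm_slice_error.
  (* With the empty list and s > 0 the error is minus the slice of [f] at s, which shows that almost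
     every slice is square integrable. *)
  have r0 : rectangles ([::] : steps n.+1) by [].
  have b3 : {ae leb, forall s : mR, L2 (nleb n) (@simplex R n)
      (fun x => slice_error [::] f (s, x))}.
    apply: (L2_section1 mSn (measurable_slice_error [::] mf)); split.
      exact: measurable_slice_error.
    rewrite sqnorm_slice_error//.
    have -> : (fun x => step_fun [::] x - f x)%R = (fun x => - f x)%R.
      by apply/funext => x; rewrite step_funE big_nil sub0r.
    have [_] := L2N (@measurable_simplex R n.+1) Lf.
    by rewrite -ge0_fin_numE ?sqnorm_ge0// => ?; rewrite -ge0_fin_numE ?mule_ge0 ?sqnorm_ge0 ?fin_numM.
  have b4 := L2_section2 mhalf (L2_measurable LD) LD.
  apply: filterS (filterI b1 (filterI b2 (filterI b3 b4))) => s [h1 [h2 [h3 h4]]] s0.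
  have hs : half s by apply/halfE.
  have Ls : L2 (nleb n) (@simplex R n) (fun x => f (consT (s, x))).
    have := L2N mSn h3; congr L2; apply/funext => x.
    by rewrite /slice_error/= s0 mul1r slice_step big_nil sub0r opprK.
  apply: (kernel_integral_closed measurableT sysB (fun k => section_kernel_integral s (rc k))) => //.
  - exact: h4.
  - move: h2; rewrite /L2cvg; under eq_fun do
      (under [X in sqnorm _ _ X]funext do rewrite /slice_error/= s0 mul1r).
    by [].
  - exact: h1.
Qed.

End levels.

(** * Summation over the levels *)

Section totals.
Context {R : realType} {d1 d2 : measure_display}
  {T1 : measurableType d1} {T2 : measurableType d2}.
Variables (P1 : probability T1 R) (P2 : probability T2 R).
Variables (B : R -> T1 -> R) (M : R -> T2 -> R).

Local Notation mR := (measurableTypeR R).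
Local Notation leb := (@lebesgue_measure R).
Local Notation nleb := (nlebesgue R).
Local Notation steps n := (seq (R * n.-tuple (R * R))).
Local Notation P := (P1 \x P2)%E.
Local Notation Q := (P1 \x leb)%E.
Local Notation half := (`]0%R, +oo[%classic : set mR).
Local Notation QD := ([set: T1] `*` half).
Local Notation PhiB := (@increment_product R T1 B).
Local Notation PhiM := (@increment_product R T2 M).
Local Notation PhiD := (@derivative_product R _ T1 B).
Local Notation PhiG := (@replaced_product R _ (T1 * T2)%type (process1 B) (process2 M)).

Hypotheses (sysB : orthogonal_system P1 setT PhiB (fun=> 1))
  (sysM : orthogonal_system P2 setT PhiM (fun=> 1))
  (sysG : orthogonal_system P setT PhiG (fun n => n%:R))
  (sysD : orthogonal_system Q QD PhiD (fun n => n%:R)).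
Hypothesis fibers : forall n (c : steps n) w, rectangles c ->
  kernel_integral P2 setT PhiM (fun x : 1.-tuple mR => simple_integral PhiD c (w, thead x))
    (fun w2 => simple_integral PhiG c (w, w2)).

Let mhalf : measurable half.
Proof. exact: measurable_itv. Qed.

Let mQD : measurable QD.
Proof. exact: measurableX. Qed.

Let halfE (s : mR) : half s <-> (0 < (s : R))%R.
Proof. by rewrite /= in_itv/= andbT. Qed.

Lemma tail_series_lty (a : nat -> \bar R) : (forall k, 0 <= a k)%E ->
  (\sum_(0 <= k <oo) a k < +oo)%E -> (\sum_(0 <= k <oo) a k.+1 < +oo)%E.
Proof.
move=> a0; rewrite (nneseries_recl (fun k _ => a0 k))// => h.
rewrite (_ : (\sum_(0 <= k <oo) a k.+1)%E = (\sum_(1 <= k <oo) a k)%E).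
  apply: le_lt_trans h; rewrite leeDr//; exact: a0.
by rewrite -(nneseries_addn 1 a0); apply: congr_lim; apply/funext => n; apply: eq_bigr => k _; rewrite addn1.
Qed.

Section totals_construction.
Variables (F : forall n, n.-tuple mR -> R) (J : nat -> T1 -> R).
Hypotheses (mF : forall n, measurable_fun (@orthant R n) (@F n))
  (sF : forall n, symmetric_fun (@F n))
  (FJ : forall n, kernel_integral P1 setT PhiB (@F n) (J n)).
Hypothesis energy :
  (\sum_(0 <= n <oo) n%:R%:E * sqnorm (nleb n) (@simplex R n) (@F n) < +oo)%E.

Lemma totals : exists DF G, [/\ kernels_integral Q QD PhiD F DF,
  kernels_integral P setT PhiG F G,
  {ae P1, forall w, kernel_integral P2 setT PhiM
      (fun x : 1.-tuple mR => DF (w, thead x)) (fun w2 => G (w, w2))} &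
  {ae leb, forall s : mR, 0 < (s : R) ->
      kernels_integral P1 setT PhiB (fun n x => F (consT (s, x))) (fun w => DF (w, s))}].
Proof.
have lev n : exists p : (T1 * mR -> R) * (T1 * T2 -> R), [/\ kernel_integral Q QD PhiD (@F n.+1) p.1,
    kernel_integral P setT PhiG (@F n.+1) p.2,
    {ae P1, forall w, kernel_integral P2 setT PhiM
      (fun x : 1.-tuple mR => p.1 (w, thead x)) (fun w2 => p.2 (w, w2))} &
    {ae leb, forall s : mR, 0 < (s : R) ->
      kernel_integral P1 setT PhiB (fun x => @F n.+1 (consT (s, x))) (fun w => p.1 (w, s))}].
  have [Dn [Gn h]] := levels sysB sysM sysG sysD fibers (mF (n := n.+1)) (sF (n := n.+1)) (FJ n.+1).
  by exists (Dn, Gn).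
have {lev}[p hp] := choice lev.
(* Level 0 is given derivative exactly 0, so that at fixed s the other levels form a chaos sum with
   orders lowered by 1. *)
pose D n : T1 * mR -> R := if n is m.+1 then (p m).1 else fun=> 0.
pose G n : T1 * T2 -> R := if n is m.+1 then (p m).2 else fun=> 0.
have [L0 _ [c0 [rc0 cf0 _]]] := FJ 0.
have FD n : kernel_integral Q QD PhiD (@F n) (D n).
  case: n => [|n]; last by have [] := hp n.
  have [X hX] := kernel_integral_exists mQD sysD L0 rc0 cf0.
  exact: (kernel_integral_degenerate mQD sysD _ hX).
have FG n : kernel_integral P setT PhiG (@F n) (G n).
  case: n => [|n]; last by have [] := hp n.
  have [X hX] := kernel_integral_exists measurableT sysG L0 rc0 cf0.
  exact: (kernel_integral_degenerate measurableT sysG _ hX).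
have LD n : L2 Q QD (D n) by have [] := FD n.
have LG n : L2 P setT (G n) by have [] := FG n.
have [DF LDF cDF] := kernels_integral_exists mQD sysD FD energy.
have [Gt LGt cGt] := kernels_integral_exists measurableT sysG FG energy.
have LSD N : L2 Q QD (fun w => \sum_(0 <= n < N) D n w) by exact: L2_sum.
have LSG N : L2 P setT (fun w => \sum_(0 <= n < N) G n w) by exact: L2_sum.
have [N1 hN1] := L2cvg_fast (half_pow_gt0 R) cDF.
have [N2 hN2] := L2cvg_fast (half_pow_gt0 R) cGt.
(* At least [k + 1], so that [(N k).-1], the number of levels left after lowering the order, still
   tends to infinity. *)
pose N k := (maxn (maxn (N1 k) (N2 k)) k).+1.
have fD k := hN1 k (N k) (leqW (leq_trans (leq_maxl _ _) (leq_maxl _ _))).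
have fG k := hN2 k (N k) (leqW (leq_trans (leq_maxr _ _) (leq_maxl _ _))).
have a3 := L2_section1 mhalf (L2_measurable LDF) LDF.
have b3 := L2_section2 mhalf (L2_measurable LDF) LDF.
have a1 := fast_section1 mhalf (fun k => L2_measurable (LSD (N k))) (L2_measurable LDF) fD.
have b1 := fast_section2 mhalf (fun k => L2_measurable (LSD (N k))) (L2_measurable LDF) fD.
exists DF, Gt; split.
- by split => //; exists D.
- by split => //; exists G.
- have mLG : L2 P (setT `*` setT) Gt by rewrite setXTT.
  have a4 := L2_section1 measurableT (L2_measurable mLG) mLG.
  have mLSG k : L2 P (setT `*` setT) (fun w => \sum_(0 <= n < N k) G n w) by rewrite setXTT.
  have fG' k : (sqnorm P (setT `*` setT) (fun x => \sum_(0 <= n < N k) G n x - Gt x)%R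
      <= (half_pow R k)%:E)%E by rewrite setXTT.
  have a2 := fast_section1 measurableT (fun k => L2_measurable (mLSG k)) (L2_measurable mLG) fG'.
  have a5 : {ae P1, forall w, forall n, kernel_integral P2 setT PhiM
      (fun x : 1.-tuple mR => D n (w, thead x)) (fun w2 => G n (w, w2))}.
    apply/ae_foralln => -[|n]; last by have [] := hp n.
    by apply: aeW => w; exact: (kernel_integral0 measurableT sysM 1%N).
  apply: filterS (filterI a1 (filterI a2 (filterI a3 (filterI a4 a5)))) =>
    w [h1 [h2 [h3 [h4 h5]]]].
  apply: (kernel_integral_closed measurableT sysM
    (fun k => kernel_integral_sum measurableT sysM (N k) h5)) => //.
    exact: (L2_thead h3).
  apply: (L2cvg_thead _ _ h1) => [k|].
    exact: (measurable_section1 mhalf (L2_measurable (LSD (N k)))).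
  exact: (L2_measurable h3).
- have b5 : {ae leb, forall s : mR, forall n, 0 < (s : R) ->
      kernel_integral P1 setT PhiB (fun x => @F n.+1 (consT (s, x))) (fun w => D n.+1 (w, s))}.
    by apply/ae_foralln => n; have [] := hp n.
  (* The squared norms of the levels at s integrate over s to terms of the energy series, so they
     are summable for almost every s. *)
  have b4 : {ae leb, forall s : mR, half s ->
      (\sum_(0 <= n <oo) sqnorm P1 setT (fun w => D n.+1 (w, s)) < +oo)%E}.
    apply: ae_series_lty => //.
    - by move=> n; exact: (measurable_sqnorm_section2 P1 mhalf (L2_measurable (LD n.+1))).
    - by move=> n s _; exact: sqnorm_ge0.
    apply: le_lt_trans (tail_series_lty _ energy).
      apply: lee_nneseries => [n _ _|n _].
        by apply: integral_ge0 => s _; exact: sqnorm_ge0.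
      rewrite -(sqnorm_section2 P1 leb mhalf (L2_measurable (LD n.+1))).
      by rewrite (kernel_integral_sqnorm mQD sysD (FD n.+1)).
    by move=> k; rewrite mule_ge0 ?sqnorm_ge0.
  apply: filterS (filterI b1 (filterI b3 (filterI b4 b5))) => s [h1 [h3 [h4 h5]]] s0.
  have hs : half s by apply/halfE.
  have {}h1 := h1 hs; have {}h3 := h3 hs; have {}h4 := h4 hs.
  have {}h5 n := h5 n s0.
  have LDs n : L2 P1 setT (fun w => D n.+1 (w, s)) by have [] := h5 n.
  (* The full chaos series at s has some limit [X]; convergence to [DF] at s is known along a
     subsequence of the partial sums only, which suffices to identify the two. *)
  have [|X LX cX] := kernels_integral_exists measurableT sysB
      (f := fun n x => F (consT (s, x))) (J := fun n w => D n.+1 (w, s)) h5.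
    apply: le_lt_trans h4; apply: lee_nneseries => [n _ _|n _].
      by rewrite mule_ge0 ?sqnorm_ge0.
    by rewrite -(kernel_integral_sqnorm measurableT sysB (h5 n)).
  have LS K : L2 P1 setT (fun w => \sum_(0 <= n < K) D n.+1 (w, s)) by exact: L2_sum.
  have cX' : L2cvg P1 setT (fun k w => \sum_(0 <= n < (N k).-1) D n.+1 (w, s)) X.
    apply/cvge0_seqP => [k|e e0]; first exact: sqnorm_ge0.
    have [K hK] := (cvge0_seqP (fun i => sqnorm_ge0 _ _ _)).1 cX e e0.
    by exists K => k Kk; apply: hK; rewrite /N/=; apply: leq_trans Kk (leq_maxr _ _).
  have cD : L2cvg P1 setT (fun k w => \sum_(0 <= n < (N k).-1) D n.+1 (w, s)) (fun w => DF (w, s)).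
    apply: L2cvg_eq h1 => k w; rewrite /N/= big_nat_recl//= add0r.
    by [].
  have hX := L2cvg_sqnorm0 measurableT (fun k => LS _) LX h3 cX' cD.
  apply: (kernels_integral_ae measurableT sysB (f := fun n x => F (consT (s, x)))
    (X := X)) => //.
  + by split => //; exists (fun n w => D n.+1 (w, s)).
  + by move=> n; have [] := h5 n.
  + by move=> n; exact: sqnorm_subrr.
Qed.

End totals_construction.
End totals.

(** * Symmetric kernels as functions on finite sets *)

Section set_kernels.
Variable R : realType.
Local Notation mR := (measurableTypeR R).
Local Notation nleb := (nlebesgue R).
Implicit Types f : forall n, n.-tuple mR -> R.

Lemma set_kernel_symmetric f n : symmetric_kernels f -> symmetric_fun (set_kernel f (n := n)).
Proof. by move=> sf s x; rewrite /set_kernel sf. Qed.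

Lemma set_kernel_measurable f n : measurable_fun (@orthant R n) (f n) ->
  measurable_fun (@orthant R n) (set_kernel f (n := n)).
Proof. by move=> mf; apply: measurable_funM => //; exact: measurable_cst. Qed.

(** One factor n! comes from passing to the simplex; together with the n! of the energy it is the
    square of the n! inside [set_kernel]. *)
Lemma set_kernel_energy f n : measurable_fun (@orthant R n) (f n) -> symmetric_fun (f n) ->
  ((n * n`!)%:R%:E * sqnorm (nleb n) (@orthant R n) (f n) =
   n%:R%:E * sqnorm (nleb n) (@simplex R n) (set_kernel f (n := n)))%E.
Proof.
move=> mf sf; rewrite sqnorm_orthant//.
have mfs : measurable_fun (@simplex R n) (f n).
  by apply: measurable_funS mf; [exact: measurable_orthant|exact: simplex_orthant].
have -> : sqnorm (nleb n) (@simplex R n) (set_kernel f (n := n)) =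
    ((n`!%:R ^+ 2)%:E * sqnorm (nleb n) (@simplex R n) (f n))%E.
  exact: (sqnormZ (nleb n) (@measurable_simplex R n) n`!%:R mfs).
by rewrite !muleA -!EFinM natrM expr2 mulrA.
Qed.

(** Since n! (n + 1) = (n + 1)!, the derivative at s acts on functions of finite sets by adjoining
    the point s. *)
Lemma derivative_set_kernel f (s : mR) :
  set_kernel (derivative_kernels f s) = fun n x => set_kernel f (consT (s, x)).
Proof.
apply/functional_extensionality_dep => n; apply/funext => x.
by rewrite /set_kernel /derivative_kernels mulrA -natrM mulnC -factS.
Qed.

Lemma derivative_symmetric f (s : R) : symmetric_kernels f ->
  symmetric_kernels (derivative_kernels f s).
Proof.
move=> sf n p x; rewrite /derivative_kernels; congr (_ * _).
exact: (symmetric_cons s (sf n.+1) p x).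
Qed.

End set_kernels.

Lemma chaos_expansionP (R : realType) d (T : measurableType d) (P : {measure set T -> \bar R})
    B (f : forall n, n.-tuple (measurableTypeR R) -> R) X : chaos_expansion P B f X ->
  [/\ forall n, symmetric_fun (set_kernel f (n := n)),
      forall n, measurable_fun (@orthant R n) (set_kernel f (n := n)) &
      kernels_integral P setT (@increment_product R T B) (set_kernel f) X].
Proof.
move=> [sf Lf fX]; split => // n; first exact: set_kernel_symmetric.
by apply: set_kernel_measurable; have [] := Lf n.
Qed.

(** * Existence, uniqueness and linearity of the gradient *)

Section gradient.
Context {R : realType} {d1 d2 : measure_display}
  {T1 : measurableType d1} {T2 : measurableType d2}.
Variables (P1 : probability T1 R) (P2 : probability T2 R).
Variables (B : R -> T1 -> R) (M : R -> T2 -> R).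

Local Notation mR := (measurableTypeR R).
Local Notation leb := (@lebesgue_measure R).
Local Notation nleb := (nlebesgue R).
Local Notation steps n := (seq (R * n.-tuple (R * R))).
Local Notation P := (P1 \x P2)%E.
Local Notation Q := (P1 \x leb)%E.
Local Notation half := (`]0%R, +oo[%classic : set mR).
Local Notation QD := ([set: T1] `*` half).
Local Notation PhiB := (@increment_product R T1 B).
Local Notation PhiM := (@increment_product R T2 M).
Local Notation PhiD := (@derivative_product R _ T1 B).
Local Notation PhiG := (@replaced_product R _ (T1 * T2)%type (process1 B) (process2 M)).

Hypotheses (sysB : orthogonal_system P1 setT PhiB (fun=> 1))
  (sysM : orthogonal_system P2 setT PhiM (fun=> 1))
  (sysG : orthogonal_system P setT PhiG (fun n => n%:R))
  (sysD : orthogonal_system Q QD PhiD (fun n => n%:R)).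
Hypothesis fibers : forall n (c : steps n) w, rectangles c ->
  kernel_integral P2 setT PhiM (fun x : 1.-tuple mR => simple_integral PhiD c (w, thead x))
    (fun w2 => simple_integral PhiG c (w, w2)).

Let mhalf : measurable half.
Proof. exact: measurable_itv. Qed.

Let mQD : measurable QD.
Proof. exact: measurableX. Qed.

Let halfE (s : mR) : half s <-> (0 < (s : R))%R.
Proof. by rewrite /= in_itv/= andbT. Qed.

Definition energy (F : forall n, n.-tuple mR -> R) : \bar R := (\sum_(0 <= n <oo)
  n%:R%:E * sqnorm (nleb n) (@simplex R n) (@F n))%E.

Lemma finite_energyP (f : forall n, n.-tuple mR -> R) F : chaos_expansion P1 B f F ->
  finite_energy f <-> (energy (set_kernel f) < +oo)%E.
Proof.
move=> [sf Lf _]; rewrite /finite_energy.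
rewrite (_ : (\sum_(0 <= n <oo) _)%E = energy (set_kernel f))//.
apply: congr_lim; apply/funext => N; apply: eq_bigr => n _.
by apply: set_kernel_energy => //; have [] := Lf n.
Qed.

Lemma sharp_exists (f : forall n, n.-tuple mR -> R) F :
  chaos_expansion P1 B f F -> finite_energy f ->
  exists DF G, [/\ malliavin_derivative P1 B F DF, integral_dM P1 P2 M DF G &
    kernels_integral P setT PhiG (set_kernel f) G].
Proof.
move=> fF ef; have [sf mf [LF [J [fJ _]]]] := chaos_expansionP fF.
have [sf' Lf _] := fF.
have [DF [G [hD hG hDG hs]]] := totals sysB sysM sysG sysD fibers mf sf fJ ((finite_energyP fF).1 ef).
exists (fun w s => DF (w, s)), G; split => //.
  exists f => //; split.
    rewrite (_ : (fun p => _) = DF); first by case: hD.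
    by apply/funext => -[].
  apply: filterS hs => s hs s0; split.
  - exact: derivative_symmetric.
  - move=> n; have {hs}[_ [K [hK _]]] := hs s0; have [Ls _ _] := hK n.
    have sc : symmetric_fun (fun x => set_kernel f (consT (s, x)) (n := n.+1)).
      exact: symmetric_cons.
    have mc : measurable_fun (@orthant R n) (fun x => set_kernel f (consT (s, x)) (n := n.+1)).
      apply: (measurable_comp (F := @orthant R n.+1)) => //.
      + exact: measurable_orthant.
      + by move=> _ [x xo <-]; apply/orthant_cons; split => //; exact: ltW.
      + apply: measurable_funTS.
        exact: (measurableT_comp (@measurable_consT R n) (pair1_measurable s)).
    have Lo : L2 (nleb n) (@orthant R n) (fun x => set_kernel f (consT (s, x)) (n := n.+1)).
      split => //; rewrite sqnorm_orthant//.
      have [_] := Ls.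
      rewrite -ge0_fin_numE ?sqnorm_ge0// => ?.
      by rewrite -ge0_fin_numE ?mule_ge0 ?sqnorm_ge0 ?fin_numM.
    have := L2Z (@measurable_orthant R n) (n`!%:R^-1) Lo; congr L2; apply/funext => x.
    rewrite /set_kernel /derivative_kernels mulrA; congr (_ * _).
    by rewrite factS natrM mulrC mulfK// pnatr_eq0 -lt0n fact_gt0.
  - rewrite chaos_integralE derivative_set_kernel; exact: hs.
split => //; by case: hG.
Qed.

(** [sqnorm_slice_error] with no steps: the slices of [e] have total norm 0, so almost all of them
    are null. *)
Lemma slice_null n (e : n.+1.-tuple mR -> R) :
  measurable_fun (@orthant R n.+1) e -> symmetric_fun e ->
  sqnorm (nleb n.+1) (@simplex R n.+1) e = 0%E ->
  {ae leb, forall s : mR, 0 < (s : R) ->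
    sqnorm (nleb n) (@simplex R n) (fun x => e (consT (s, x))) = 0%E}.
Proof.
move=> me se e0; have mSn := @measurable_simplex R n.
have r0 : rectangles ([::] : steps n.+1) by [].
have := sqnorm_slice_error r0 me se.
have -> : (fun x => step_fun [::] x - e x)%R = (fun x => -1 * e x)%R.
  by apply/funext => x; rewrite step_funE big_nil sub0r mulN1r.
have mes : measurable_fun (@simplex R n.+1) e.
  by apply: measurable_funS me; [exact: measurable_orthant|exact: simplex_orthant].
rewrite (sqnormZ (nleb n.+1) (@measurable_simplex R n.+1) (-1) mes) e0 !mule0 => /(sqnorm0_section1 leb (nleb n) mSn (measurable_slice_error [::] me)).
apply: filterS => s + s0.
rewrite (_ : (fun x => slice_error _ _ _) = (fun x => - e (consT (s, x)))); last first.
  by apply/funext => x; rewrite /slice_error/= s0 mul1r slice_step big_nil sub0r.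
by move=> <-; apply: eq_integral => x _; rewrite sqrrN.
Qed.

(** By uniqueness, the kernels of K agree almost everywhere with the combined ones, so do almost all
    their slices, and these determine the derivative at almost every s. General [a] gives linearity,
    [a = 0] independence of the chosen derivative. *)
Lemma malliavin_combine a F H K DF DH DK :
  malliavin_derivative P1 B F DF -> malliavin_derivative P1 B H DH ->
  malliavin_derivative P1 B K DK ->
  sqnorm P1 setT (fun w => K w - (a * F w + H w)) = 0%E ->
  sqnorm Q QD (fun p => DK p.1 p.2 - (a * DF p.1 p.2 + DH p.1 p.2)) = 0%E.
Proof.
move=> [f [fF _] [LDF hDF]] [h [hH _] [LDH hDH]] [k [kK _] [LDK hDK]] KFH.
have [sf mf cf] := chaos_expansionP fF; have [sh mh ch] := chaos_expansionP hH.
have [sk mk ck] := chaos_expansionP kK.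
have cfh := kernels_integral_combine measurableT sysB a cf ch.
pose e n (x : n.-tuple mR) := set_kernel k x - (a * set_kernel f x + set_kernel h x).
have e0 n : sqnorm (nleb n) (@simplex R n) (@e n) = 0%E.
  exact: (kernels_integral_inj measurableT sysB ck cfh KFH).
have me n : measurable_fun (@orthant R n) (@e n).
  have maf : measurable_fun (@orthant R n) (fun x => a * set_kernel f x).
    exact: (measurable_funM (measurable_cst _) (mf n)).
  exact: (measurable_funB (mk n) (measurable_funD maf (mh n))).
have se n : symmetric_fun (@e n).
  by move=> s x; rewrite /e sf sh sk.
have ae_e : {ae leb, forall s : mR, forall n, 0 < (s : R) ->
    sqnorm (nleb n) (@simplex R n) (fun x => @e n.+1 (consT (s, x))) = 0%E}.
  by apply/ae_foralln => n; exact: slice_null.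
have Ld : L2 Q QD (fun p => DK p.1 p.2 - (a * DF p.1 p.2 + DH p.1 p.2)).
  exact: (L2B mQD LDK (L2D mQD (L2Z mQD a LDF) LDH)).
apply/(sqnorm0_section2 P1 leb mhalf (L2_measurable Ld)).
apply: filterS (filterI hDF (filterI hDH (filterI hDK ae_e))) => s [h1 [h2 [h3 h4]]] /halfE s0.
have [_ _ +] := h1 s0; have [_ _ +] := h2 s0; have [_ _ +] := h3 s0.
rewrite !chaos_integralE !derivative_set_kernel => c3 c2 c1.
apply: (kernels_integral_unique measurableT sysB c3
  (kernels_integral_combine measurableT sysB a c1 c2)) => n.
exact: (h4 n s0).
Qed.

Lemma integral_dM_combine a DF DH DK G G' G'' :
  L2 Q QD (fun p => DF p.1 p.2) -> L2 Q QD (fun p => DH p.1 p.2) ->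
  L2 Q QD (fun p => DK p.1 p.2) ->
  integral_dM P1 P2 M DF G -> integral_dM P1 P2 M DH G' -> integral_dM P1 P2 M DK G'' ->
  sqnorm Q QD (fun p => DK p.1 p.2 - (a * DF p.1 p.2 + DH p.1 p.2)) = 0%E ->
  sqnorm P setT (fun w => G'' w - (a * G w + G' w)) = 0%E.
Proof.
move=> LDF LDH LDK [LG hG] [LG' hG'] [LG'' hG''].
have Ld : L2 Q QD (fun p => DK p.1 p.2 - (a * DF p.1 p.2 + DH p.1 p.2)).
  exact: (L2B mQD LDK (L2D mQD (L2Z mQD a LDF) LDH)).
move=> /(sqnorm0_section1 P1 leb mhalf (L2_measurable Ld)) h0.
have Ldd : L2 P (setT `*` setT) (fun w => G'' w - (a * G w + G' w)).
  rewrite setXTT.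
  exact: (L2B measurableT LG'' (L2D measurableT (L2Z measurableT a LG) LG')).
rewrite -setXTT; apply/(sqnorm0_section1 P1 P2 measurableT (L2_measurable Ldd)).
apply: filterS (filterI hG (filterI hG' (filterI hG'' h0))) => w [h1 [h2 [h3 h4]]].
have := kernel_integralB measurableT sysM h3 (kernel_integral_combine measurableT sysM a h1 h2).
move=> /(kernel_integral_thead sysM (measurable_section1 mhalf (L2_measurable Ld) w)) ->.
exact: h4.
Qed.

Lemma ae_eq_combine d (T : measurableType d) (mu : {measure set T -> \bar R}) a (X Y Z : T -> R) :
  measurable_fun setT (fun w => Z w - (a * X w + Y w)) ->
  sqnorm mu setT (fun w => Z w - (a * X w + Y w)) = 0%E ->
  {ae mu, forall w, Z w = a * X w + Y w}.
Proof.
move=> mXYZ /(sqnorm_eq0 mu measurableT mXYZ); apply: filterS => w /(_ I) /eqP.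
by rewrite subr_eq0 => /eqP.
Qed.

Lemma ou_domain_combine a F H : ou_domain P1 B F -> ou_domain P1 B H ->
  ou_domain P1 B (fun w => a * F w + H w).
Proof.
move=> [f fF ef] [h hH eh].
have [sf mf cf] := chaos_expansionP fF; have [sh mh ch] := chaos_expansionP hH.
pose k n (x : n.-tuple mR) := a * f n x + h n x.
have kE : set_kernel k = fun n x => a * set_kernel f x + set_kernel h x.
  apply/functional_extensionality_dep => n; apply/funext => x.
  by rewrite /set_kernel /k mulrDr mulrCA.
have kK : chaos_expansion P1 B k (fun w => a * F w + H w).
  have [sf' Lf _] := fF; have [sh' Lh _] := hH; split.
  - by move=> n s x; rewrite /k sf' sh'.
  - move=> n; have mo := @measurable_orthant R n.
    exact: (L2D mo (L2Z mo a (Lf n)) (Lh n)).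
  - rewrite chaos_integralE kE.
    exact: (kernels_integral_combine measurableT sysB a cf ch).
exists k; first exact: kK.
apply: (finite_energyP kK).2; rewrite kE /energy.
have ef' := (finite_energyP fF).1 ef; have eh' := (finite_energyP hH).1 eh.
have mS n := @measurable_simplex R n.
have mf' n : measurable_fun (@simplex R n) (set_kernel f (n := n)).
  by apply: measurable_funS (mf n); [exact: measurable_orthant|exact: simplex_orthant].
have mh' n : measurable_fun (@simplex R n) (set_kernel h (n := n)).
  by apply: measurable_funS (mh n); [exact: measurable_orthant|exact: simplex_orthant].
apply: (@le_lt_trans _ _ (\sum_(0 <= n <oo) ((2 * a ^+ 2)%:E * (n%:R%:E *
    sqnorm (nleb n) (@simplex R n) (set_kernel f (n := n))) +
    2%:E * (n%:R%:E * sqnorm (nleb n) (@simplex R n) (set_kernel h (n := n)))))%E).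
  apply: lee_nneseries => [n _ _|n _]; first by rewrite mule_ge0 ?sqnorm_ge0.
  have ma : measurable_fun (@simplex R n) (fun x => a * set_kernel f x).
    exact: (measurable_funM (measurable_cst _) (mf' n)).
  have := sqnorm_add_le (nleb n) (mS n) ma (mh' n).
  rewrite (sqnormZ (nleb n) (mS n) a (mf' n)) => h1.
  apply: (@le_trans _ _ (n%:R%:E *
    (2%:E * ((a ^+ 2)%:E * sqnorm (nleb n) (@simplex R n) (set_kernel f (n := n))) +
     2%:E * sqnorm (nleb n) (@simplex R n) (set_kernel h (n := n))))%E).
    by rewrite lee_wpmul2l ?lee_fin.
  rewrite ge0_muleDr ?mule_ge0 ?sqnorm_ge0// ?lee_fin ?sqr_ge0//.
  by rewrite !muleA -!EFinM [n%:R * 2]mulrC -mulrA [n%:R * _]mulrC mulrA.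
rewrite nneseriesD; last 2 first.
- by move=> n _; rewrite mule_ge0 ?mule_ge0 ?sqnorm_ge0// lee_fin mulr_ge0 ?sqr_ge0.
- by move=> n _; rewrite mule_ge0 ?mule_ge0 ?sqnorm_ge0.
rewrite !nneseriesZl; try by move=> n _; rewrite mule_ge0 ?sqnorm_ge0.
apply: lte_add_pinfty; apply: lte_mul_pinfty => //.
  by rewrite lee_fin mulr_ge0 ?sqr_ge0.
Qed.

Section operator.
Variable S : (T1 -> R) -> T1 * T2 -> R.
Hypothesis hS : sharp_operator P1 P2 B M S.

(** Besides linearity it yields, with [a = 0], that [S] respects almost sure equality. *)
Lemma sharp_combine a F H K : ou_domain P1 B F -> ou_domain P1 B H -> ou_domain P1 B K ->
  sqnorm P1 setT (fun w => K w - (a * F w + H w)) = 0%E ->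
  {ae P, forall w, S K w = a * S F w + S H w}.
Proof.
move=> /hS[DF mF iF] /hS[DH mH iH] /hS[DK mK iK] KFH.
have LD G DG : malliavin_derivative P1 B G DG -> L2 Q QD (fun p => DG p.1 p.2).
  by move=> [f _ []].
have := integral_dM_combine (LD _ _ mF) (LD _ _ mH) (LD _ _ mK) iF iH iK
  (malliavin_combine mF mH mK KFH).
apply: ae_eq_combine; have [LF _] := iF; have [LH _] := iH; have [LK _] := iK.
exact: L2_measurable (L2B measurableT LK (L2D measurableT (L2Z measurableT a LF) LH)).
Qed.

Lemma ou_domain_L2 F : ou_domain P1 B F -> L2 P1 setT F.
Proof. by move=> [f [_ _ []]]. Qed.

Lemma sqnorm_replace a (F H K : T1 -> R) : L2 P1 setT F -> L2 P1 setT H -> L2 P1 setT K ->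
  {ae P1, forall w, K w = a * F w + H w} ->
  sqnorm P1 setT (fun w => K w - (a * F w + H w)) = 0%E.
Proof.
move=> LF LH LK KFH.
have Ld := L2B measurableT LK (L2D measurableT (L2Z measurableT a LF) LH).
apply/(sqnorm_eq0 P1 measurableT (L2_measurable Ld)).
by apply: filterS KFH => w -> _; rewrite subrr.
Qed.

Lemma sharp_gradient : ou_gradient P1 P2 B S.
Proof.
split.
- by move=> F /hS[DF _ []].
- move=> F H dF dH FH; have LF := ou_domain_L2 dF; have LH := ou_domain_L2 dH.
  have := @sharp_combine 0 F H F dF dH dF (sqnorm_replace LF LH LF _).
  move=> h; apply: filterS (h _) => [w ->|]; first by rewrite mul0r add0r.
  by apply: filterS FH => w ->; rewrite mul0r add0r.
- move=> a F H dF dH; have dK := ou_domain_combine a dF dH; split => //.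
  by apply: (sharp_combine dF dH dK); exact: sqnorm_subrr.
(* [DF] need not be the derivative behind [S F]; the case [a = 0] of [malliavin_combine] identifies
   the two almost everywhere. *)
- move=> F DF dF mDF; have [DF0 mDF0 [_ hSF]] := hS dF.
  have LF := ou_domain_L2 dF.
  have FF : {ae P1, forall w, F w = 0 * F w + F w}.
    by apply: aeW => w; rewrite mul0r add0r.
  have := malliavin_combine mDF mDF0 mDF (sqnorm_replace LF LF LF FF).
  have [_ _ [LDF _]] := mDF; have [_ _ [LDF0 _]] := mDF0.
  have Ld := L2B mQD LDF (L2D mQD (L2Z mQD 0 LDF) LDF0).
  move=> /(sqnorm0_section1 P1 leb mhalf (L2_measurable Ld)) h0.
  apply: filterS (filterI h0 hSF) => w [h1 h2].
  have m1 := measurable_section1 mhalf (L2_measurable LDF) w.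
  have m2 := measurable_section1 mhalf (L2_measurable LDF0) w.
  rewrite (kernel_integral_thead sysM m2 h2) /carre_du_champ.
  apply: (sqnorm_ae mhalf m2 m1).
  have md := measurable_section1 mhalf (L2_measurable Ld) w.
  have := (sqnorm_eq0 leb mhalf md).1 h1.
  by apply: filterS => s /[apply] /eqP; rewrite /= mul0r add0r subr_eq0 => /eqP.
Qed.

End operator.

Lemma sharp_operator_exists : exists S, sharp_operator P1 P2 B M S.
Proof.
have h (F : T1 -> R) : exists G, ou_domain P1 B F ->
    exists2 DF, malliavin_derivative P1 B F DF & integral_dM P1 P2 M DF G.
  have [[f fF ef]|nF] := pselect (ou_domain P1 B F); last by exists (fun=> 0).
  by have [DF [G [mD iD _]]] := sharp_exists fF ef; exists G => _; exists DF.
by have [S hS] := choice h; exists S.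
Qed.

End gradient.

(** * The limit of the difference quotients *)

Section weights.
Variable R : realType.
Implicit Types theta : R.

Lemma sin_mean_value theta : exists c, sin theta = cos c * theta.
Proof.
have pos t : 0 <= t -> exists c, sin t = cos c * t :> R.
  move=> t0; have [|c _] := @MVT_segment R sin cos 0 t t0 (fun x _ => is_derive_sin x).
    by apply: continuous_subspaceT; exact: continuous_sin.
  by rewrite sin0 !subr0; exists c.
have [t0|t0] := leP 0 theta; first exact: pos.
have [|c hc] := pos (- theta); first by rewrite oppr_ge0 ltW.
by exists c; move: hc; rewrite sinN mulrN => /oppr_inj.
Qed.

Lemma sqr_sin_le theta : sin theta ^+ 2 <= theta ^+ 2.
Proof.
have [c ->] := sin_mean_value theta; rewrite exprMn ler_piMl ?sqr_ge0//.
Qed.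

(** The left side is 4 sin^2 (theta / 2), and |sin x| <= |x|. *)
Lemma cos_quadratic theta : 2 * (1 - cos theta) <= theta ^+ 2.
Proof.
have e : theta / 2 *+ 2 = theta by rewrite mulr2n; field.
have := cos_mulr2n (theta / 2); rewrite e => ->.
have := sqr_sin_le (theta / 2); have := cos2Dsin2 (theta / 2).
rewrite expr_div_n -natrX; move: (cos _ ^+ 2) (sin _ ^+ 2) => c s cs sle.
rewrite (_ : 2 * (1 - (c *+ 2 - 1)) = 4 * s); first by lra.
by rewrite mulr2n; lra.
Qed.

(** Bounds the weight of the remainder divided by n theta^2. At theta = 0 the quotient is read as 0,
    which gives the value 2, still between 0 and 4. *)
Definition cosine_defect theta n : R := 2 * (1 - cos theta ^+ n.-1 * (sin theta / theta)).

Lemma cosine_defect_bounds theta n : 0 <= cosine_defect theta n <= 4.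
Proof.
have [c hc] := sin_mean_value theta.
have h : `|cos theta ^+ n.-1 * (sin theta / theta)| <= 1.
  rewrite normrM normrX -[leRHS]mul1r ler_pM// ?exprn_ile1// ?cos_max//.
  have [->|t0] := eqVneq theta 0; first by rewrite invr0 mulr0 normr0.
  by rewrite hc mulfK// cos_max.
move: h; rewrite ler_norml => /andP[h1 h2]; rewrite /cosine_defect.
by apply/andP; split; lra.
Qed.

(** 1 - cos^n theta <= n (1 - cos theta), since the powers in the geometric sum are at most 1. With
    [cos_quadratic], the first and last terms of the weight add up to at most 2 n theta^2. *)
Lemma remainder_weight_le theta n : theta != 0 ->
  remainder_weight theta n <= theta ^+ 2 * (cosine_defect theta n * n%:R).
Proof.
move=> t0; have h1 : 2 * (1 - cos theta ^+ n) <= n%:R * theta ^+ 2.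
  apply: (@le_trans _ _ (n%:R * (2 * (1 - cos theta)))); last first.
    by rewrite ler_wpM2l// cos_quadratic.
  have -> : 1 - cos theta ^+ n = (1 - cos theta) * \sum_(i < n) cos theta ^+ i.
    by rewrite -opprB subrX1 -mulNr opprB.
  rewrite mulrCA [n%:R * _]mulrC mulrCA mulrA ler_wpM2l//.
  rewrite -[leRHS]mulr1 -[n in n%:R]card_ord -sum1_card natr_sum mulr_suml.
  apply: ler_sum => i _; rewrite mulr1.
  apply: le_trans (ler_norm _) _; rewrite normrX.
  by rewrite exprn_ile1// cos_max.
rewrite /remainder_weight /cosine_defect.
have -> : theta ^+ 2 * (2 * (1 - cos theta ^+ n.-1 * (sin theta / theta)) * n%:R) =
   n%:R * theta ^+ 2 - 2 * n%:R * cos theta ^+ n.-1 * sin theta * theta + n%:R * theta ^+ 2.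
  by field.
by rewrite !lerD2r.
Qed.

Lemma sinc_cvg : (fun theta : R => sin theta / theta) @ 0^' --> (1 : R).
Proof.
have h := @ex_derive _ _ _ _ _ _ _ (is_derive_sin (0 : R)).
have e : 'D_1 sin (0 : R) = 1 by rewrite derive_val cos0.
rewrite -[X in _ --> X]e.
rewrite (_ : (fun theta : R => sin theta / theta) =
  (fun h => h^-1 *: ((sin \o shift 0) (h *: 1) - sin 0)) :> (R -> R)); first exact: h.
by apply/funext => x /=; rewrite sin0 subr0 addr0 scaler1 mulrC.
Qed.

Lemma cosine_defect_cvg n : (fun theta => cosine_defect theta n) @ 0^' --> (0 : R).
Proof.
rewrite [X in _ --> X](_ : 0 = 2 * (1 - 1 ^+ n.-1 * 1)); last by rewrite expr1n mulr1 subrr mulr0.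
apply: cvgM; first exact: cvg_cst.
apply: cvgB; first exact: cvg_cst.
apply: cvgM; last exact: sinc_cvg.
have h : cos @ 0^' --> (1 : R).
  apply: cvg_within_filter; have := @continuous_cos R 0.
  by rewrite /continuous_at cos0.
elim: n.-1 => [|m ih]; first by rewrite expr0; under eq_fun do rewrite expr0; exact: cvg_cst.
by under eq_fun do rewrite exprS; rewrite exprS; exact: cvgM.
Qed.

Lemma dominated_series_cvg0 (u : R -> nat -> R) (b : nat -> \bar R) :
  (forall theta n, 0 <= u theta n <= 4) ->
  (forall n, (fun theta => u theta n) @ 0^' --> (0 : R)) ->
  (forall n, 0 <= b n)%E -> (\sum_(0 <= n <oo) b n < +oo)%E ->
  (fun theta => (\sum_(0 <= n <oo) (u theta n)%:E * b n)%E) @ 0^' --> 0%E.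
Proof.
move=> u4 u0 b0 boo.
have t0 theta n : (0 <= (u theta n)%:E * b n)%E.
  by rewrite mule_ge0// lee_fin; have /andP[] := u4 theta n.
apply/cvge0P => [theta|e e0].
  by apply: nneseries_ge0 => n _ _.
(* Four times this tail is half of [e]; the finitely many other terms take the other half. *)
have e8 : 0 < e / 8 by rewrite divr_gt0.
have [|N hN] := (cvge0_seqP _).1 (nneseries_tail_cvg boo (fun k _ => b0 k)) _ e8.
  by move=> k; apply: nneseries_ge0 => n _ _.
have bfin n : b n \is a fin_num.
  rewrite ge0_fin_numE//; apply: le_lt_trans boo.
  rewrite (nneseriesD1 (n := n) (P := xpredT) (fun k _ => b0 k) isT) leeDl//.
  by apply: nneseries_ge0.
have head : \forall theta \near 0^', (\sum_(0 <= n < N) (u theta n)%:E * b n <= (e / 2)%:E)%E.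
  have : (fun theta => \sum_(0 <= n < N) u theta n * fine (b n)) @ 0^' --> (0 : R).
    rewrite [X in _ --> X](_ : 0 = \sum_(0 <= n < N) 0 * fine (b n)); last first.
      by rewrite big1// => n _; rewrite mul0r.
    elim: N {hN} => [|N ih].
      by under eq_fun do rewrite big_geq//; rewrite big_geq//; exact: cvg_cst.
    under eq_fun do rewrite big_nat_recr//=; rewrite big_nat_recr//=.
    by apply: cvgD => //; apply: cvgM => //; exact: cvg_cst.
  move=> /cvgrPdist_le/(_ (e / 2)); rewrite divr_gt0// => /(_ isT).
  apply: filterS => theta; rewrite sub0r normrN => h.
  rewrite (eq_bigr (fun n => (u theta n * fine (b n))%:E)); last first.
    by move=> n _; rewrite EFinM fineK.
  by rewrite sumEFin lee_fin; apply: le_trans h; exact: ler_norm.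
apply: filterS head => theta h.
rewrite (nneseries_split 0 N)//= add0n.
have -> : e%:E = ((e / 2)%:E + (e / 2)%:E)%E by rewrite -EFinD; congr EFin; field.
apply: leeD => //.
apply: (@le_trans _ _ (\sum_(N <= n <oo) 4%:E * b n)%E).
  apply: lee_nneseries => [n _ _|n _]; first exact: t0.
  by apply: lee_wpmul2r => //; rewrite lee_fin; have /andP[] := u4 theta n.
rewrite nneseriesZl//; apply: (@le_trans _ _ (4%:E * (e / 8)%:E)%E).
  by apply: lee_wpmul2l => //; exact: hN.
by rewrite -EFinM lee_fin; lra.
Qed.

End weights.

Section limit.
Context {R : realType} {d1 d2 : measure_display}
  {T1 : measurableType d1} {T2 : measurableType d2}.
Variables (P1 : probability T1 R) (P2 : probability T2 R).
Variables (B : R -> T1 -> R) (M : R -> T2 -> R).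

Local Notation mR := (measurableTypeR R).
Local Notation leb := (@lebesgue_measure R).
Local Notation nleb := (nlebesgue R).
Local Notation steps n := (seq (R * n.-tuple (R * R))).
Local Notation P := (P1 \x P2)%E.
Local Notation Q := (P1 \x leb)%E.
Local Notation half := (`]0%R, +oo[%classic : set mR).
Local Notation QD := ([set: T1] `*` half).
Local Notation PhiB := (@increment_product R T1 B).
Local Notation PhiM := (@increment_product R T2 M).
Local Notation PhiD := (@derivative_product R _ T1 B).
Local Notation PhiG := (@replaced_product R _ (T1 * T2)%type (process1 B) (process2 M)).

Hypotheses (sysB : orthogonal_system P1 setT PhiB (fun=> 1))
  (sysM : orthogonal_system P2 setT PhiM (fun=> 1))
  (sysG : orthogonal_system P setT PhiG (fun n => n%:R))
  (sysD : orthogonal_system Q QD PhiD (fun n => n%:R)).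
Hypothesis fibers : forall n (c : steps n) w, rectangles c ->
  kernel_integral P2 setT PhiM (fun x : 1.-tuple mR => simple_integral PhiD c (w, thead x))
    (fun w2 => simple_integral PhiG c (w, w2)).
Hypotheses (sysY : forall theta, orthogonal_system P setT
    (@increment_product R (T1 * T2)%type (rotated B M theta)) (fun=> 1))
  (sysR : forall theta, orthogonal_system P setT
    (remainder_system (process1 B) (process2 M) theta) (remainder_weight theta)).

Local Notation PhiY theta := (@increment_product R (T1 * T2)%type (rotated B M theta)).

Lemma sqnorm_fst (h : T1 -> R) : measurable_fun setT h ->
  sqnorm P setT (fun w => h w.1) = sqnorm P1 setT h.
Proof.
move=> mh; have := sqnorm_tensor P1 P2 mh (measurable_cst (1 : R)).
under [X in sqnorm P _ X]funext do rewrite mulr1.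
move=> ->; rewrite [X in (_ * X)%E](_ : _ = 1%E) ?mule1//.
by rewrite (sqnormE measurableT (L2_cst P2 1)) ip11.
Qed.

Lemma L2_fst (h : T1 -> R) : L2 P1 setT h -> L2 P setT (fun w => h w.1).
Proof.
move=> [mh hoo]; split; last by rewrite sqnorm_fst.
exact: (measurableT_comp mh measurable_fst).
Qed.

Lemma L2cvg_fst (u : nat -> T1 -> R) X : (forall k, L2 P1 setT (u k)) -> L2 P1 setT X ->
  L2cvg P1 setT u X -> L2cvg P setT (fun k w => u k w.1) (fun w => X w.1).
Proof.
move=> Lu LX; apply: L2cvg_transfer => k.
exact: (sqnorm_fst (L2_measurable (L2B measurableT (Lu k) LX))).
Qed.

(** Y^0 = B, so F itself, read on the product space, is a version of F^0; this links the two
    difference quotients. *)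
Lemma kernels_integral_fst (F : forall n, n.-tuple mR -> R) X :
  kernels_integral P1 setT PhiB F X ->
  kernels_integral P setT (PhiY 0) F (fun w => X w.1).
Proof.
move=> [LX [J [FJ cJ]]]; have LJ n : L2 P1 setT (J n) by have [] := FJ n.
have LS N : L2 P1 setT (fun w => \sum_(0 <= n < N) J n w) by exact: L2_sum.
split; first exact: L2_fst.
exists (fun n w => J n w.1); split; last exact: (L2cvg_fst LS LX cJ).
move=> n; have [Lf _ [c [rc cf cX]]] := FJ n.
split => //; first exact: L2_fst.
exists c; split => //.
apply: L2cvg_eq (L2cvg_fst (fun k => L2_simple measurableT sysB (rc k)) (LJ n) cX) => k w.
rewrite /simple_integral; apply: eq_bigr => p _; congr (_ * _).
by apply: eq_bigr => i _; rewrite /rotated cos0 sin0 !mulr1 !mulr0 !addr0.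
Qed.

(** All Y^theta have weight 1, like B, so the steps of F can be reused and the series for F^theta
    has the same norms as that for F. *)
Lemma kernels_integral_rotated (F : forall n, n.-tuple mR -> R) X theta :
  kernels_integral P1 setT PhiB F X ->
  exists Z, kernels_integral P setT (PhiY theta) F Z.
Proof.
move=> FX; have [LX [J [FJ _]]] := FX.
have h n : exists K, kernel_integral P setT (PhiY theta) (@F n) K.
  have [Lf _ [c [rc cf _]]] := FJ n.
  exact: (kernel_integral_exists measurableT (sysY theta) Lf rc cf).
have [K FK] := choice h.
have [|Z LZ cZ] := kernels_integral_exists measurableT (sysY theta) FK.
  by rewrite -(kernels_integral_sqnorm measurableT sysB FX); have [] := LX.
by exists Z; split => //; exists K.
Qed.

Lemma kernels_integral_remainder (F : forall n, n.-tuple mR -> R) G Z0 Z theta :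
  kernels_integral P setT PhiG F G -> kernels_integral P setT (PhiY 0) F Z0 ->
  kernels_integral P setT (PhiY theta) F Z ->
  kernels_integral P setT (remainder_system (process1 B) (process2 M) theta) F
    (fun w => -1 * (theta * G w + Z0 w) + Z w).
Proof.
move=> FG F0 FZ; have [LG _ _] := sysG; have [L0 _ _] := sysY 0.
have h := kernels_integral_system measurableT theta LG (sysY 0) FG F0.
apply: (kernels_integral_system measurableT (-1) _ (sysY theta) h FZ) => n b rb.
exact: (L2D measurableT (L2Z measurableT theta (LG n b rb)) (L0 n b rb)).
Qed.

(** The domain provides some expansion of finite energy; by uniqueness of kernels the given one has
    the same energy. *)
Lemma energy_domain (f : forall n, n.-tuple mR -> R) F : ou_domain P1 B F ->
  chaos_expansion P1 B f F -> finite_energy f.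
Proof.
move=> [g gF eg] fF; apply/(finite_energyP fF).2; have {eg} := (finite_energyP gF).1 eg.
have [_ mf cf] := chaos_expansionP fF; have [_ mg cg] := chaos_expansionP gF.
rewrite (_ : energy (set_kernel f) = energy (set_kernel g))//.
apply: congr_lim; apply/funext => N; apply: eq_bigr => n _; congr (_ * _)%E.
have mS := @measurable_simplex R n.
have mf' : measurable_fun (@simplex R n) (set_kernel f (n := n)).
  by apply: measurable_funS (mf n); [exact: measurable_orthant|exact: simplex_orthant].
have mg' : measurable_fun (@simplex R n) (set_kernel g (n := n)).
  by apply: measurable_funS (mg n); [exact: measurable_orthant|exact: simplex_orthant].
have e0 := kernels_integral_inj measurableT sysB cf cg (sqnorm_subrr P1 setT F) (ltr01 : 0 < 1).
have md := measurable_funB mf' mg'.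
apply: (sqnorm_ae mS mf' mg').
apply: filterS ((sqnorm_eq0 (nleb n) mS md).1 (e0 n)) => x /[apply] /eqP.
by rewrite subr_eq0 => /eqP.
Qed.

Section operator.
Variables (S : (T1 -> R) -> T1 * T2 -> R) (F : T1 -> R) (f : forall n, n.-tuple mR -> R).
Hypotheses (hS : sharp_operator P1 P2 B M S) (dF : ou_domain P1 B F)
  (fF : chaos_expansion P1 B f F).

(** [S F] is only known through some derivative and its integral against M. This ties it to the
    series of replaced products, whose kernels are those of F^theta. *)
Lemma sharp_kernels : exists2 G, kernels_integral P setT PhiG (set_kernel f) G &
  {ae P, forall w, S F w = G w}.
Proof.
have ef := energy_domain dF fF.
have [DF0 [G [mDF0 iDF0 hG]]] := sharp_exists sysB sysM sysG sysD fibers fF ef.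
exists G => //; have [DF mDF iDF] := hS dF.
have LF := ou_domain_L2 dF.
have FF : {ae P1, forall w, F w = 0 * F w + F w} by apply: aeW => w; rewrite mul0r add0r.
have e := malliavin_combine sysB mDF0 mDF0 mDF (sqnorm_replace LF LF LF FF).
have [_ _ [LDF _]] := mDF; have [_ _ [LDF0 _]] := mDF0.
have := integral_dM_combine sysM LDF0 LDF0 LDF iDF0 iDF0 iDF e.
have [LG _] := iDF0; have [LSF _] := iDF.
have Ld := L2B measurableT LSF (L2D measurableT (L2Z measurableT 0 LG) LG).
move=> /(ae_eq_combine (L2_measurable Ld)); apply: filterS => w ->.
by rewrite mul0r add0r.
Qed.

Variable Z : R -> T1 * T2 -> R.
Hypothesis hZ : forall theta, kernels_integral P setT (PhiY theta) (set_kernel f) (Z theta).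

Let LZ theta : L2 P setT (Z theta).
Proof. by have [] := hZ theta. Qed.

Let LSF : L2 P setT (S F).
Proof. by have [DF _ []] := hS dF. Qed.

(** The difference quotient minus G is theta^-1 times the remainder, whose squared norm is the
    series with [remainder_weight]; the theta^2 in the bound for the weight cancels. *)
Lemma quotient_sqnorm_le theta : theta != 0 ->
  (sqnorm P setT (fun w => (Z theta w - Z 0 w) / theta - S F w)%R <=
   \sum_(0 <= n <oo) (cosine_defect theta n)%:E *
     (n%:R%:E * sqnorm (nleb n) (@simplex R n) (set_kernel f (n := n))))%E.
Proof.
move=> t0; have [G hG SG] := sharp_kernels; have LG : L2 P setT G by case: hG.
have hR := kernels_integral_remainder hG (hZ 0) (hZ theta); have [LR _] := hR.
have LQ : L2 P setT (fun w => (Z theta w - Z 0 w) / theta - S F w).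
  apply: (L2B measurableT _ LSF).
  have := L2Z measurableT theta^-1 (L2B measurableT (LZ theta) (LZ 0)).
  by congr L2; apply/funext => w; rewrite mulrC.
rewrite (sqnorm_ae measurableT (L2_measurable LQ)
  (L2_measurable (L2Z measurableT theta^-1 LR))); last first.
  by apply: filterS SG => w -> _; field.
rewrite (sqnormZ P measurableT theta^-1 (L2_measurable LR)).
rewrite (kernels_integral_sqnorm measurableT (sysR theta) hR).
have [_ w0 _] := sysR theta.
rewrite -nneseriesZl; last by move=> n _; rewrite mule_ge0 ?sqnorm_ge0 ?lee_fin.
apply: lee_nneseries => [n _ _|n _].
  by rewrite !mule_ge0 ?sqnorm_ge0 ?lee_fin ?sqr_ge0.
rewrite !muleA -!EFinM; apply: lee_wpmul2r; first exact: sqnorm_ge0.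
rewrite lee_fin exprVn mulrC ler_pdivrMr ?exprn_even_gt0//.
by rewrite [leRHS]mulrC; exact: remainder_weight_le.
Qed.

Lemma quotient_cvg : L2_lim0 P1 P2 (fun theta w => (Z theta w - Z 0 w) / theta) (S F).
Proof.
have b0 n : (0 <= n%:R%:E * sqnorm (nleb n) (@simplex R n) (set_kernel f (n := n)))%E.
  by rewrite mule_ge0 ?sqnorm_ge0 ?lee_fin.
have boo := (finite_energyP fF).1 (energy_domain dF fF).
have h := dominated_series_cvg0 (fun theta n => cosine_defect_bounds theta n)
  (fun n => cosine_defect_cvg (R := R) n) b0 boo.
apply/cvge0P => [theta|e e0]; first exact: sqnorm_ge0.
have := (cvge0P _).1 h e e0; move=> /(_ _)h'.
have {h'} : \forall theta \near 0^', (\sum_(0 <= n <oo) (cosine_defect theta n)%:E *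
     (n%:R%:E * sqnorm (nleb n) (@simplex R n) (set_kernel f (n := n))) <= e%:E)%E.
  apply: h' => theta; apply: nneseries_ge0 => n _ _; apply: mule_ge0 => //.
  by rewrite lee_fin; have /andP[] := cosine_defect_bounds theta n.
apply: filterS2 (nbhs_dnbhs_neq (0 : R)) => theta t0.
exact: le_trans (quotient_sqnorm_le t0).
Qed.

Lemma quotient_cvg_fst : L2_lim0 P1 P2 (fun theta w => theta^-1 * (Z theta w - F w.1)) (S F).
Proof.
have [_ _ cF] := chaos_expansionP fF; have hF := kernels_integral_fst cF.
have LF : L2 P setT (fun w => F w.1) by case: hF.
have e0 : {ae P, forall w, Z 0 w = F w.1}.
  have := kernels_integral_unique measurableT (sysY 0) (hZ 0) hF (fun n => sqnorm_subrr _ _ _).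
  have Ld := L2B measurableT (LZ 0) LF.
  move=> /(sqnorm_eq0 P measurableT (L2_measurable Ld)); apply: filterS => w /(_ I) /eqP.
  by rewrite subr_eq0 => /eqP.
have := quotient_cvg; rewrite /L2_lim0.
have -> // : (fun theta => sqnorm P setT (fun w => (Z theta w - Z 0 w) / theta - S F w)) =
  (fun theta => sqnorm P setT (fun w => theta^-1 * (Z theta w - F w.1) - S F w)).
apply/funext => theta; apply: (sqnorm_ae measurableT).
- apply: L2_measurable (L2B measurableT _ LSF).
  have := L2Z measurableT theta^-1 (L2B measurableT (LZ theta) (LZ 0)).
  by congr L2; apply/funext => w; rewrite mulrC.
- apply: L2_measurable (L2B measurableT _ LSF).
  exact: (L2Z measurableT theta^-1 (L2B measurableT (LZ theta) LF)).
by apply: filterS e0 => w -> _; rewrite mulrC.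
Qed.

End operator.
End limit.

Theorem proposition7 (R : realType) (d1 d2 : measure_display)
    (T1 : measurableType d1) (T2 : measurableType d2)
    (P1 : probability T1 R) (P2 : probability T2 R)
    (B : R -> T1 -> R) (M : R -> T2 -> R)
    (hB : wiener_space P1 B) (hM : normal_martingale P2 M) :
  (exists S, sharp_operator P1 P2 B M S) /\
  forall S : (T1 -> R) -> T1 * T2 -> R, sharp_operator P1 P2 B M S ->
    ou_gradient P1 P2 B S /\
    forall (F : T1 -> R) (f : forall n, n.-tuple (measurableTypeR R) -> R),
      ou_domain P1 B F -> chaos_expansion P1 B f F ->
      (forall theta : R, exists X,
         chaos_integral (P1 \x P2)%E (rotated B M theta) (set_kernel f) X) /\
      forall Ftheta : R -> T1 * T2 -> R,
        (forall theta : R,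
           chaos_integral (P1 \x P2)%E (rotated B M theta) (set_kernel f)
             (Ftheta theta)) ->
        L2_lim0 P1 P2
          (fun theta w => (Ftheta theta w - Ftheta 0 w) / theta) (S F) /\
        L2_lim0 P1 P2
          (fun theta w => theta^-1 * (Ftheta theta w - F w.1)) (S F).
Proof.
have [bB _] := hB.
have [fG1 adB LB zB vB] := brownian_orthogonal bB.
have [G2 [fG2 adM LM zM vM]] := normal_martingale_orthogonal hM.
have aV1 := past_family P1 fG1; have aV2 := past_family P2 fG2.
have cB := past_compatible fG1 adB vB; have cM := past_compatible fG2 adM vM.
have {}zB := past_centered fG1 adB LB zB vB; have {}zM := past_centered fG2 adM LM zM vM.
have {}vB := past_covariation fG1 adB vB; have {}vM := past_covariation fG2 adM vM.
have sysB := system_B aV1 cB zB vB; have sysM := system_M aV2 cM zM vM.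
have sysG := system_G aV1 aV2 cB cM zB zM vB vM.
have sysD := system_D aV1 aV2 cB cM zB zM vB vM.
have fibers := simple_fibers aV2 B cM zM vM.
have sysY := system_Y aV1 aV2 cB cM zB zM vB vM.
have sysR := system_R aV1 aV2 cB cM zB zM vB vM.
split; first exact: (sharp_operator_exists sysB sysM sysG sysD fibers).
move=> S hS; split; first exact: (sharp_gradient sysB sysM hS).
move=> F f dF fF; split.
  move=> theta; have [_ _ cF] := chaos_expansionP fF.
  exact: (kernels_integral_rotated sysB sysY theta cF).
move=> Z hZ; split.
  exact: (quotient_cvg sysB sysM sysG sysD fibers sysY sysR hS dF fF hZ).
exact: (quotient_cvg_fst sysB sysM sysG sysD fibers sysY sysR hS dF fF hZ).
Qed.
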